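(* Let $d \geq 2$ be an integer and let $r$ be the smallest prime divisor of $d$. Let $m$ be a positive integer such that $\operatorname{rad}(m) \mid \operatorname{rad}(d)$. If $q \equiv 1 \pmod d$ is an odd prime power such that $$ q>(8\log_r m+4)d^2m^2, $$ then there is a maximal clique $C$ in the $d$-Paley graph $GP(q^d,d)$ with size $|C|=\frac{q}{m}+O(d\log m\sqrt{q})$. More precisely, $$ \frac{q}{m}-d\log_r m \cdot \sqrt{q}\leq |C|\leq \frac{q}{m}+d\log_r m \cdot (\sqrt{q}+1). $$
   Context: For a positive integer $m$, the radical $\operatorname{rad}(m)$ is the product of the distinct prime divisors of $m$ (so $\operatorname{rad}(1)=1$), and $\log_r$ denotes the base-$r$ logarithm. For an integer $d\ge 2$ and a prime power $Q\equiv 1 \pmod{2d}$, the $d$-Paley graph $GP(Q,d)$ is the graph with vertex set the finite field $\mathbb{F}_Q$ in which two vertices are adjacent if and only if their difference is a $d$-th power in $\mathbb{F}_Q^*=\mathbb{F}_Q\setminus\{0\}$. A clique is a set of vertices any two distinct elements of which are adjacent; a maximal clique is a clique that cannot be extended to a larger clique by adding a new vertex. The precise meaning of the $O$-estimate is given by the displayed explicit inequalities. *)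

(* Defs.v *)
From HB Require Import structures.
From mathcomp Require Import all_boot all_order all_algebra all_field.
From mathcomp Require Import reals exp.

Set Implicit Arguments.
Unset Strict Implicit.
Unset Printing Implicit Defensive.

Import Order.TTheory GRing.Theory Num.Theory.
Local Open Scope ring_scope.

Definition radn (m : nat) : nat := (\prod_(p <- primes m) p)%N.

Definition prime_power (q : nat) : Prop :=
  exists p k : nat, [/\ prime p, (0 < k)%N & q = (p ^ k)%N].

Definition logb (R : realType) (b x : R) : R := ln x / ln b.

(* Adjacency of the d-Paley graph GP(#|F|, d) on the vertex set F.  It is
   irreflexive since z != 0, and symmetric when #|F| = 1 %[mod 2 * d], because
   -1 is then a d-th power.  That congruence is automatic if #|F| = q ^ d with
   q odd and q = 1 %[mod d]. *)
Definition paley (F : finFieldType) (d : nat) : rel F :=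
  fun x y => [exists z : F, (z != 0) && (x - y == z ^+ d)].
Arguments paley : clear implicits.

Definition clique (T : finType) (e : rel T) (C : {set T}) : Prop :=
  {in C &, forall x y, x != y -> e x y}.

Definition maximal_clique (T : finType) (e : rel T) (C : {set T}) : Prop :=
  clique e C /\ forall v : T, v \notin C -> ~ clique e (v |: C).

(* Main.v *)
Require Import Defs.
From HB Require Import structures.
From mathcomp Require Import all_boot all_order all_algebra all_field.
From mathcomp Require Import reals exp.
From mathcomp Require Import perm cyclic ring lra zify.

Set Implicit Arguments.
Unset Strict Implicit.
Unset Printing Implicit Defensive.

Import Order.TTheory GRing.Theory Num.Theory.
Local Open Scope ring_scope.

(** Let K be the subfield with q elements of F, which is a clique since d divides
    (q^d - 1)/(q - 1), and chi a character of order d of the unit group of F: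
    adjacency means chi(x - y) = 1. Write m = p_1 ... p_k with p_1 >= ... >= p_k
    primes dividing d. For theta in the extension of degree p of K, but not in K,
    chi(x - theta) is a p-th root of unity for all x in K, so that theta should be
    adjacent to about one p-th of a given subset of K. Points theta_1, ..., theta_k of
    degrees p_1, ..., p_k which are pairwise adjacent, and whose set A of common
    neighbours in K has nearly q/m elements, are found one after the other: the
    second moment of the number of neighbours of theta in the current A, with
    theta weighted by an indicator of being adjacent to the earlier points, is
    estimated by Weil's bound over the extension of degree p. In any maximal clique
    containing these points, K contributes exactly A. For a point theta outside K,
    the function chi(x - theta) equals 1 on A, and for theta running through the t
    Frobenius classes of such points these functions are almost orthogonal on K,
    whence t |A| <= q + t (2d - 1) sqrt q: the points outside K are few.

    Weil's bound is proved from the L-function of the sum, a polynomial whose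
    inverse roots are controlled by Stepanov's method. *)

(** The lower bounds used for q are 12 d^2 m^2 when m > 1 and 20 d^2 m^2 when m has at least two
    prime factors, however many there are. Errors therefore must not accumulate: each step divides
    the earlier error by p, so the total stays below 5/2 sqrt q, and log_r m enters only through its
    lower bounds 1 and 2. The tight case is p = 2, where theta runs over q^2 elements only and
    Weil's error has order q. Decreasing primes bound the degrees of the earlier points in terms of
    their own primes.

    Subfields are not built as types. The field with e elements is the set of solutions of x^e = x,
    and polynomials over it are those with P^e = P(X^e), so that degrees and conjugates are read off
    from Frobenius orbits inside one field.

    Stepanov's method gives the right order of magnitude with a poor constant, and here only over
    fields of square order. Neither matters for power sums of the inverse roots along multiples of
    an even degree: their growth rate bounds each root, and the number of roots then gives the sharp
    constant. *)

Lemma exists_linear_dependency (R : fieldType) (I J : finType)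
    (c : I -> J -> R) : (#|J| < #|I|)%N ->
  exists v : I -> R, (exists i, v i != 0) /\ forall j, \sum_i v i * c i j = 0.
Proof.
move=> ltJI; pose A := \matrix_(i < #|I|, j < #|J|) c (enum_val i) (enum_val j).
have /rowV0Pn[v /sub_kermxP vA v_neq0] : kermx A != 0.
  rewrite -mxrank_eq0 mxrank_ker subn_eq0 -ltnNge.
  exact: leq_ltn_trans (rank_leq_col A) ltJI.
exists (fun i => v 0 (enum_rank i)); split.
  have [i vi] : exists i, v 0 i != 0.
    apply/existsP; apply: contraNT v_neq0; rewrite negb_exists => /forallP v0.
    by apply/eqP/rowP=> i; rewrite mxE; apply/eqP; rewrite -[_ == _]negbK v0.
  by exists (enum_val i); rewrite enum_valK.
move=> j; have := congr1 (fun B : 'M_(_, _) => B 0 (enum_rank j)) vA.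
rewrite !mxE => vA0; rewrite -[RHS]vA0.
rewrite (reindex_onto (@enum_val I I) enum_rank) /=; last by move=> i _; rewrite enum_rankK.
apply: eq_big => [i|i _]; first by rewrite enum_valK eqxx.
by rewrite !mxE enum_rankK enum_valK.
Qed.

(** * Polynomial identities in positive characteristic *)

Section BivariateSubstitution.
Variable R : comNzRingType.

(* Outer variable x, inner variable z; [subst_frob Q w] is w(x, x^Q). *)
Definition subst_frob (Q : nat) : {poly {poly R}} -> {poly R} :=
  horner_eval 'X \o map_poly (comp_poly 'X^Q).

HB.instance Definition _ Q := GRing.RMorphism.copy (subst_frob Q)
  (horner_eval 'X \o map_poly (comp_poly 'X^Q)).

Lemma subst_frobE Q (w : {poly {poly R}}) :
  subst_frob Q w = \sum_(i < size w) (w`_i \Po 'X^Q) * 'X^i.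
Proof.
rewrite /subst_frob /= /horner_eval (@horner_coef_wide _ (size w)) ?size_poly //.
by apply: eq_bigr => i _; rewrite coef_map.
Qed.

(** An exponent [Q * l + j] with [j < Q] determines [l] and [j], so the monomials of [w] cannot
    cancel when z becomes x^Q. *)
Lemma subst_frob_inj Q (w : {poly {poly R}}) : (size w <= Q)%N -> subst_frob Q w = 0 -> w = 0.
Proof.
move=> szw w0; case: (posnP Q) => [Q0|Q_gt0].
  by apply/eqP; rewrite -size_poly_eq0 -leqn0 -Q0.
apply/polyP=> j; rewrite coef0.
have [lt_j|/(nth_default 0)->//] := ltnP j (size w).
apply/polyP=> l; rewrite coef0.
have := congr1 (fun p : {poly R} => p`_(Q * l + j)) w0.
rewrite subst_frobE coef0 coef_sum (bigD1 (Ordinal lt_j)) //= big1 ?addr0.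
  rewrite coefMXn ltnNge leq_addl /= addnK coef_comp_poly_Xn //.
  by rewrite dvdn_mulr // mulKn.
move=> i ne_ij; rewrite coefMXn; case: ltnP => // le_i.
rewrite coef_comp_poly_Xn //; case: ifP => // /dvdnP[t Dt].
have eq_ij : (i = j %[mod Q])%N.
  by rewrite -(modnMDl t i) -Dt subnK // mulnC modnMDl.
case/eqP: ne_ij; apply: val_inj => /=.
by rewrite -(modn_small (leq_trans (ltn_ord i) szw)) eq_ij modn_small // (leq_trans lt_j).
Qed.

End BivariateSubstitution.

Lemma exprBn_pchar (R : comNzRingType) (x y : R) n :
  [pchar R].-nat n -> (x - y) ^+ n = x ^+ n - y ^+ n.
Proof.
move=> n_pchar; have := exprDn_pchar (x - y) y n_pchar.
by rewrite subrK => ->; rewrite addrK.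
Qed.

(** * Hasse derivatives and multiplicities of roots *)

Section HasseDerivatives.

(** Hasse derivatives, unlike iterated ones, still detect multiplicities beyond the characteristic.
    Factorials are divided out, so Leibniz's rule has no binomial coefficients. *)
Lemma nderivnM (R : comNzRingType) (p q : {poly R}) n :
  (p * q)^`N(n) = \sum_(i < n.+1) p^`N(i) * q^`N(n - i).
Proof.
elim/poly_ind: p n => [|p c IHp] n.
  rewrite mul0r linear0 big1 // => i _.
  by rewrite linear0 mul0r.
case: n => [|n]; first by rewrite big_ord1 !nderivn0.
rewrite mulrDl mulrAC nderivnD.
have -> : ((p * q) * 'X)^`N(n.+1) = (p * q)^`N(n) + (p * q)^`N(n.+1) * 'X.
  by rewrite -[(p * q) * 'X]addr0 -(polyC0 R) nderivnMXaddC.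
rewrite mul_polyC nderivnZ !IHp -mul_polyC.
have -> : \sum_(i < n.+2) (p * 'X + c%:P)^`N(i) * q^`N(n.+1 - i)
    = (p * 'X + c%:P) * q^`N(n.+1)
      + (\sum_(i < n.+1) p^`N(i) * q^`N(n - i)
         + (\sum_(i < n.+1) p^`N(i.+1) * q^`N(n - i)) * 'X).
  rewrite big_ord_recl nderivn0 subn0 mulr_suml -big_split /=; congr (_ + _).
  by apply: eq_bigr => i _; rewrite /bump /= add1n nderivnMXaddC subSS; ring.
rewrite [in X in _ + X * 'X + _]big_ord_recl nderivn0 subn0 /=.
under [in X in _ + X * 'X + _]eq_bigr => i _ do rewrite /bump /= add1n subSS.
by ring.
Qed.

Lemma dvdp_nderivn_expM (R : fieldType) (g a : {poly R}) m e :
  (e <= m)%N -> (g ^+ (m - e) %| (g ^+ m * a)^`N(e)).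
Proof.
elim: m e => [|m IHm] e; first by rewrite leqn0 => /eqP->; rewrite dvd1p.
move=> le_em; rewrite exprS -mulrA nderivnM.
apply: (big_ind (fun x => _ %| x)) => [|x y|[i /= lt_i] _]; first exact: dvdp0.
  exact: dvdp_add.
case: i lt_i => [_|i lt_i].
  rewrite nderivn0 subn0; move: le_em; rewrite leq_eqVlt => /orP[/eqP->|].
    by rewrite subnn dvd1p.
  by rewrite ltnS => le_em; rewrite subSn // exprS dvdp_mul // IHm.
apply: dvdp_mull.
case: (leqP i.+1 e) => [lt_ie|lt_ei]; last first.
  move: lt_i; rewrite ltnS => lt_i'.
  by have := leq_ltn_trans lt_i' lt_ei; rewrite ltnS ltnn.
have le_em' : (e - i.+1 <= m)%N by rewrite leq_subLR (leq_trans le_em) // addSn ltnS leq_addl.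
apply: dvdp_trans (IHm _ le_em').
by apply: dvdp_exp2l; lia.
Qed.

(** The Hasse derivatives of ['X^Q] of orders 1 to [Q - 1] vanish, so powers of ['X^Q] behave as
    constants. Hence x^Q can be replaced by x after differentiation. *)
Lemma nderivn_frobM (R : comNzRingType) (Q l : nat) (a : {poly R}) e :
  [pchar R].-nat Q -> (e < Q)%N ->
  ('X^(Q * l) * a)^`N(e) = 'X^(Q * l) * a^`N(e).
Proof.
move=> pQ lt_eQ; elim: l => [|l IHl] in a *; first by rewrite muln0 !mul1r.
rewrite mulnS exprD -!mulrA -IHl; move: ('X^(Q * l) * a) => {IHl a}b.
rewrite nderivnM big_ord_recl nderivn0 subn0 big1 ?addr0 // => -[i /= lt_ie] _.
suff -> : ('X^Q : {poly R})^`N(i.+1) = 0 by rewrite mul0r.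
have iltQ : (i.+1 < Q)%N by apply: leq_ltn_trans lt_eQ.
(* Comparing coefficients in (X + 1)^Q = X^Q + 1 shows that the inner binomial coefficients of Q
   vanish in [R]. *)
have := exprDn_pchar ('X : {poly R}) 1 (_ : [pchar {poly R}].-nat Q).
rewrite (eq_pnat _ (pchar_poly R)) => /(_ pQ).
rewrite expr1n exprDn => /(congr1 (fun p : {poly R} => p`_(Q - i.+1))).
rewrite coef_sum (bigD1 (Ordinal (leqW iltQ : (i.+1 < Q.+1)%N))) //= big1 ?addr0.
  rewrite expr1n mulr1 coefMn coefXn eqxx coefD coefXn coef1 subn_eq0 leqNgt iltQ addr0.
  rewrite eqn_leq leq_subr /= leqNgt ltn_subrL /= (leq_trans _ iltQ) // => C0.
  by rewrite nderivnXn -mulr_natr -polyC_natr C0 mulr0.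
move=> j ne_ji; rewrite expr1n mulr1 coefMn coefXn.
case: eqP => [eqj|_]; last by rewrite mul0rn.
case/eqP: ne_ji; apply: val_inj => /=.
by rewrite -(subKn (ltnW iltQ)) eqj subKn // -ltnS.
Qed.

Lemma dvdp_XsubC_expP (R : fieldType) (P : {poly R}) (x : R) M :
  (forall e, (e < M)%N -> (P^`N(e)).[x] = 0) -> ('X - x%:P) ^+ M %| P.
Proof.
move=> P0; rewrite -[P]comp_polyXr.
have {2}-> : 'X = x%:P + ('X - x%:P) :> {poly R} by rewrite addrC subrK.
rewrite /comp_poly nderiv_taylor; last exact: mulrC.
apply: (big_ind (fun x => _ %| x)) => [|y z|[i /= _] _]; [exact: dvdp0 | exact: dvdp_add |].
rewrite nderivn_map /=; have [lt_iM|le_Mi] := ltnP i M.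
  by rewrite horner_map /= P0 // mul0r dvdp0.
by rewrite dvdp_mull // dvdp_exp2l.
Qed.

Lemma size_mul_leq_of_roots (R : fieldType) (P : {poly R}) (s : seq R) M :
  P != 0 -> uniq s -> {in s, forall x, ('X - x%:P) ^+ M %| P} ->
  (size s * M < size P)%N.
Proof.
move=> P_neq0 s_uniq sP.
have prod_dvd : \prod_(x <- s) ('X - x%:P) ^+ M %| P.
  elim: s s_uniq sP => [|x s IHs]; first by rewrite big_nil dvd1p.
  move=> /andP[s'x s_uniq] sP; rewrite big_cons Gauss_dvdp.
    rewrite sP ?mem_head //= IHs // => y sy; apply: sP; exact: mem_behead.
  rewrite coprimep_expl // big_seq.
  apply: (big_ind (fun p => coprimep _ p)) => [|p q cp cq|y sy].
  - by rewrite coprimep1.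
  - by rewrite coprimepMr cp.
  rewrite coprimep_expr // coprimep_XsubC root_XsubC.
  by apply: contraNneq s'x => <-.
have := dvdp_leq P_neq0 prod_dvd; apply: leq_trans.
rewrite prodrXl -[X in (_ < X)%N]prednK ?ltnS.
  by rewrite size_exp size_prod_XsubC.
by rewrite size_poly_gt0 expf_neq0 // monic_neq0 // monic_prod_XsubC.
Qed.
End HasseDerivatives.

(** * Irreducibility of Kummer polynomials *)

Section KummerFactors.
Variables (M : fieldType) (n : nat) (w : M).
Hypothesis prim_w : n.-primitive_root w.

Let n_gt0 : (0 < n)%N := prim_order_gt0 prim_w.

Lemma prim_root_neq0 : w != 0.
Proof.
have := oner_neq0 M; rewrite -(prim_expr_order prim_w); apply: contraNneq => ->.
by rewrite expr0n gtn_eqF.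
Qed.

(** The remainder of [q] by [p], composed with ['X^n], is again divisible by p(X^n), but its degree
    is too small. *)
Lemma dvdp_comp_Xn_cancel (p q : {poly M}) :
  p \Po 'X^n %| q \Po 'X^n -> p %| q.
Proof.
have [->|p_neq0] := eqVneq p 0.
  rewrite comp_poly0 !dvd0p => /eqP q0; apply/eqP.
  have /eqP := congr1 (fun r : {poly M} => (size r).-1) q0.
  rewrite size_comp_poly size_polyXn size_poly0 /= muln_eq0 -[X in _ || X]leqn0 leqNgt n_gt0 orbF.
  move=> szq; have [|q1] := leqP (size q) 0; first by rewrite leqn0 size_poly_eq0 => /eqP.
  have /size_poly1P[c c0 Dq] : size q == 1 by move: szq q1; case: (size q) => [|[]].
  by move: q0; rewrite Dq comp_polyC.
rewrite {1}(divp_eq q p) comp_polyD comp_polyM dvdp_addr ?dvdp_mulIr //.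
set r := q %% p => dvd_r.
suff r0 : r = 0 by apply/eqP.
apply: contraTeq dvd_r => r_neq0; apply/negP => /dvdp_leq leq_sz.
have r_lt : (size r < size p)%N by rewrite ltn_modp.
have sz0 (s : {poly M}) : s != 0 -> (0 < size (s \Po 'X^n))%N /\
   (size (s \Po 'X^n)).-1 = ((size s).-1 * n)%N.
  move=> s0; split; last by rewrite size_comp_poly size_polyXn.
  rewrite size_poly_gt0; apply: contraNneq s0 => e.
  have := congr1 (fun r : {poly M} => (lead_coef r)) e.
  rewrite lead_coef_comp ?size_polyXn ?ltnS // lead_coefXn expr1n mulr1 lead_coef0.
  by move/eqP; rewrite lead_coef_eq0.
have [rg rs] := sz0 _ r_neq0; have [pg ps] := sz0 _ p_neq0.
have := leq_sz; rewrite -size_poly_gt0 rg => /(_ isT).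
rewrite -(prednK rg) -(prednK pg) ltnS rs ps leq_pmul2r //.
move: r_lt; rewrite -size_poly_gt0 in r_neq0.
by rewrite -{1}(prednK r_neq0); case: (size p) => //= s; rewrite ltnS => /leq_trans h /h; rewrite ltnn.
Qed.

Lemma comp_Xn_of_invariant (H : {poly M}) :
  H \Po (w *: 'X) = H -> exists h, H = h \Po 'X^n.
Proof.
move=> Hw; exists (\poly_(j < size H) H`_(n * j)).
apply/polyP=> i; rewrite coef_comp_poly_Xn // coef_poly.
have /eqP := congr1 (fun p : {poly M} => p`_i) Hw.
rewrite comp_polyE coef_sum.
have -> : \sum_(j < size H) (H`_j *: (w *: 'X) ^+ j)`_i = H`_i * w ^+ i.
  have [lt_i|le_i] := ltnP i (size H); last first.
    rewrite nth_default // mul0r big1 // => j _.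
    rewrite exprZn !coefZ coefXn; case: eqP => [E|]; last by rewrite !mulr0.
    by have := ltn_ord j; rewrite -E ltnNge le_i.
  rewrite (bigD1 (Ordinal lt_i)) //= big1 ?addr0.
    by rewrite exprZn !coefZ coefXn eqxx mulr1.
  move=> j ne_j; rewrite exprZn !coefZ coefXn; case: eqP => [E|]; last by rewrite !mulr0.
  by case/eqP: ne_j; apply: val_inj.
rewrite -subr_eq0 -{2}[H`_i]mulr1 -mulrBr mulf_eq0 subr_eq0 -(prim_order_dvd prim_w).
case: ifP => [dvd_n _|_]; last by rewrite orbF => /eqP.
rewrite mulnC divnK //; case: ltnP => // le_s.
by rewrite nth_default // (leq_trans le_s) // leq_div.
Qed.

(* A monic factor of [X^n - g] of degree [r] has, up to a root of unity, an
   [n]-th root of [g^r] as constant coefficient: the product of its twists by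
   the [n]-th roots of unity is a polynomial in [X^n] dividing a power of
   [X^n - g]. *)
Lemma monic_factor_Xn_sub (g : M) (G : {poly M}) :
  G \is monic -> G %| 'X^n - g%:P ->
  exists k, G.[0] ^+ n = w ^+ k * (- g) ^+ (size G).-1.
Proof.
move=> mG dG; pose H := \prod_(i < n) (G \Po (w ^+ i *: 'X)).
have szwX i : size (w ^+ i *: 'X) = 2.
  by rewrite size_scale ?size_polyX // expf_neq0 // prim_root_neq0.
have Hw : H \Po (w *: 'X) = H.
  rewrite /H rmorph_prod /=.
  have -> : \prod_(i < n) ((G \Po (w ^+ i *: 'X)) \Po (w *: 'X))
      = \prod_(i < n) (G \Po (w ^+ i.+1 *: 'X)).
    apply: eq_bigr => i _; rewrite -comp_polyA comp_polyZ comp_polyX.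
    by rewrite scalerA exprSr.
  case: (n) n_gt0 prim_w => // n' _ pw.
  rewrite big_ord_recr [RHS]big_ord_recl mulrC /=; congr (_ * _).
  by rewrite (prim_expr_order pw).
have [h Dh] := comp_Xn_of_invariant Hw.
have H_dvd : H %| ('X^n - g%:P) ^+ n.
  have -> : ('X^n - g%:P) ^+ n = \prod_(i < n) ('X^n - g%:P) by rewrite prodr_const card_ord.
  apply: (big_ind2 (fun p q => p %| q)) => [|a b c d|i _]; first exact: dvdpp.
    exact: dvdp_mul.
  have -> : 'X^n - g%:P = ('X^n - g%:P) \Po (w ^+ i *: 'X).
    rewrite comp_polyB comp_polyC rmorphXn /= comp_polyX exprZn -exprM mulnC exprM.
    by rewrite (prim_expr_order prim_w) expr1n scale1r.
  exact: dvdp_comp_poly.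
have : h %| ('X - g%:P) ^+ n.
  apply: dvdp_comp_Xn_cancel; rewrite -Dh rmorphXn /= comp_polyB comp_polyC.
  by rewrite comp_polyX.
case/dvdp_exp_XsubCP => k [_ /eqpf_eq[c c_neq0 Dh']].
have DH : H = c *: ('X^n - g%:P) ^+ k.
  by rewrite Dh Dh' comp_polyZ rmorphXn /= comp_polyB comp_polyC comp_polyX.
have G0 : H.[0] = G.[0] ^+ n.
  rewrite /H horner_prod (eq_bigr (fun=> G.[0])) ?prodr_const ?card_ord //.
  by move=> i _; rewrite horner_comp !hornerE ?mulr0.
have lcX : lead_coef ('X^n - g%:P : {poly M}) = 1.
  exact/eqP/monicXnsubC.
have lcH : lead_coef H = \prod_(i < n) (w ^+ i) ^+ (size G).-1.
  rewrite lead_coef_prod; apply: eq_bigr => i _.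
  rewrite lead_coef_comp ?szwX // (eqP mG) mul1r lead_coefZ lead_coefX mulr1 //.
have szH : (size H).-1 = (n * (size G).-1)%N.
  rewrite size_prod; last by move=> i _; rewrite comp_poly2_eq0 ?szwX // monic_neq0.
  rewrite (eq_bigr (fun=> size G)) => [|i _]; last by rewrite size_comp_poly2 // szwX.
  rewrite sum_nat_const card_ord.
  have : (0 < size G)%N by rewrite size_poly_gt0 monic_neq0.
  case: (size G) => // s _ /=; rewrite mulnS; lia.
have kr : k = (size G).-1.
  apply/eqP; rewrite -(eqn_pmul2l n_gt0) -szH DH size_scale //.
  by rewrite size_exp size_XnsubC //= mulnC.
move: lcH; rewrite DH lead_coefZ lead_coef_exp lcX expr1n mulr1 => Dc.
exists (\sum_(i < n) i * (size G).-1)%N.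
rewrite -G0 DH hornerZ horner_exp !hornerE expr0n gtn_eqF //= sub0r kr; congr (_ * _).
rewrite Dc; elim/big_rec2: _ => [|i y1 y2 _ ->]; first by rewrite expr0.
by rewrite exprD exprM.
Qed.

End KummerFactors.

Lemma fraction_numden (R : idomainType) (x : {fraction R}) :
  exists a b : R, b != 0 /\ x * tofrac b = tofrac a.
Proof.
exists (\n_(repr x)), (\d_(repr x)); split; first exact: denom_ratioP.
move: (repr x) (reprK x) (denom_ratioP (repr x)) => r <- r_neq0; unlock tofrac.
rewrite -[LHS]FracField.pi_mul; apply/eqmodP => /=.
by rewrite FracField.equivfE /= !numden_Ratio ?mulr1 ?mul1r ?oner_neq0 // mulrC.
Qed.

Section KummerIrreducible.
Variables (L : fieldType) (n : nat) (w : L) (f : {poly L}).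
Hypothesis prim_w : n.-primitive_root w.
Hypothesis f_neq0 : f != 0.
Hypothesis f_order : forall r, (0 < r < n)%N -> exists x, ~~ (n %| r * mup x f)%N.

Lemma mupX (x : L) (p : {poly L}) k : p != 0 -> mup x (p ^+ k) = (k * mup x p)%N.
Proof.
move=> p0; elim: k => [|k IHk]; first by rewrite mupNroot // expr0 root1.
by rewrite exprS mupM ?expf_neq0 // IHk mulSn.
Qed.

Lemma mupZ (x c : L) (p : {poly L}) : c != 0 -> mup x (c *: p) = mup x p.
Proof.
by move=> c0; rewrite -mul_polyC mupMr // rootC.
Qed.

(** Over the fraction field, the gcd of X^n - c f and a nonzero [C] would be a proper factor: if it
    were trivial, X^n - c f would divide [V], whose degree is too small. The constant term of a
    factor of degree r has n-th power (- c f)^r up to a root of unity, so n would divide r times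
    every multiplicity of [f], against [f_order]. *)
Lemma kummer_irreducible (V C W : {poly {poly L}}) (c : L) :
  c != 0 -> V * C = W * ('X^n - (c *: f)%:P) ->
  (size V <= n)%N -> (size C <= n)%N -> V != 0 -> C = 0.
Proof.
move=> c_neq0 VC szV szC V_neq0; apply/eqP; apply: contraT => C_neq0.
have n_gt0 := prim_order_gt0 prim_w.
pose toM := @tofrac {poly L}; pose g := toM (c *: f).
pose wM : {fraction {poly L}} := toM w%:P.
have prim_wM : n.-primitive_root wM.
  have [inj1 inj2] : injective (toM \o polyC) /\ True.
    by split=> // x y /= /eqP; rewrite tofrac_eq => /eqP /polyC_inj.
  have := fmorph_primitive_root (toM \o polyC : {rmorphism L -> _}) n w.
  by rewrite /= prim_w => ->.
pose mp := map_poly toM : {poly {poly L}} -> {poly {fraction {poly L}}}.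
have inj_toM : injective toM by move=> x y /eqP; rewrite tofrac_eq => /eqP.
have szM (p : {poly {poly L}}) : size (mp p) = size p.
  by rewrite size_map_inj_poly // rmorph0.
have neqM (p : {poly {poly L}}) : p != 0 -> mp p != 0.
  by rewrite -!size_poly_eq0 szM.
have dX : mp ('X^n - (c *: f)%:P) = 'X^n - g%:P.
  by rewrite /mp rmorphB /= map_polyXn map_polyC.
have VCM : mp V * mp C = mp W * ('X^n - g%:P) by rewrite -dX -!rmorphM VC.
pose G0 := gcdp ('X^n - g%:P) (mp C).
have szX : size ('X^n - g%:P) = n.+1 by rewrite size_XnsubC.
have X_neq0 : 'X^n - g%:P != 0 by rewrite -size_poly_eq0 szX.
have G0_neq0 : G0 != 0 by rewrite gcdp_eq0 (negPf X_neq0).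
pose G := (lead_coef G0)^-1 *: G0.
have lG0 : (lead_coef G0)^-1 != 0 by rewrite invr_eq0 lead_coef_eq0.
have szG : size G = size G0 by rewrite size_scale.
have mG : G \is monic.
  by apply/monicP; rewrite lead_coefZ; apply: mulVf; rewrite lead_coef_eq0; exact: G0_neq0.
have dG : G %| 'X^n - g%:P by rewrite dvdpZl // dvdp_gcdl.
have szG_le : (size G <= n)%N.
  by rewrite szG (leq_trans _ szC) // -szM dvdp_leq ?neqM // dvdp_gcdr.
have szG_gt1 : (1 < size G)%N.
  rewrite ltn_neqAle size_poly_gt0 monic_neq0 // andbT eq_sym szG.
  apply/negP => cop.
  have : 'X^n - g%:P %| mp V by rewrite -(Gauss_dvdpl _ cop) VCM dvdp_mulIr.
  move/(dvdp_leq (neqM _ V_neq0)); rewrite szX szM => /leq_trans/(_ szV).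
  by rewrite ltnn.
have [k Gk] := monic_factor_Xn_sub prim_wM mG dG.
pose r := (size G).-1; have r_bd : (0 < r < n)%N.
  by rewrite /r ltn_predRL szG_gt1 prednK ?szG_le // ltnW.
have [x xP] := f_order r_bd.
have [a [b [b_neq0 Dab]]] := fraction_numden G.[0].
have gr_neq0 : toM (- (c *: f)) != 0.
  by rewrite tofrac_eq0 oppr_eq0 scaler_eq0 negb_or c_neq0.
have : toM (a ^+ n) = toM ((w ^+ k)%:P * (- (c *: f)) ^+ r * b ^+ n).
  rewrite /toM tofracXn -Dab exprMn Gk !tofracM !tofracXn -/r /wM; congr (_ * _ * _).
    by rewrite polyC_exp /toM tofracXn.
  by rewrite /g /toM tofracN.
move/inj_toM => E.
have f'_neq0 : - (c *: f) != 0 by rewrite oppr_eq0 scaler_eq0 negb_or c_neq0.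
have wk_neq0 : w ^+ k != 0 by rewrite expf_neq0 // (prim_root_neq0 prim_w).
have a_neq0 : a != 0.
  have : a ^+ n != 0 by rewrite E !mulf_eq0 !negb_or polyC_eq0 !expf_neq0 // (prim_root_neq0 prim_w).
  by apply: contraNneq => ->; rewrite expr0n gtn_eqF.
have := congr1 (mup x) E; rewrite mupX // -mulrA mul_polyC mupZ // mupM ?expf_neq0 //.
rewrite !mupX // -scaleNr mupZ ?oppr_eq0 // => Em.
case/negP: xP; rewrite -(dvdn_addl _ (dvdn_mulr (mup x b) (dvdnn n))) -Em.
by rewrite dvdn_mulr.
Qed.

End KummerIrreducible.

Lemma rmorph_det0 (R : comNzRingType) (S : idomainType) (g : {rmorphism R -> S})
    n (A : 'M[R]_n) (u : 'rV[S]_n) :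
  u != 0 -> u *m (map_mx g A)^T = 0 -> g (\det A) = 0.
Proof.
by move=> u_neq0 uA; rewrite -det_map_mx -det_tr; apply/eqP/det0P; exists u.
Qed.

(** * Stepanov's method *)

Section StepanovNonvanishing.
Variables (L : finFieldType) (n : nat) (w : L) (f : {poly L}) (Q N a : nat).
Hypothesis prim_w : n.-primitive_root w.
Hypothesis f_neq0 : f != 0.
Hypothesis f_order : forall r, (0 < r < n)%N -> exists x, ~~ (n %| r * mup x f)%N.
Hypothesis DQ : Q = (n * N).+1.
Hypothesis f_frob : f \Po 'X^Q = f ^+ Q.
Hypothesis leQL : (Q <= #|L|)%N.
Hypothesis leaQ : (n * (a + size f) <= Q)%N.

Let n_gt0 : (0 < n)%N := prim_order_gt0 prim_w.

Variable A : nat -> {poly {poly L}}.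
Hypothesis sizeA : forall j, (j < n)%N -> (size (A j) <= a)%N.
Hypothesis A_root : \sum_(0 <= j < n) subst_frob Q (A j) * f ^+ (j * N) = 0.

(* The matrix of multiplication by [\sum_j A_j T^j], scaled by [f(x)], modulo
   [f(x) T^n - f(z)]; under z = x^Q the class of T becomes [f ^+ N]. *)
Let mulmat : 'M[{poly {poly L}}]_n :=
  \matrix_(i, t) if (i <= t)%N then A (t - i) * map_poly polyC f
                 else A (t + (n - i)) * f%:P.

Let subst_fx : subst_frob Q (map_poly polyC f) = f.
Proof.
rewrite /subst_frob /= /horner_eval -map_poly_comp /=.
rewrite (eq_map_poly (g := polyC)) => [|c /=]; last by rewrite comp_polyC.
by rewrite -[RHS]comp_polyXr.
Qed.

Let subst_fz : subst_frob Q f%:P = f ^+ Q.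
Proof. by rewrite /subst_frob /= /horner_eval map_polyC hornerC. Qed.

(** The powers of [u = f ^+ N] form a null vector: since Q = n N + 1, f u^n = f^Q is the image of
    f(z), so [u] satisfies the relation that defines the matrix. *)
Let det_mulmat_frob : subst_frob Q (\det mulmat) = 0.
Proof.
pose u := f ^+ N; apply: (rmorph_det0 (u := \row_t u ^+ t)).
  apply/eqP => /rowP/(_ (Ordinal n_gt0)); rewrite !mxE expr0 => /eqP.
  by rewrite oner_eq0.
apply/rowP => i; rewrite !mxE.
transitivity (f * u ^+ i * \sum_(0 <= j < n) subst_frob Q (A j) * f ^+ (j * N)); last first.
  by rewrite A_root mulr0.
under eq_bigr => t _ do rewrite !mxE.
rewrite -(big_mkord xpredT (fun t => u ^+ t * subst_frob Q (if (i <= t)%N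
   then A (t - i) * map_poly polyC f else A (t + (n - i)) * f%:P))).
rewrite (big_cat_nat (n := i)) //= ?(ltnW (ltn_ord i)) //.
rewrite [in RHS](big_cat_nat (n := n - i)) ?leq_subr //= mulrDr addrC.
have expu j : f ^+ (j * N) = u ^+ j by rewrite mulnC exprM.
congr (_ + _).
  rewrite -{1}[nat_of_ord i]add0n big_addn mulr_sumr; apply: eq_bigr => j _.
  rewrite leq_addl addnK rmorphM /= subst_fx expu exprD; ring.
have -> (F : nat -> {poly L}) :
    \sum_(n - i <= j < n) F j = \sum_(0 <= t < i) F (t + (n - i))%N.
  by rewrite -{1}[(n - i)%N]add0n big_addn subKn // ltnW.
rewrite !big_mkord mulr_sumr; apply: eq_bigr => t _.
rewrite leqNgt ltn_ord /= rmorphM /= subst_fz expu DQ exprS exprD mulnC exprM -/u.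
have -> : u ^+ n = u ^+ (n - i) * u ^+ i by rewrite -exprD subnK // ltnW.
ring.
Qed.

Let size_entry i t : (size (mulmat i t) <= a + size f)%N.
Proof.
rewrite mxE; case: ifP => h; apply: leq_trans (size_polyMleq _ _) _.
  rewrite size_map_polyC (leq_trans (leq_pred _)) // leq_add2r sizeA //.
  exact: leq_ltn_trans (leq_subr _ _) (ltn_ord t).
have lt_t : (t + (n - i) < n)%N.
  by have := ltn_ord t; have := ltn_ord i; move/negbT: h; rewrite -ltnNge; lia.
apply: leq_trans (leq_pred _) (leq_add (sizeA lt_t) _).
by apply: leq_trans (size_polyC_leq1 _) _; rewrite size_poly_gt0.
Qed.

(** The degree of the determinant in x is below Q, so its vanishing at z = x^Q lifts to an identity
    in independent x and z. From here on x can be specialized while z stays free. *)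
Let det_mulmat : \det mulmat = 0.
Proof.
apply: subst_frob_inj det_mulmat_frob.
apply: leq_trans (size_sum _ _ _) _; apply/bigmax_leqP => s _.
rewrite -signr_odd mulr_sign; have -> (b : bool) (p : {poly {poly L}}) :
  size (if b then - p else p) = size p by case: b; rewrite ?size_polyN.
apply: leq_trans (size_prod_leq _ _) _.
rewrite card_ord; apply: leq_trans leaQ; rewrite leq_subLR.
apply: (@leq_ltn_trans (\sum_(i < n) (a + size f))).
  by apply: leq_sum => i _; exact: size_entry.
by rewrite sum_nat_const card_ord -[X in (X < _)%N]add0n ltn_add2r.
Qed.

Let exists_specialization j : (j < n)%N -> A j != 0 ->
  exists x0, f.[x0] != 0 /\ (A j).[x0%:P] != 0.
Proof.
move=> lt_jn Aj_neq0; have [i Aji] : exists i, (A j)`_i != 0.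
  by exists (size (A j)).-1; rewrite -lead_coefE lead_coef_eq0.
have [l Ajil] : exists l, (A j)`_i`_l != 0.
  by exists (size (A j)`_i).-1; rewrite -lead_coefE lead_coef_eq0.
pose p := \poly_(k < size (A j)) (A j)`_k`_l.
have p_neq0 : p != 0.
  apply: contraNneq Ajil => /(congr1 (fun p : {poly L} => p`_i)).
  rewrite coef_poly coef0; case: ltnP => [_ ->//|le_i _].
  by rewrite [(A j)`_i]nth_default // coef0.
have [x0 x0P] : exists x0, ~~ root (p * f) x0.
  apply/existsP; apply: contraT; rewrite negb_exists => /forallP allr.
  have pf0 : p * f != 0 by rewrite mulf_neq0.
  have := max_poly_roots pf0 (rs := enum L) _ (enum_uniq L).
  rewrite -cardE => lt_L; have : (#|L| < size (p * f)%R)%N.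
    by apply: lt_L; apply/allP => x _; rewrite -[root _ _]negbK.
  rewrite ltnNge => /negP[]; apply: leq_trans leQL; apply: leq_trans leaQ.
  apply: leq_trans (size_polyMleq _ _) _; apply: leq_trans (leq_pred _) _.
  apply: leq_trans (leq_pmull _ n_gt0); rewrite leq_add2r.
  exact: leq_trans (size_poly _ _) (sizeA lt_jn).
exists x0; move: x0P; rewrite rootM negb_or andbC => /andP[fx0 px0]; split=> //.
apply: contra px0 => /eqP Ax0; rewrite /root.
have := congr1 (fun p : {poly L} => p`_l) Ax0; rewrite coef0 => <-.
rewrite horner_poly (horner_coef (A j)) coef_sum.
by apply/eqP; apply: eq_bigr => k _; rewrite -polyC_exp coefMC.
Qed.

(** Auxiliary polynomials of Stepanov's method do not vanish by accident. At a point x0 where some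
    [A j] and [f] survive, the determinant gives a nonzero [V] whose product with [CP], the sum of
    the A_k(x0, z) T^k, vanishes modulo T^n - f(z) / f(x0). Kummer irreducibility then forces all
    A_k(x0, z) to be 0. *)
Lemma stepanov_coefs0 j : (j < n)%N -> A j = 0.
Proof.
move=> lt_jn; apply/eqP; apply: contraT => Aj_neq0.
have [x0 [fx0 Ajx0]] := exists_specialization lt_jn Aj_neq0.
pose C k := (A k).[x0%:P]; pose c0 := f.[x0].
have : \det (map_mx (horner_eval x0%:P) mulmat) == 0.
  by rewrite det_map_mx det_mulmat /= /horner_eval horner0.
case/det0P => v v_neq0 vA.
pose v' (i : nat) : {poly L} := if (insub i : option 'I_n) is Some i' then v 0 i' else 0.
have v'E (i : 'I_n) : v' i = v 0 i by rewrite /v' valK.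
pose V : {poly {poly L}} := \poly_(i < n) v' i.
pose CP : {poly {poly L}} := \poly_(k < n) C k.
have fx : (map_poly polyC f).[x0%:P] = c0%:P :> {poly L} by rewrite horner_map.
have vA' t : (t < n)%N ->
    \sum_(0 <= i < n) v' i * (if (i <= t)%N then C (t - i)%N * c0%:P
                              else C (t + (n - i))%N * f) = 0.
  move=> lt_t; have := congr1 (fun r : 'rV_n => r 0 (Ordinal lt_t)) vA.
  rewrite !mxE => vt0; rewrite big_mkord -[RHS]vt0; apply: eq_bigr => i _.
  rewrite v'E !mxE /horner_eval.
  by case: ifP => _; rewrite hornerM ?fx ?hornerC.
have V_neq0 : V != 0.
  apply: contra v_neq0 => /eqP V0; apply/eqP/rowP => i; rewrite mxE.
  have := congr1 (fun p : {poly {poly L}} => p`_i) V0.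
  by rewrite coef0 coef_poly ltn_ord v'E.
(* [U] and [W] are the remainder and the quotient of [V * CP] by ['X^n]; the null vector says that
   c0 U + f W = 0. *)
pose U := \sum_(0 <= i < n) \sum_(0 <= k < n - i)
            (v' i * C k)%:P * 'X^(k + i) : {poly {poly L}}.
pose W := \sum_(0 <= i < n) \sum_(0 <= t < i)
            (v' i * C (t + (n - i))%N)%:P * 'X^t : {poly {poly L}}.
have shift (T : nmodType) i (F : nat -> T) : (i <= n)%N ->
    \sum_(n - i <= j < n) F j = \sum_(0 <= t < i) F (t + (n - i))%N.
  by move=> le_in; rewrite -{1}[(n - i)%N]add0n big_addn subKn.
have DVC : V * CP = U + W * 'X^n.
  have -> : V = \sum_(0 <= i < n) v' i *: 'X^i by rewrite /V poly_def big_mkord.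
  have -> : CP = \sum_(0 <= i < n) C i *: 'X^i by rewrite /CP poly_def big_mkord.
  rewrite mulr_suml /U /W.
  rewrite mulr_suml -big_split /=.
  apply: eq_big_nat => i /andP[_ lt_in]; rewrite mulr_sumr.
  rewrite (big_cat_nat (n := n - i)) ?leq_subr //= shift ?(ltnW lt_in) // mulr_suml.
  rewrite -!mul_polyC.
  congr (_ + _); apply: eq_bigr => k _; rewrite -!mul_polyC polyCM ?exprD; first by ring.
  have : 'X^n = 'X^(n - i) * 'X^i :> {poly {poly L}} by rewrite -exprD subnK // ltnW.
  by move=> ->; ring.
have UW0 : c0%:P%:P * U + f%:P * W = 0.
  have -> : 0 = \sum_(0 <= t < n) (\sum_(0 <= i < n) v' i *
     (if (i <= t)%N then C (t - i)%N * c0%:P else C (t + (n - i))%N * f))%:P * 'X^t.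
    by rewrite big_nat big1 // => t /andP[_ lt_t]; rewrite vA' // mul0r.
  under eq_bigr => t _ do rewrite rmorph_sum mulr_suml.
  rewrite exchange_big /= !mulr_sumr -big_split /=.
  apply: eq_big_nat => i /andP[_ lt_in].
  rewrite [RHS](big_cat_nat (n := i)) ?(ltnW lt_in) //= addrC !mulr_sumr.
  congr (_ + _).
    apply: eq_big_nat => t /andP[_ lt_t].
    by rewrite leqNgt lt_t /= !polyCM; ring.
  have -> (F : nat -> {poly {poly L}}) :
      \sum_(i <= t < n) F t = \sum_(0 <= k < n - i) F (k + i)%N.
    by rewrite -{1}[i]add0n big_addn.
  apply: eq_bigr => k _.
  by rewrite leq_addl addnK !polyCM; ring.
have VCW : V * CP = W * ('X^n - (c0^-1 *: f)%:P).
  rewrite DVC.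
  have -> : U = - ((c0^-1 *: f)%:P * W).
    have c0P : c0^-1%:P%:P * c0%:P%:P = 1 :> {poly {poly L}}.
      by rewrite -!polyCM mulVf.
    have /eqP := UW0; rewrite addr_eq0 => /eqP /(congr1 (fun p => c0^-1%:P%:P * p)).
    by rewrite mulrA c0P mul1r => ->; rewrite -mul_polyC polyCM mulrN mulrA.
  by ring.
suff CP0 : CP = 0.
  have := congr1 (fun p : {poly {poly L}} => p`_j) CP0.
  by rewrite coef_poly lt_jn coef0 => Cj0; case/negP: Ajx0; apply/eqP.
apply: (kummer_irreducible prim_w f_neq0 f_order) VCW _ _ V_neq0.
- by rewrite invr_eq0.
- exact: size_poly.
- exact: size_poly.
Qed.

End StepanovNonvanishing.

Section StepanovCount.
Variables (L : finFieldType) (n : nat) (w : L) (f : {poly L}) (Q N B : nat).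
Hypothesis prim_w : n.-primitive_root w.
Hypothesis f_neq0 : f != 0.
Hypothesis f_order : forall r, (0 < r < n)%N -> exists x, ~~ (n %| r * mup x f)%N.
Hypothesis DQ : Q = (n * N).+1.
Hypothesis Q_pchar : [pchar L].-nat Q.
Hypothesis f_frob : f \Po 'X^Q = f ^+ Q.
Hypothesis leQL : (Q <= #|L|)%N.
Hypothesis B_gt0 : (0 < B)%N.

(** The size of [a] makes the B n a unknowns outnumber the M wd linear conditions; after
    cancellation this reads (B - 1)(B + n (B - 1) size f) < a. *)
Let a := (B ^ 2 * (1 + n * size f)).+1.
Let M := (n * B.-1)%N.
Hypothesis leaQ : (n * (a + size f) <= Q)%N.

Let n_gt0 : (0 < n)%N := prim_order_gt0 prim_w.
Let idx : finType := ('I_B * 'I_n * 'I_a)%type.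
Let sf_gt0 : (0 < size f)%N. Proof. by rewrite size_poly_gt0. Qed.

(** The extra factor f^M lets a power of [f] be split off from every Hasse derivative of order below
    M, also when the exponent of f^N is 0. *)
Let h (t : idx) := 'X^(t.2) * f ^+ (t.1.2 * N + M).
Let b e (t : idx) := (h t)^`N(e) %/ f ^+ (t.1.2 * N + M - e).

Let hE e t : (e < M)%N -> (h t)^`N(e) = b e t * f ^+ (t.1.2 * N + M - e).
Proof.
move=> lt_eM; rewrite /b divpK // /h mulrC dvdp_nderivn_expM //.
exact: leq_trans (ltnW lt_eM) (leq_addl _ _).
Qed.

Let size_h t : (size (h t) <= a + (size f).-1 * (t.1.2 * N + M))%N.
Proof.
rewrite /h size_mul ?expf_neq0 ?polyX_eq0 // size_polyXn.
rewrite addSn /= -size_exp.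
have : (0 < size (f ^+ (t.1.2 * N + M)))%N by rewrite size_poly_gt0 expf_neq0.
by move: (ltn_ord t.2); case: (size _) => // s' lt_i _ /=; rewrite addnS -addSn leq_add2r.
Qed.

Let size_b e t : (e < M)%N -> (size (b e t) <= a + M * size f)%N.
Proof.
move=> lt_eM; have le_e : (e <= t.1.2 * N + M)%N.
  exact: leq_trans (ltnW lt_eM) (leq_addl _ _).
rewrite /b size_divp ?expf_neq0 // leq_subLR.
have -> : (size (f ^+ (t.1.2 * N + M - e))).-1 = ((size f).-1 * (t.1.2 * N + M - e))%N.
  by rewrite size_exp.
have le1 : (size (h t)^`N(e) <= size (h t))%N.
  by apply: leq_trans (size_poly _ _) (leq_subr _ _).
apply: leq_trans le1 (leq_trans (size_h t) _); rewrite addnCA leq_add2l.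
rewrite -{1}(subnK le_e) mulnDr leq_add2l mulnC leq_mul ?leq_pred //.
exact: ltnW.
Qed.

Let wd := (B + (a + M * size f))%N.

Let card_lt : (#|{: 'I_M * 'I_wd}| < #|idx|)%N.
Proof.
rewrite !card_prod !card_ord /wd /M -(prednK B_gt0) /a.
set s := size f; set B' := B.-1; rewrite -(prednK B_gt0) -/B'.
nia.
Qed.

Variable zeta : L.
Hypothesis zeta_neq0 : zeta != 0.

Let c (t : idx) (r : 'I_M * 'I_wd) : L :=
  (zeta ^+ t.1.2 *: ('X^(t.1.1) * b r.1 t))`_r.2.

(** On [s], x^Q becomes x and f^N becomes [zeta], so each Hasse derivative of [P] agrees there with
    a power of [f] times a polynomial [R] of small degree. Requiring [R = 0] for all orders below M
    costs few linear conditions and yields zeros of order M at all points of [s]; the degree of [P]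
    then bounds their number. *)
Lemma stepanov_count (s : seq L) : uniq s ->
  {in s, forall x, x ^+ Q = x /\ f.[x] ^+ N = zeta} ->
  (size s * M <= a + Q * B.-1 + size f * (M + Q))%N.
Proof.
move=> s_uniq sP; have [v [[t0 vt0] v_dep]] := exists_linear_dependency c card_lt.
pose P := \sum_t v t *: ('X^(Q * t.1.1) * h t).
have ltMQ : (M < Q)%N.
  by apply: leq_trans leaQ; rewrite /M /a; move: n_gt0 B_gt0; nia.
have N_gt0 : (0 < N)%N.
  rewrite lt0n; apply: contraTneq leaQ => N0; rewrite DQ N0 muln0 /a -ltnNge.
  by move: n_gt0 sf_gt0; nia.
have P_root : {in s, forall x, ('X - x%:P) ^+ M %| P}.
  move=> x /sP[xQ fx]; apply: dvdp_XsubC_expP => e lt_eM.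
  have fx_neq0 : f.[x] != 0.
    apply: contraNneq zeta_neq0 => fx0.
    by rewrite -fx fx0 expr0n gtn_eqF.
  pose R := \sum_t v t *: (zeta ^+ t.1.2 *: ('X^(t.1.1) * b e t)).
  have R0 : R = 0.
    apply/polyP => k; rewrite coef0; have [lt_k|le_k] := ltnP k wd; last first.
      rewrite nth_default // (leq_trans _ le_k) // (leq_trans (size_sum _ _ _)) //.
      apply/bigmax_leqP => t _; apply: leq_trans (size_scale_leq _ _) _.
      apply: leq_trans (size_scale_leq _ _) _.
      apply: leq_trans (size_polyMleq _ _) _; rewrite size_polyXn addSn /=.
      by rewrite leq_add ?size_b // ltnW.
    rewrite coef_sum -[RHS](v_dep (Ordinal lt_eM, Ordinal lt_k)).
    by apply: eq_bigr => t _; rewrite coefZ.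
  have -> : (P^`N(e)).[x] = f.[x] ^+ (M - e) * R.[x]; last by rewrite R0 horner0 mulr0.
  rewrite /P linear_sum /= !horner_sum mulr_sumr; apply: eq_bigr => t _.
  rewrite linearZ /= nderivn_frobM ?(ltn_trans lt_eM) // hE // !hornerE.
  have -> : x ^+ (Q * t.1.1) = x ^+ t.1.1 by rewrite exprM xQ.
  rewrite -addnBA ?(ltnW lt_eM) // exprD mulnC exprM fx /=; ring.
have P_neq0 : P != 0.
  pose A (j : nat) : {poly {poly L}} :=
    \sum_(t : idx | t.1.2 == j :> nat) ((v t)%:P * 'X^(t.1.1))%:P * 'X^(t.2).
  have sizeA j : (j < n)%N -> (size (A j) <= a)%N.
    move=> _; apply: leq_trans (size_sum _ _ _) _; apply/bigmax_leqP => t _.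
    rewrite mul_polyC; apply: leq_trans (size_scale_leq _ _) _.
    by rewrite size_polyXn.
  have substA j : subst_frob Q (A j) =
      \sum_(t : idx | t.1.2 == j :> nat) v t *: ('X^(Q * t.1.1) * 'X^(t.2)).
    rewrite rmorph_sum; apply: eq_bigr => t _; rewrite rmorphM /=.
    rewrite /subst_frob /= /horner_eval map_polyC hornerC /= map_polyXn hornerXn.
    by rewrite comp_polyM comp_polyC rmorphXn /= comp_polyX -exprM mul_polyC -scalerAl.
  apply: contra vt0 => /eqP P0.
  have A_root : \sum_(0 <= j < n) subst_frob Q (A j) * f ^+ (j * N) = 0.
    apply: (mulfI (expf_neq0 M f_neq0)); rewrite mulr0 -[RHS]P0 /P.
    rewrite (partition_big (fun t : idx => t.1.2) xpredT) //= big_mkord mulr_sumr.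
    apply: eq_bigr => j _; rewrite substA mulr_suml mulr_sumr.
    apply: eq_big => t; first by rewrite -val_eqE.
    move=> /eqP Dj; rewrite /h Dj exprD -!mul_polyC; ring.
  have := stepanov_coefs0 prim_w f_neq0 f_order DQ f_frob leQL leaQ sizeA A_root (ltn_ord t0.1.2).
  move/(congr1 (fun p : {poly {poly L}} => p`_(t0.2)`_(t0.1.1))); rewrite !coef0 => <-.
  rewrite coef_sum coef_sum (bigD1 t0) //= big1 ?addr0.
    by rewrite coefCM coefXn eqxx mulr1 coefCM coefXn eqxx mulr1.
  move=> t /andP[/eqP Dj ne_t]; rewrite coefCM coefXn.
  case: eqP => [D2|]; last by rewrite mulr0 coef0.
  rewrite mulr1 coefCM coefXn; case: eqP => [D1|]; last by rewrite mulr0.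
  case/eqP: ne_t; case: t Dj D2 D1 => [[l j] i]; case: (t0) => [[l0 j0] i0] /=.
  by move=> /val_inj-> /val_inj-> /val_inj->.
have := size_mul_leq_of_roots P_neq0 s_uniq P_root.
move/ltnW/leq_trans; apply; apply: leq_trans (size_sum _ _ _) _.
apply/bigmax_leqP => t _; apply: leq_trans (size_scale_leq _ _) _.
apply: leq_trans (size_polyMleq _ _) _; rewrite size_polyXn addSn /=.
have le_l : (Q * t.1.1 <= Q * B.-1)%N.
  by rewrite leq_mul2l -ltnS prednK // ltn_ord orbT.
have le_j : (t.1.2 * N + M <= M + Q)%N.
  rewrite addnC leq_add2l DQ; apply: leqW; rewrite leq_mul2r.
  by rewrite ltnW ?orbT // ltn_ord.
apply: leq_trans (leq_add le_l (size_h t)) _; rewrite addnA [(a + _)%N]addnC leq_add2l.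
by rewrite leq_mul // leq_pred.
Qed.

End StepanovCount.

(** * Characters of roots of unity and Stepanov's bound for their sums *)

Section RootCharacter.

(* The character of the group of [n]-th roots of unity of [F] sending the
   primitive root [z] to [w], extended by 0. *)
Definition rootchar (F : fieldType) (n : nat) (z : F) (w : algC) (y : F) : algC :=
  \sum_(i < n) (if y == z ^+ i then w ^+ i else 0).

Variables (F : fieldType) (n : nat) (z : F) (w : algC).
Hypotheses (prim_z : n.-primitive_root z) (prim_w : n.-primitive_root w).
Local Notation phi := (rootchar n z w).

Lemma rootcharX i : phi (z ^+ i) = w ^+ i.
Proof.
have n_gt0 := prim_order_gt0 prim_z.
have lt_i : (i %% n < n)%N by rewrite ltn_mod.
rewrite /rootchar (bigD1 (Ordinal lt_i)) //= big1 ?addr0.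
  by rewrite (prim_expr_mod prim_z) eqxx (prim_expr_mod prim_w).
move=> j ne_j; rewrite (eq_prim_root_expr prim_z); case: eqP => // eq_ij.
by case/eqP: ne_j; apply: val_inj => /=; rewrite eq_ij modn_small.
Qed.

Lemma rootchar0 : phi 0 = 0.
Proof.
rewrite /rootchar big1 // => i _; case: eqP => // /esym/eqP.
by rewrite expf_eq0 (negPf (prim_root_neq0 prim_z)) andbF.
Qed.

Lemma rootchar1 : phi 1 = 1.
Proof. by rewrite -(expr0 z) rootcharX expr0. Qed.

Lemma rootcharM x y : x ^+ n = 1 \/ x = 0 -> y ^+ n = 1 \/ y = 0 ->
  phi (x * y) = phi x * phi y.
Proof.
move=> [xn|->] [yn|->]; rewrite ?mulr0 ?mul0r ?rootchar0 ?mulr0 ?mul0r //.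
have [i ->] := prim_rootP prim_z xn; have [j ->] := prim_rootP prim_z yn.
by rewrite -exprD !rootcharX exprD.
Qed.

Lemma norm_rootchar y : y ^+ n = 1 -> `|phi y| = 1.
Proof.
move=> yn; have [i ->] := prim_rootP prim_z yn; rewrite rootcharX normrX.
have /eqP -> : `|w| == 1; last by rewrite expr1n.
rewrite -(pexpr_eq1 (prim_order_gt0 prim_w)) // -normrX.
by rewrite (prim_expr_order prim_w) normr1.
Qed.

Lemma rootchar_eq1 y : y ^+ n = 1 -> phi y = 1 -> y = 1.
Proof.
move=> yn; have [i ->] := prim_rootP prim_z yn; rewrite rootcharX => /eqP.
by rewrite -(prim_order_dvd prim_w) (prim_order_dvd prim_z) => /eqP.
Qed.

End RootCharacter.

Lemma rootchar_map (F L : fieldType) (iota : {rmorphism F -> L}) n z w y :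
  rootchar n (iota z) w (iota y) = rootchar n z w y.
Proof.
by apply: eq_bigr => i _; rewrite -rmorphXn (inj_eq (fmorph_inj iota)).
Qed.

Lemma rootchar_sub (F : fieldType) n g (z : F) w y :
  (g %| n)%N -> n.-primitive_root z -> n.-primitive_root w ->
  y ^+ (n %/ g) = 1 \/ y = 0 ->
  rootchar n z w y = rootchar (n %/ g) (z ^+ g) (w ^+ g) y.
Proof.
move=> dvd_gn pz pw; have pz' := dvdn_prim_root pz (dvdn_div dvd_gn).
have pw' := dvdn_prim_root pw (dvdn_div dvd_gn).
have n_gt0 := prim_order_gt0 pz.
rewrite divnA // mulKn // in pz' pw'.
case=> [yn|->]; last by rewrite (rootchar0 w pz) (rootchar0 _ pz').
have [i ->] := prim_rootP pz' yn.
by rewrite (rootcharX pz' pw') -exprM (rootcharX pz pw) exprM.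
Qed.

Section StepanovSum.
Variables (L : finFieldType) (Q h : nat).
Hypothesis Q_pchar : [pchar L].-nat Q.
Hypothesis leQL : (Q <= #|L|)%N.
Hypothesis cardQ : #|[set x : L | x ^+ Q == x]| = Q.
Hypothesis DQ : Q = (h ^ 2)%N.

(** For B >= 1 this constant times B^2 dominates n (a + size f) with a = B^2 (1 + n size f) + 1, the
    quantity that Stepanov's method wants below Q. *)
Definition stepanov_const n s := (n * (2 + s + n * s))%N.

(** Stepanov's count gives a common upper bound U for the level sets of f^N. They and the zeros of
    [f] fill the field of Q elements, so the total defect of the level sets from U is small; as the
    n-th roots of unity sum to 0, U can be subtracted from each level set in the sum. *)
Lemma stepanov_sum_full n z (w : algC) f N S : (1 < n)%N -> n.-primitive_root z ->
  n.-primitive_root w -> f != 0 ->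
  (forall r, (0 < r < n)%N -> exists x : L, ~~ (n %| r * mup x f)%N) ->
  f \Po 'X^Q = f ^+ Q -> Q = (n * N).+1 -> (size f <= S)%N ->
  (3 * stepanov_const n S <= h)%N ->
  `|\sum_(x : L | x ^+ Q == x) rootchar n z w (f.[x] ^+ N)|
    <= (2 * stepanov_const n S * (1 + 3 * S) * h)%:R.
Proof.
move=> n_gt1 pz pw f_neq0 f_order f_frob DQN leS le_h.
set c := stepanov_const n S; pose B := (h %/ c)%N.
have sf_gt0 : (0 < size f)%N by rewrite size_poly_gt0.
have c_gt0 : (0 < c)%N by rewrite /c /stepanov_const; nia.
have leB : (B * c <= h)%N by rewrite /B leq_trunc_div.
have B_ge3 : (3 <= B)%N by rewrite /B leq_divRL.
have ltB : (h < 2 * c * B.-1)%N.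
  have : (h < B.+1 * c)%N by rewrite /B ltn_ceil.
  move/leq_trans; apply; rewrite mulnC -mulnA mulnCA leq_mul2l.
  by apply/orP; right; move: B_ge3; lia.
have leaQ : (n * ((B ^ 2 * (1 + n * size f)).+1 + size f) <= Q)%N.
  rewrite DQ; apply: (@leq_trans ((B * c) ^ 2)); last by rewrite leq_sqr.
  have ltnc : (n * (2 + size f + n * size f) <= c)%N.
    by rewrite /c /stepanov_const leq_mul2l leq_add ?orbT // ?leq_add2l // leq_mul2l leS orbT.
  rewrite expnMn; apply: (@leq_trans (B ^ 2 * c)).
    apply: (leq_trans _ (leq_mul (leqnn _) ltnc)).
    rewrite [X in (_ <= X)%N]mulnCA leq_mul2l; apply/orP; right.
    have : (0 < B ^ 2)%N by rewrite expn_gt0 (leq_trans _ B_ge3).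
    by move: (B ^ 2)%N => b b_gt0; nia.
  by rewrite leq_mul2l -{1}[c]expn1 leq_pexp2l ?orbT.
have leBQ : (n * B.-1 <= Q)%N.
  apply: leq_trans leaQ; rewrite leq_mul2l; apply/orP; right; apply: leq_trans (leq_pred _) _.
  rewrite -addn1 -addnA; apply: leq_trans (leq_addr _ _).
  by rewrite -{1}[B]muln1 -mulnn -mulnA leq_mul2l muln_gt0 (leq_trans _ B_ge3) //= orbT.
have leaQ' : ((B ^ 2 * (1 + n * size f)).+1 <= Q)%N.
  apply: leq_trans leaQ; apply: leq_trans (leq_pmull _ (ltnW n_gt1)).
  exact: leq_addr.
have leB1Q : (B.-1 <= Q)%N.
  by apply: leq_trans leBQ; rewrite leq_pmull // ltnW.
pose X (i : nat) := [set x : L | (x ^+ Q == x) && (f.[x] ^+ N == z ^+ i)].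
have cardX i : (#|X i| * (n * B.-1) <= (B ^ 2 * (1 + n * size f)).+1 + Q * B.-1
    + size f * (n * B.-1 + Q))%N.
  have := stepanov_count pz f_neq0 f_order DQN Q_pchar f_frob leQL
     (ltnW (ltnW B_ge3)) leaQ (expf_neq0 i (prim_root_neq0 pz)) (enum_uniq (X i)).
  rewrite -cardE; apply => x; rewrite mem_enum inE => /andP[/eqP-> /eqP->] //.
set K := ((_ + _ + _)%N) in cardX.
pose U := (K %/ (n * B.-1))%N.
have nB_gt0 : (0 < n * B.-1)%N by rewrite muln_gt0 (ltnW n_gt1) /=; move: B_ge3; lia.
have leXU i : (#|X i| <= U)%N by rewrite /U leq_divRL.
have fxn x : x ^+ Q = x -> f.[x] != 0 -> (f.[x] ^+ N) ^+ n = 1.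
  move=> xQ fx0; apply: (mulfI fx0); rewrite mulr1 -exprM mulnC -exprS -DQN.
  by rewrite -horner_exp -f_frob horner_comp hornerXn xQ.
have sumX : (Q <= \sum_(i < n) #|X i| + size f)%N.
  pose Z := [set x | root f x].
  have cardZ : (#|Z| <= size f)%N.
    rewrite cardE ltnW // max_poly_roots ?enum_uniq //.
    by apply/allP => x; rewrite mem_enum inE.
  apply: leq_trans (leq_add (leqnn _) cardZ).
  have cE (A : {set L}) : #|A| = (\sum_x (x \in A : nat))%N.
    by rewrite -sum1_card big_mkcond.
  have -> : (\sum_(i < n) #|X i| = \sum_(i < n) \sum_x (x \in X i : nat))%N.
    by apply: eq_bigr => i _; exact: cE.
  have -> : Q = (\sum_x (x \in [set x : L | x ^+ Q == x] : nat))%N by rewrite -cE.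
  rewrite (cE Z).
  rewrite exchange_big /= -big_split /=; apply: leq_sum => x _.
  rewrite !inE; case: eqP => // xQ; case: (boolP (root f x)) => fx0.
    by rewrite addn1.
  have [k Dk] := prim_rootP pz (fxn x xQ fx0).
  by rewrite addn0 (bigD1 k) //= inE xQ eqxx Dk eqxx.
have sumw : \sum_(i < n) w ^+ i = 0.
  have w_neq1 : w != 1.
    apply: contraTneq n_gt1 => w1; rewrite -leqNgt.
    have : w ^+ 1 == 1 by rewrite w1 expr1n.
    by rewrite -(prim_order_dvd pw) dvdn1 => /eqP->.
  apply: (mulfI (_ : w - 1 != 0)); first by rewrite subr_eq0.
  by rewrite -subrX1 (prim_expr_order pw) subrr mulr0.
have -> : \sum_(x : L | x ^+ Q == x) rootchar n z w (f.[x] ^+ N)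
     = \sum_(i < n) w ^+ i * (#|X i|%:R - U%:R).
  transitivity (\sum_(i < n) w ^+ i * #|X i|%:R); last first.
    under [RHS]eq_bigr => i _ do rewrite mulrBr.
    by rewrite sumrB -mulr_suml sumw mul0r subr0.
  rewrite exchange_big /=; apply: eq_bigr => i _.
  rewrite -big_mkcondr /= sumr_const [RHS]mulr_natr; congr (_ *+ _).
  by apply: eq_card => x; rewrite !inE.
apply: le_trans (ler_norm_sum _ _ _) _.
have norm_w : `|w| = 1.
  by have := norm_rootchar pz pw (prim_expr_order pz); rewrite -[z in rootchar _ _ _ z]expr1 (rootcharX pz pw).
rewrite (eq_bigr (fun i : 'I_n => (U - #|X i|)%:R)); last first.
  move=> i _; rewrite normrM normrX norm_w expr1n mul1r distrC natrB //.
  by rewrite ger0_norm // subr_ge0 ler_nat.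
rewrite -natr_sum ler_nat.
have sumU : (\sum_(i < n) (U - #|X i|) + \sum_(i < n) #|X i| = n * U)%N.
  rewrite -big_split /= (eq_bigr (fun=> U)) ?sum_nat_const ?card_ord // => i _.
  by rewrite subnK.
have leUK : (U * (n * B.-1) <= K)%N by rewrite /U leq_trunc_div.
set T := (\sum_(i < n) (U - _))%N in sumU *.
have : (T + Q <= n * U + size f)%N by rewrite -sumU -addnA leq_add2l.
move=> leT; have B1_gt0 : (0 < B.-1)%N by move: B_ge3; lia.
have leT2 : (B.-1 * T <= (1 + 3 * S) * Q)%N.
  have : (B.-1 * (T + Q) <= B.-1 * (n * U + size f))%N by rewrite leq_mul2l leT orbT.
  have : (size f * (n * B.-1 + Q) <= S * (Q + Q))%N by rewrite leq_mul // leq_add2r.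
  have : (B.-1 * size f <= Q * S)%N by rewrite leq_mul.
  move: leUK leaQ'; rewrite /K; set x1 := ((_ ^ 2 * _).+1); set x2 := (size f * _)%N.
  rewrite !mulnDr mulnDl mul1n -mulnA (mulnC Q S) (mulnC U) -mulnA mulnCA (mulnC B.-1 Q).
  move: (B.-1 * T)%N (Q * B.-1)%N (S * Q)%N (B.-1 * (n * U))%N (B.-1 * size f)%N.
  by move=> *; lia.
have : (B.-1 * T <= B.-1 * (2 * c * (1 + 3 * S) * h))%N; last by rewrite leq_pmul2l.
apply: leq_trans leT2 _; rewrite DQ -mulnn.
have -> : (B.-1 * (2 * c * (1 + 3 * S) * h) = (1 + 3 * S) * (2 * c * B.-1 * h))%N by lia.
by rewrite leq_mul2l leq_mul2r (ltnW ltB) !orbT.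
Qed.

Lemma mup_prod_XsubCX (t : seq L) (k : L -> nat) y : uniq t ->
  mup y (\prod_(x <- t) ('X - x%:P) ^+ k x) = if y \in t then k y else 0%N.
Proof.
elim: t => [|x t IHt] /= => [_|/andP[t'x t_uniq]].
  by rewrite big_nil mupNroot // root1.
have prod_neq0 : \prod_(x <- t) ('X - x%:P) ^+ k x != 0.
  by rewrite prodf_seq_neq0; apply/allP => z _; rewrite expf_neq0 // polyXsubC_eq0.
rewrite big_cons mupM ?expf_neq0 ?polyXsubC_eq0 // mup_XsubCX IHt // inE.
rewrite [y == x]eq_sym; case: eqP => [<-|] //=; by rewrite (negPf t'x) addn0.
Qed.

(** With [g] the gcd of n and all multiplicities in [s], the product is f^g, and the character of
    order n at f^g is one of order n / g at [f], which satisfies the irreducibility condition. The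
    point [y0] ensures g < n. *)
Lemma stepanov_sum n z (w : algC) N S (s : seq L) (y0 : L) : n.-primitive_root z ->
  n.-primitive_root w -> Q = (n * N).+1 -> {in s, forall y, y ^+ Q = y} ->
  y0 \in s -> ~~ (n %| count_mem y0 s)%N -> (size s < S)%N ->
  (3 * stepanov_const n S <= h)%N ->
  `|\sum_(x : L | x ^+ Q == x) rootchar n z w ((\prod_(y <- s) (x - y)) ^+ N)|
    <= (2 * stepanov_const n S * (1 + 3 * S) * h)%:R.
Proof.
move=> pz pw DQN s_frob s_y0 y0_ndvd lt_sS le_h.
have n_gt0 := prim_order_gt0 pz.
pose mu y := count_mem y s; pose t := undup s.
pose g := \big[gcdn/n]_(y <- t) mu y.
have dvd_gn : (g %| n)%N.
  rewrite /g; elim: (t) => [|y u IHu]; first by rewrite big_nil.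
  by rewrite big_cons (dvdn_trans (dvdn_gcdr _ _)).
have dvd_gmu y : y \in s -> (g %| mu y)%N.
  rewrite -mem_undup -/t /g; elim: (t) => // x u IHu; rewrite inE big_cons => /orP[/eqP->|].
    exact: dvdn_gcdl.
  by move=> /IHu; apply: dvdn_trans; exact: dvdn_gcdr.
have g_max r : (forall y, y \in t -> (n %| r * mu y)%N) -> (n %| r * g)%N.
  rewrite /g; elim: (t) => [|y u IHu] nP; first by rewrite big_nil dvdn_mull.
  rewrite big_cons muln_gcdr dvdn_gcd nP ?mem_head // IHu // => x u_x.
  by apply: nP; rewrite inE u_x orbT.
have g_gt0 : (0 < g)%N := dvdn_gt0 n_gt0 dvd_gn.
pose n' := (n %/ g)%N; have Dn : (n' * g = n)%N by rewrite divnK.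
have n'_gt1 : (1 < n')%N.
  rewrite ltn_neqAle eq_sym divn_gt0 // (dvdn_leq n_gt0) // andbT.
  apply: contraNneq y0_ndvd => n'1; have := dvd_gmu _ s_y0.
  by rewrite -[g]mul1n -n'1 Dn.
have pz' : n'.-primitive_root (z ^+ g).
  by have := dvdn_prim_root pz (dvdn_div dvd_gn); rewrite divnA // mulKn.
have pw' : n'.-primitive_root (w ^+ g).
  by have := dvdn_prim_root pw (dvdn_div dvd_gn); rewrite divnA // mulKn.
pose f := \prod_(y <- t) ('X - y%:P) ^+ (mu y %/ g).
have f_neq0 : f != 0.
  by rewrite prodf_seq_neq0; apply/allP => y _; rewrite expf_neq0 // polyXsubC_eq0.
have mup_f y : mup y f = (mu y %/ g)%N.
  rewrite mup_prod_XsubCX ?undup_uniq // mem_undup; case: ifPn => // s'y.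
  by rewrite /mu (count_memPn s'y) div0n.
have f_order r : (0 < r < n')%N -> exists x, ~~ (n' %| r * mup x f)%N.
  move=> /andP[r_gt0 lt_rn']; apply/existsP; apply: contraTT lt_rn'.
  rewrite negb_exists => /forallP rP; rewrite -leqNgt dvdn_leq //.
  rewrite -(dvdn_pmul2r g_gt0) Dn; apply: g_max => y; rewrite mem_undup => s_y.
  rewrite -Dn -(divnK (dvd_gmu y s_y)) mulnA dvdn_pmul2r //.
  by have := rP y; rewrite negbK mup_f.
have f_frob : f \Po 'X^Q = f ^+ Q.
  rewrite rmorph_prod /= -prodrXl; apply: eq_big_seq => y.
  rewrite mem_undup => s_y; rewrite rmorphXn /= comp_polyB comp_polyX comp_polyC.
  rewrite -!exprM mulnC exprM; congr (_ ^+ _).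
  have Qc : [pchar {poly L}].-nat Q by rewrite (eq_pnat _ (pchar_poly L)).
  by rewrite exprBn_pchar // -polyC_exp s_frob.
have prod_s : \prod_(y <- s) ('X - y%:P) = f ^+ g.
  rewrite -prodrXl -big_undup_iterop_count.
  apply: eq_big_seq => y; rewrite mem_undup => s_y.
  by rewrite -exprM divnK ?dvd_gmu.
have DQN' : Q = (n' * (g * N)).+1 by rewrite mulnA Dn.
have size_f : (size f <= S)%N.
  apply: leq_trans lt_sS; rewrite -(size_prod_XsubC s id) prod_s.
  by rewrite dvdp_leq ?expf_neq0 // -(prednK g_gt0) exprS dvdp_mulIl.
have le_n : (n' <= n)%N by rewrite leq_div.
have le_const : (stepanov_const n' S <= stepanov_const n S)%N.
  by rewrite leq_mul // leq_add2l leq_mul2r le_n orbT.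
have le_c : (3 * stepanov_const n' S <= h)%N.
  by apply: leq_trans le_h; rewrite leq_mul2l le_const.
have N_gt0 : (0 < N)%N.
  rewrite lt0n; apply: contraTneq le_h => N0; rewrite -ltnNge /stepanov_const.
  by move: DQ; rewrite DQN N0 muln0 -mulnn; nia.
have := stepanov_sum_full n'_gt1 pz' pw' f_neq0 f_order f_frob DQN' size_f le_c.
have -> : \sum_(x | x ^+ Q == x) rootchar n' (z ^+ g) (w ^+ g) (f.[x] ^+ (g * N))
   = \sum_(x | x ^+ Q == x) rootchar n z w ((\prod_(y <- s) (x - y)) ^+ N).
  apply: eq_bigr => x /eqP xQ.
  have -> : \prod_(y <- s) (x - y) = f.[x] ^+ g.
    rewrite -horner_exp -prod_s horner_prod; apply: eq_bigr => y _.
    by rewrite !hornerE.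
  rewrite -exprM; symmetry; apply: rootchar_sub => //.
  have [->|fx0] := eqVneq f.[x] 0; [right|left].
    by rewrite expr0n muln_eq0 !gtn_eqF.
  apply: (mulfI fx0); rewrite mulr1 -exprM -exprS mulnC -DQN'.
  by rewrite -horner_exp -f_frob horner_comp hornerXn xQ.
move/le_trans; apply; rewrite ler_nat.
by rewrite !leq_mul2r leq_mul2l le_const !orbT.
Qed.

End StepanovSum.

(** * Inverse roots and power sums *)

Section PowerSums.
Implicit Types (bs : seq algC) (b h C r : algC).

Lemma bernoulli_ge r k : 0 <= r -> 1 + k%:R * r <= (1 + r) ^+ k.
Proof.
move=> r_ge0; elim: k => [|k IHk]; first by rewrite mul0r addr0 expr0.
rewrite exprS; apply: le_trans (ler_wpM2l (addr_ge0 ler01 r_ge0) IHk).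
rewrite -subr_ge0 -[k.+1]addn1 natrD.
have -> : (1 + r) * (1 + k%:R * r) - (1 + (k%:R + 1%:R) * r) = k%:R * (r * r) by ring.
by rewrite mulr_ge0 ?ler0n // mulr_ge0.
Qed.

Lemma bounded_powers_le1 r C k1 : 0 <= r ->
  (forall k, (k1 <= k)%N -> r ^+ k <= C) -> r <= 1.
Proof.
move=> r_ge0 rC; rewrite real_leNgt ?ger0_real ?rpred1 //; apply/negP => r_gt1.
have d_gt0 : 0 < r - 1 by rewrite subr_gt0.
have C_ge0 : 0 <= C by apply: le_trans (rC k1 (leqnn _)); rewrite exprn_ge0.
have := archi_boundP (divr_ge0 C_ge0 (ltW d_gt0)); set N := Num.bound _ => ltN.
have := rC (k1 + N)%N (leq_addr _ _); rewrite real_leNgt ?ger0_real ?exprn_ge0 //.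
move/negP; apply; move: ltN; rewrite ltr_pdivrMr // => /lt_le_trans; apply.
have := bernoulli_ge (k1 + N) (ltW d_gt0); rewrite [X in _ <= X ^+ _ -> _]addrC subrK.
apply: le_trans; rewrite natrD mulrDl addrA.
by rewrite ler_wpDl // addr_ge0 // mulr_ge0 ?ler0n // ltW.
Qed.

(* Lagrange interpolation isolates the contribution of a single [b]. *)
Lemma power_sums_bound bs C h k1 : 0 < h ->
  (forall k, (k1 <= k)%N -> `|\sum_(b <- bs) b ^+ k| <= C * h ^+ k) ->
  {in bs, forall b, `|b| <= h}.
Proof.
move=> h_gt0 bsC b bs_b.
pose p := \prod_(c <- rem b (undup bs)) ('X - c%:P).
have pb_neq0 : p.[b] != 0.
  rewrite horner_prod prodf_seq_neq0; apply/allP => c.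
  rewrite mem_rem_uniq ?undup_uniq // inE => /andP[ne_cb _] /=.
  by rewrite !hornerE subr_eq0 eq_sym.
have pc c : c \in bs -> c != b -> p.[c] = 0.
  move=> bs_c ne_cb; apply/eqP; rewrite -[_ == 0]/(root p c) root_prod_XsubC.
  by rewrite mem_rem_uniq ?undup_uniq // inE ne_cb mem_undup.
pose m := count_mem b bs; have m_gt0 : (0 < m)%N by rewrite -has_count has_pred1.
have isolate k : m%:R * p.[b] * b ^+ k = \sum_(j < size p) p`_j * \sum_(c <- bs) c ^+ (k + j).
  transitivity (\sum_(c <- bs) c ^+ k * p.[c]).
    rewrite (bigID (pred1 b)) /= [X in _ = _ + X]big_seq_cond [X in _ = _ + X]big1 => [|c]; last first.
      by case/andP=> bs_c ne_cb; rewrite pc // mulr0.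
    rewrite addr0 (eq_bigr (fun=> b ^+ k * p.[b])) => [|c /eqP-> //].
    by rewrite big_const_seq iter_addr_0 -[RHS]mulr_natl -/m; ring.
  under [RHS]eq_bigr => j _ do rewrite mulr_sumr.
  rewrite exchange_big /=; apply: eq_bigr => c _; rewrite horner_coef mulr_sumr.
  by apply: eq_bigr => j _; rewrite exprD; ring.
pose D := \sum_(j < size p) `|p`_j| * (C * h ^+ j).
have mp_gt0 : 0 < `|m%:R * p.[b]| by rewrite normr_gt0 mulf_neq0 ?pnatr_eq0 -?lt0n.
suff : `|b| / h <= 1 by rewrite ler_pdivrMr // mul1r.
apply: (@bounded_powers_le1 _ (D / `|m%:R * p.[b]|) k1); first by rewrite divr_ge0 ?normr_ge0 // ltW.
move=> k le_k; rewrite expr_div_n ler_pdivrMr ?exprn_gt0 // mulrAC ler_pdivlMr //.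
rewrite -normrX -normrM mulrC isolate mulr_suml.
apply: le_trans (ler_norm_sum _ _ _) _.
apply: ler_sum => j _; rewrite normrM -mulrA ler_wpM2l //.
apply: le_trans (bsC _ (leq_trans le_k (leq_addr _ _))) _.
by rewrite exprD mulrA mulrAC.
Qed.

Definition unit_prod bs : {poly algC} := \prod_(b <- bs) (1 - b *: 'X).
(** The sign is that of the coefficients of X U' / U for U = [unit_prod bs], the place taken by the
    character sums when U is an L-function. *)
Definition psum bs j : algC := - \sum_(b <- bs) b ^+ j.

Lemma coef_linM b (p : {poly algC}) k :
  ((1 - b *: 'X) * p)`_k = p`_k - b * (if k is k'.+1 then p`_k' else 0).
Proof.
rewrite mulrBl mul1r -scalerAl coefB coefZ coefXM; by case: k.
Qed.

Lemma newton_unit_prod bs k :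
  k.+1%:R * (unit_prod bs)`_k.+1
    = \sum_(j < k.+1) psum bs j.+1 * (unit_prod bs)`_(k - j).
Proof.
elim: bs k => [|b bs IHbs] k.
  rewrite /unit_prod big_nil coef1 mulr0 big1 // => j _.
  by rewrite /psum big_nil oppr0 mul0r.
have DU : unit_prod (b :: bs) = (1 - b *: 'X) * unit_prod bs by rewrite /unit_prod big_cons.
set r := unit_prod bs in IHbs DU *.
have Dps j : psum (b :: bs) j = psum bs j - b ^+ j.
  by rewrite /psum big_cons opprD addrC.
have r_prev : \sum_(j < k.+1) psum bs j.+1 * (if (k - j)%N is i.+1 then r`_i else 0)
    = k%:R * r`_k.
  rewrite big_ord_recr /= subnn mulr0 addr0; case: k => [|k].
    by rewrite big_ord0 mul0r.
  rewrite IHbs; apply: eq_bigr => j _; rewrite subSn //.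
  by rewrite -ltnS.
have telesc : \sum_(j < k.+1) b ^+ j.+1 * (r`_(k - j) - b * (if (k - j)%N is i.+1 then r`_i else 0))
    = b * r`_k.
  elim: k {r_prev} => [|k IHk]; first by rewrite big_ord1 /= mulr0 subr0 expr1.
  rewrite big_ord_recl subn0 /= expr1 mulrBr -[RHS]addr0 -addrA; congr (_ + _).
  under eq_bigr => j _ do rewrite /bump /= add1n subSS exprS -mulrA.
  by rewrite -mulr_sumr IHk addNr.
rewrite DU coef_linM mulrBr IHbs.
under [RHS]eq_bigr => j _ do rewrite coef_linM Dps mulrBl.
rewrite sumrB telesc.
under [X in _ = X - _]eq_bigr => j _ do rewrite mulrBr mulrCA.
by rewrite sumrB -mulr_sumr r_prev -addrA -opprD; congr (_ - _); rewrite -[k.+1]addn1 natrD; ring.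
Qed.

Lemma newton_unique (a S T : nat -> algC) K : a 0%N = 1 ->
  (forall k, (k < K)%N -> k.+1%:R * a k.+1 = \sum_(j < k.+1) S j.+1 * a (k - j)%N) ->
  (forall k, (k < K)%N -> k.+1%:R * a k.+1 = \sum_(j < k.+1) T j.+1 * a (k - j)%N) ->
  forall j, (j < K)%N -> S j.+1 = T j.+1.
Proof.
move=> a0 aS aT j; have [n] := ubnP j; elim: n j => // n IHn j; rewrite ltnS => le_jn lt_jK.
have := aS _ lt_jK; rewrite (aT _ lt_jK) !big_ord_recr /= subnn a0 !mulr1.
have -> : \sum_(i < j) T i.+1 * a (j - i)%N = \sum_(i < j) S i.+1 * a (j - i)%N.
  apply: eq_bigr => i _; rewrite IHn //; first exact: leq_trans (ltn_ord i) le_jn.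
  exact: ltn_trans (ltn_ord i) lt_jK.
by move/addrI.
Qed.

Lemma poly_unit_prod (p : {poly algC}) : p`_0 = 1 ->
  exists2 bs, p = unit_prod bs & size bs = (size p).-1.
Proof.
move=> p0; have [rs Dp] := closed_field_poly_normal p.
have p_neq0 : p != 0 by apply: contraTneq (oner_neq0 algC) => p0'; rewrite -p0 p0' coef0 eqxx.
have rs_neq0 : all (fun r => r != 0) rs.
  apply/allP => r rs_r; apply: contraTneq (oner_neq0 algC) => r0.
  have : root p r by rewrite Dp rootZ ?lead_coef_eq0 // root_prod_XsubC.
  by rewrite r0 /root horner_coef0 p0 => ->.
exists (map GRing.inv rs); last first.
  by rewrite size_map {1}Dp size_scale ?lead_coef_eq0 // size_prod_XsubC.
have [c Dc] : exists c, p = c *: unit_prod (map GRing.inv rs).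
  exists (lead_coef p * \prod_(z <- rs) - z); rewrite {1}Dp -scalerA; congr (_ *: _).
  rewrite /unit_prod big_map; elim: rs rs_neq0 {Dp} => [|z rs IHrs] /=.
    by rewrite !big_nil scale1r.
  case/andP => z_neq0 /IHrs IH; rewrite !big_cons {}IH -scalerA.
  rewrite [in RHS]scalerAr scalerAl; congr (_ * _).
  by rewrite scalerBr scalerA mulNr mulfV // scaleN1r opprK [RHS]addrC scaleNr alg_polyC.
have : c = 1; last by move=> c1; rewrite {1}Dc c1 scale1r.
have U0 : (unit_prod (map GRing.inv rs))`_0 = 1.
  rewrite /unit_prod -horner_coef0 horner_prod big1 // => z _.
  by rewrite !hornerE ?mulr0 ?subr0.
by move: p0; rewrite {1}Dc coefZ U0 mulr1.
Qed.

(* The Riemann hypothesis for an abstract L-function: if the power sums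
   attached to a polynomial of degree < D with constant coefficient 1 are
   O(r^(J k)) along the multiples of J, its inverse roots have size <= r. *)
Lemma rh_of_power_sums (a : nat -> algC) (D J k1 : nat) C r s1 :
  a 0%N = 1 -> (forall k, (D <= k)%N -> a k = 0) -> 0 < r -> (0 < J)%N ->
  (forall k, (k1 <= k)%N -> exists S : nat -> algC,
     [/\ forall i, (i < J * k)%N -> i.+1%:R * a i.+1 = \sum_(j < i.+1) S j.+1 * a (i - j)%N,
         S 1%N = s1 & `|S (J * k)%N| <= C * (r ^+ J) ^+ k]) ->
  `|s1| <= D.-1%:R * r.
Proof.
move=> a0 aD r_gt0 J_gt0 SC.
have p0 : (\poly_(i < D) a i)`_0 = 1.
  by rewrite coef_poly; case: ltnP => // D0; rewrite -a0 aD.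
have [bs Dbs szbs] := poly_unit_prod p0.
have aE k : (unit_prod bs)`_k = a k.
  by rewrite -Dbs coef_poly; case: ltnP => // leDk; rewrite aD.
(* Each k comes with its own [S], computed in its own extension field. Newton's identities identify
   all of them with the power sums of one list of inverse roots. *)
have psE (S : nat -> algC) K : (forall i, (i < K)%N ->
    i.+1%:R * a i.+1 = \sum_(j < i.+1) S j.+1 * a (i - j)%N) ->
    forall j, (j < K)%N -> S j.+1 = psum bs j.+1.
  move=> aS; apply: (newton_unique (a := a)) => // k _.
  by rewrite -aE newton_unit_prod; apply: eq_bigr => i _; rewrite aE.
have s1E : s1 = psum bs 1.
  have [S [aS <- _]] := SC k1.+1 (leqnSn _).
  by apply: psE aS _ _; rewrite muln_gt0 J_gt0.
have bsJ : {in map (fun b => b ^+ J) bs, forall b, `|b| <= r ^+ J}.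
  apply: (@power_sums_bound _ C _ k1.+1); first by rewrite exprn_gt0.
  move=> [//|k] lt_k; have [S [aS _]] := SC k.+1 (ltnW lt_k).
  have DJ : (J * k.+1)%N = (J * k.+1).-1.+1 by rewrite prednK // muln_gt0 J_gt0.
  rewrite DJ (psE S _ aS) -?DJ // /psum normrN; congr (`|_| <= _); rewrite big_map.
  by apply: eq_bigr => b _; rewrite exprM.
have bs_r b : b \in bs -> `|b| <= r.
  move=> bs_b; have := bsJ _ (map_f (fun b => b ^+ J) bs_b).
  by rewrite normrX ler_pXn2r ?nnegrE ?normr_ge0 ?(ltW r_gt0) //.
rewrite s1E /psum normrN; apply: le_trans (ler_norm_sum _ _ _) _.
apply: (@le_trans _ _ (\sum_(b <- bs) r)).
  by rewrite !big_seq; apply: ler_sum => b bs_b; rewrite expr1 bs_r.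
rewrite big_const_seq count_predT iter_addr_0 -[leLHS]mulr_natl ler_wpM2r ?(ltW r_gt0) //.
by rewrite ler_nat szbs -!subn1 leq_sub2r // size_poly.
Qed.

End PowerSums.

(** * The L-function of a character of monic polynomials *)

Section RationalPolynomials.
Variables (K : finFieldType) (e : nat).
Hypothesis e_pchar : [pchar K].-nat e.
Hypothesis e_gt0 : (0 < e)%N.
Implicit Types (P Q : {poly K}) (x : K).

(* [P] has its coefficients in the subfield [x ^+ e = x]. *)
Definition rational P := P ^+ e == P \Po 'X^e.

Let pcharP : [pchar {poly K}].-nat e.
Proof. by rewrite (eq_pnat _ (pchar_poly K)). Qed.

Lemma rationalM P Q : rational P -> rational Q -> rational (P * Q).
Proof. by rewrite /rational exprMn comp_polyM => /eqP-> /eqP->. Qed.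

Lemma rational1 : rational 1.
Proof. by rewrite /rational expr1n comp_polyC. Qed.

Lemma rationalD P Q : rational P -> rational Q -> rational (P + Q).
Proof. by rewrite /rational exprDn_pchar // comp_polyD => /eqP-> /eqP->. Qed.

Lemma rationalB P Q : rational P -> rational Q -> rational (P - Q).
Proof. by rewrite /rational exprBn_pchar // comp_polyB => /eqP-> /eqP->. Qed.

Lemma rational_divl P Q : P != 0 -> rational P -> rational (P * Q) -> rational Q.
Proof.
move=> P_neq0 /eqP rP; rewrite /rational exprMn comp_polyM -rP => /eqP.
by move/(mulfI (expf_neq0 e P_neq0)) => ->.
Qed.

(** Raising P = q M + R to the power e and substituting X^e give two divisions of the same
    polynomial by M^e; uniqueness of the remainder makes R rational. *)
Lemma rational_modp P (M : {poly K}) : M != 0 -> rational P -> rational M -> rational (P %% M).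
Proof.
move=> M_neq0 /eqP rP /eqP rM; rewrite /rational.
have DP := divp_eq P M; set q := P %/ M in DP; set R := P %% M in DP *.
have szR : (size R < size M)%N by rewrite ltn_modp.
have E1 : (q ^+ e - (q \Po 'X^e)) * M ^+ e = (R \Po 'X^e) - R ^+ e.
  have := rP; rewrite {1 2}DP exprDn_pchar // exprMn comp_polyD comp_polyM -rM => E.
  have -> : R \Po 'X^e = q ^+ e * M ^+ e + R ^+ e - (q \Po 'X^e) * M ^+ e.
    by rewrite E addrAC subrr add0r.
  by rewrite mulrBl [RHS]addrAC addrK.
rewrite eq_sym -subr_eq0 -E1; apply: contraT => neq0.
have q_neq0 : q ^+ e - (q \Po 'X^e) != 0 by apply: contraNneq neq0 => ->; rewrite mul0r.
have := dvdp_leq neq0 (dvdp_mull (q ^+ e - (q \Po 'X^e)) (dvdpp (M ^+ e))).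
rewrite E1 leqNgt => /negP[].
apply: leq_ltn_trans (size_polyD _ _) _; rewrite size_polyN gtn_max.
have szM : (0 < size (M ^+ e))%N by rewrite size_poly_gt0 expf_neq0.
have szMe : (size (M ^+ e) = ((size M).-1 * e).+1)%N by rewrite -size_exp prednK.
have le_szR : ((size R).-1 * e < (size M).-1 * e)%N \/ R = 0.
  have [->|R_neq0] := eqVneq R 0; [by right | left].
  rewrite ltn_pmul2r //; move: szR; rewrite -size_poly_gt0 in R_neq0.
  by move: R_neq0; case: (size R) => // s _; case: (size M).
case: le_szR => [lt_sz|->]; last by rewrite comp_poly0 expr0n gtn_eqF // size_poly0 szMe.
rewrite szMe !ltnS; apply/andP; split.
  apply: leq_trans (leqSpred _) _; by rewrite size_comp_poly size_polyXn.
by apply: leq_trans (leqSpred _) _; rewrite size_exp.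
Qed.

Lemma rational_frob_root P x : rational P -> P.[x ^+ e] = P.[x] ^+ e.
Proof. by move=> /eqP rP; rewrite -horner_exp rP horner_comp hornerXn. Qed.

(** When x^(e^j) = x, this is the characteristic polynomial of x for the extension of degree j of
    the base field, hence a power of its minimal polynomial. *)
Definition conjpoly j x : {poly K} := \prod_(i < j) ('X - (x ^+ (e ^ i))%:P).

Lemma monic_conjpoly j x : conjpoly j x \is monic.
Proof. by rewrite monic_prod_XsubC. Qed.

Lemma size_conjpoly j x : size (conjpoly j x) = j.+1.
Proof. by rewrite size_prod_XsubC /index_enum -enumT size_enum_ord. Qed.

Lemma rational_conjpoly j x : x ^+ (e ^ j) = x -> rational (conjpoly j x).
Proof.
move=> xj; rewrite /rational /conjpoly -prodrXl rmorph_prod /=; apply/eqP.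
under eq_bigr => i _ do rewrite exprBn_pchar // -polyC_exp -exprM -expnSr.
under [RHS]eq_bigr => i _ do rewrite comp_polyB comp_polyX comp_polyC.
case: j xj => [|j] xj; first by rewrite !big_ord0.
rewrite big_ord_recr [RHS]big_ord_recl /= xj mulrC; congr (_ * _).
Qed.

Lemma conjpoly_root j x : (0 < j)%N -> root (conjpoly j x) x.
Proof.
case: j => // j _; rewrite /conjpoly big_ord_recl rootM root_XsubC /= expn0 expr1.
by rewrite eqxx.
Qed.

Lemma conjpolyD i j x : x ^+ (e ^ i) = x ->
  conjpoly (i + j) x = conjpoly i x * conjpoly j x.
Proof.
move=> xi; rewrite /conjpoly big_split_ord /=; congr (_ * _).
by apply: eq_bigr => l _; rewrite expnD exprM xi.
Qed.

Lemma conjpolyM i j x : x ^+ (e ^ i) = x -> conjpoly (j * i) x = conjpoly i x ^+ j.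
Proof.
move=> xi; elim: j => [|j IHj]; first by rewrite mul0n /conjpoly big_ord0.
by rewrite mulSn conjpolyD // IHj exprS.
Qed.

Let frob x := x ^+ e.

Lemma frob_inj : injective frob.
Proof.
move=> x y /eqP; rewrite /frob -subr_eq0 -exprBn_pchar // expf_eq0.
by rewrite subr_eq0 => /andP[_ /eqP].
Qed.

Lemma iter_frob i x : iter i frob x = x ^+ (e ^ i).
Proof. by elim: i => [|i IHi] /=; rewrite ?expn0 ?expr1 // IHi /frob -exprM expnSr. Qed.

(** The degree of x over the base field, as the length of its Frobenius orbit. *)
Definition conjdeg x := order frob x.

Lemma conjdeg_gt0 x : (0 < conjdeg x)%N. Proof. exact: order_gt0. Qed.

Lemma conjdegP j x : (x ^+ (e ^ j) == x) = (conjdeg x %| j)%N.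
Proof.
have fix_deg : x ^+ (e ^ conjdeg x) = x by rewrite -iter_frob iter_order //; exact: frob_inj.
have fix_mul q : x ^+ (e ^ (q * conjdeg x)) = x.
  by elim: q => [|q IHq]; rewrite ?mul0n ?expn0 ?expr1 // mulSn expnD exprM fix_deg.
rewrite {1}(divn_eq j (conjdeg x)) expnD exprM fix_mul /dvdn.
have lt_r : (j %% conjdeg x < conjdeg x)%N by rewrite ltn_mod conjdeg_gt0.
have := orbit_uniq frob x; rewrite /orbit => u; rewrite -iter_frob.
have szt : size (traject frob x (order frob x)) = conjdeg x by rewrite size_traject.
have := nth_uniq x (i := (j %% conjdeg x)%N) (j := 0%N) _ _ u; rewrite szt lt_r conjdeg_gt0.
by rewrite !nth_traject ?conjdeg_gt0 //= => ->.
Qed.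

Lemma conj_uniq x : uniq [seq x ^+ (e ^ i) | i <- iota 0 (conjdeg x)].
Proof.
have := orbit_uniq frob x; rewrite /orbit; congr uniq.
apply: (@eq_from_nth _ x); first by rewrite size_traject size_map size_iota.
move=> i; rewrite size_traject => lt_i.
by rewrite nth_traject // (nth_map 0%N) ?size_iota // nth_iota // iter_frob.
Qed.

Lemma conjpolyE j x : conjpoly j x = \prod_(y <- [seq x ^+ (e ^ i) | i <- iota 0 j]) ('X - y%:P).
Proof.
rewrite big_map /conjpoly -(big_mkord xpredT (fun i => 'X - (x ^+ (e ^ i))%:P)).
by rewrite /index_iota subn0.
Qed.

Lemma rational_root_conj P x i : rational P -> root P x -> root P (x ^+ (e ^ i)).
Proof.
move=> rP Px; elim: i => [|i IHi]; first by rewrite expn0 expr1.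
by rewrite expnSr exprM /root rational_frob_root // (eqP IHi) expr0n gtn_eqF.
Qed.

Lemma dvdp_conjpoly P x : rational P -> root P x -> conjpoly (conjdeg x) x %| P.
Proof.
move=> rP Px; rewrite conjpolyE; have [->|P_neq0] := eqVneq P 0; first exact: dvdp0.
apply: uniq_roots_dvdp; last by rewrite uniq_rootsE conj_uniq.
by apply/allP => _ /mapP[i _ ->]; apply: rational_root_conj.
Qed.

(* The multiplicity of [x] in a rational [P] counts the powers of the minimal
   polynomial of [x] dividing [P]; these powers are the [conjpoly j x] over the
   [j] with [x ^+ (e ^ j) = x]. *)
Lemma mup_rational P x k : rational P -> P != 0 -> (size P).-1 = k ->
  mup x P = (\sum_(j < k) ((x ^+ (e ^ j.+1) == x) && (conjpoly j.+1 x %| P)%R))%N.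
Proof.
move=> rP P_neq0 szP; set d := conjdeg x; pose pi := conjpoly d x.
have d_gt0 : (0 < d)%N := conjdeg_gt0 x.
have fix_d : x ^+ (e ^ d) = x by apply/eqP; rewrite conjdegP.
have r_pi : rational pi by apply: rational_conjpoly.
have pi_neq0 : pi != 0 by rewrite monic_neq0 ?monic_conjpoly.
have mup_pi : mup x pi = 1%N.
  rewrite /pi conjpolyE mu_prod_XsubC count_uniq_mem ?conj_uniq //.
  have -> // : x \in [seq x ^+ (e ^ i) | i <- iota 0 d].
  by apply/mapP; exists 0%N; rewrite ?mem_iota ?d_gt0 // expn0 expr1.
have dvd_pi v : (pi ^+ v %| P) = (v <= mup x P)%N.
  rewrite mup_geq //; elim: v P rP P_neq0 {szP} => [|v IHv] P rP P_neq0.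
    by rewrite !dvd1p.
  apply/idP/idP => [|dvdP].
    apply: dvdp_trans; apply: dvdp_exp2r; rewrite dvdp_XsubCl; exact: conjpoly_root.
  have /dvdp_conjpoly : root P x.
    by rewrite -dvdp_XsubCl (dvdp_trans _ dvdP) // exprS dvdp_mulIl.
  move=> /(_ rP) /dvdpP[P' DP]; rewrite -/d -/pi mulrC in DP.
  have P'_neq0 : P' != 0 by apply: contraNneq P_neq0 => P'0; rewrite DP P'0 mulr0.
  have rP' : rational P' by apply: (rational_divl pi_neq0 r_pi); rewrite -DP.
  rewrite DP exprS dvdp_mul2l // IHv //.
  by move: dvdP; rewrite -!mup_geq // DP mupM // mup_pi.
have -> : (\sum_(j < k) ((x ^+ (e ^ j.+1) == x) && (conjpoly j.+1 x %| P)%R))%N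
    = count (fun j => (d %| j) && (j %/ d <= mup x P))%N (iota 1 k).
  transitivity (\sum_(j < k) ((d %| j.+1) && (j.+1 %/ d <= mup x P)))%N.
    apply: eq_bigr => j _; rewrite conjdegP -/d; case: (boolP (d %| j.+1)%N) => //= /dvdnP[v ->].
    by rewrite conjpolyM // dvd_pi mulnK.
  elim: {szP} k => [|k IHk]; first by rewrite big_ord0.
  by rewrite big_ord_recr IHk -[k.+1]addn1 iotaD count_cat /= addn0 addn1 add1n.
rewrite -size_filter.
have : perm_eq [seq j <- iota 1 k | (d %| j) && (j %/ d <= mup x P)]%N
               [seq (v * d)%N | v <- iota 1 (mup x P)].
  apply: uniq_perm.
  - by rewrite filter_uniq ?iota_uniq.
  - by rewrite map_inj_uniq ?iota_uniq // => u v /eqP; rewrite eqn_pmul2r // => /eqP.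
  move=> j; rewrite mem_filter mem_iota; apply/andP/mapP.
    case=> /andP[/dvdnP[v ->]]; rewrite mulnK // => le_v /andP[v_gt0 _].
    exists v => //; rewrite mem_iota add1n ltnS le_v andbT.
    by case: v v_gt0 {le_v}.
  case=> v; rewrite mem_iota add1n ltnS => /andP[v_gt0 le_v] ->.
  rewrite dvdn_mull // mulnK // le_v muln_gt0 v_gt0 d_gt0 add1n ltnS -szP; split=> //.
  have := dvd_pi v; rewrite le_v => /(dvdp_leq P_neq0).
  rewrite -conjpolyM // size_conjpoly; by case: (size P).
by move/perm_size ->; rewrite size_map size_iota.
Qed.

End RationalPolynomials.

(** * The Euler product as a recurrence, and vanishing of high coefficients *)

Section EulerProduct.
Variables (K : finFieldType) (e : nat).
Hypothesis e_pchar : [pchar K].-nat e.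
Hypothesis e_gt0 : (0 < e)%N.
Local Notation rational := (rational e).
Local Notation conjpoly := (conjpoly e).

Definition monics k : seq {poly K} :=
  [seq 'X^k + \sum_(i < k) c i *: 'X^i | c : {ffun 'I_k -> K}].

Lemma monic_coefs k (c : {ffun 'I_k -> K}) (i : 'I_k) :
  ('X^k + \sum_(i < k) c i *: 'X^i)`_i = c i.
Proof.
rewrite coefD coefXn ltn_eqF // add0r coef_sum (bigD1 i) //= big1 ?addr0.
  by rewrite coefZ coefXn eqxx mulr1.
move=> j ne_ji; rewrite coefZ coefXn; case: eqP => [/val_inj/esym/eqP|]; last by rewrite mulr0.
by rewrite (negPf ne_ji).
Qed.

Lemma monics_uniq k : uniq (monics k).
Proof.
rewrite map_inj_uniq ?enum_uniq // => c d cd; apply/ffunP => i.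
by rewrite -[c i]monic_coefs cd monic_coefs.
Qed.

Lemma mem_monics k P : (P \in monics k) = (P \is monic) && (size P == k.+1).
Proof.
apply/mapP/andP => [[c _ ->]|[/eqP mP /eqP szP]].
  have szS : (size (\sum_(i < k) c i *: 'X^i : {poly K})%R < size ('X^k : {poly K})%R)%N.
    rewrite size_polyXn ltnS; apply: leq_trans (size_sum _ _ _) _.
    apply/bigmax_leqP => i _; apply: leq_trans (size_scale_leq _ _) _.
    by rewrite size_polyXn.
  by rewrite monicE lead_coefDl // lead_coefXn eqxx size_polyDl // size_polyXn.
exists [ffun i : 'I_k => P`_i]; first by rewrite mem_enum.
apply/polyP => i; have [lt_ik|le_ki] := ltnP i k.
  by rewrite (monic_coefs _ (Ordinal lt_ik)) ffunE.
rewrite coefD coef_sum coefXn big1 ?addr0 => [|j _]; last first.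
  rewrite coefZ coefXn; case: eqP => [E|]; rewrite ?mulr0 //.
  by have := ltn_ord j; rewrite -E ltnNge le_ki.
move: le_ki; rewrite leq_eqVlt => /orP[/eqP<-|lt_ki].
  by rewrite eqxx -mP lead_coefE szP.
by rewrite gtn_eqF // nth_default // szP.
Qed.

Definition ratmonics k := [seq P <- monics k | rational P].

Lemma ratmonics_uniq k : uniq (ratmonics k).
Proof. by rewrite filter_uniq ?monics_uniq. Qed.

Lemma mem_ratmonics k P :
  (P \in ratmonics k) = [&& rational P, P \is monic & size P == k.+1].
Proof. by rewrite mem_filter mem_monics. Qed.

Variable lam : {poly K} -> algC.
Hypothesis lamM : forall P Q, rational P -> rational Q -> lam (P * Q) = lam P * lam Q.
Hypothesis lam1 : lam 1 = 1.

(** The coefficients of L(T), the sum of lam(P) T^(deg P) over monic rational P. Those of T L'(T) /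
    L(T) are the [lpsum j]. *)
Definition lcoef k := \sum_(P <- ratmonics k) lam P.
Definition lpsum j := \sum_(x : K | x ^+ (e ^ j) == x) lam (conjpoly j x).

Lemma lcoef0 : lcoef 0 = 1.
Proof.
rewrite /lcoef (perm_big [:: 1]) ?big_seq1 //; apply: uniq_perm => //.
  exact: ratmonics_uniq.
move=> P; rewrite mem_ratmonics inE; apply/and3P/eqP => [[_ mP /size_poly1P[c _ DP]]|->].
  by move: mP; rewrite DP monicE lead_coefC => /eqP->.
by rewrite rational1 monic1 size_poly1.
Qed.

Lemma lcoef_dvd B j k : rational B -> B \is monic -> size B = j.+1 -> (j <= k)%N ->
  \sum_(P <- ratmonics k | B %| P) lam P = lam B * lcoef (k - j).
Proof.
move=> rB mB szB le_jk; have B_neq0 := monic_neq0 mB.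
rewrite -big_filter (perm_big [seq B * Q | Q <- ratmonics (k - j)]) /=.
  rewrite big_map mulr_sumr; apply: eq_big_seq => Q.
  by rewrite mem_ratmonics => /and3P[rQ _ _]; rewrite lamM.
apply: uniq_perm; first by rewrite filter_uniq ?ratmonics_uniq.
  by rewrite map_inj_uniq ?ratmonics_uniq //; exact: mulfI.
move=> P; rewrite mem_filter; apply/andP/mapP => [[/dvdpP[Q DP]]|[Q]].
  rewrite mulrC in DP; rewrite DP mem_ratmonics => /and3P[rBQ mBQ szBQ]; exists Q => //.
  have mQ : Q \is monic by move: mBQ; rewrite monicMl.
  rewrite mem_ratmonics mQ (rational_divl B_neq0 rB rBQ) /=.
  move: szBQ; rewrite size_Mmonic ?monic_neq0 // szB addSn /= => /eqP E.
  by rewrite -(addKn j (size Q)) E subSn.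
rewrite mem_ratmonics => /and3P[rQ mQ /eqP szQ] ->; rewrite dvdp_mulIl mem_ratmonics.
rewrite rationalM // monicMl // mQ size_Mmonic ?monic_neq0 // szB szQ addnS /=.
by rewrite addSn subnKC.
Qed.

(** A double count replaces the Euler product and its logarithmic derivative: deg P is the sum of
    the multiplicities of its roots, hence the number of pairs (x, j) with [conjpoly j x] dividing
    [P]. Grouping the P by such a pair and dividing out that factor gives the right side. *)
Lemma lcoef_recurrence k :
  {in ratmonics k.+1, forall P, exists rs, P = \prod_(r <- rs) ('X - r%:P)} ->
  k.+1%:R * lcoef k.+1 = \sum_(j < k.+1) lpsum j.+1 * lcoef (k - j).
Proof.
move=> split_rat; rewrite /lcoef mulr_sumr.
have sum_mup P : P \in ratmonics k.+1 -> k.+1 = (\sum_x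
    \sum_(j < k.+1) ((x ^+ (e ^ j.+1) == x) && (conjpoly j.+1 x %| P)%R))%N.
  move=> ratP; have [rs DP] := split_rat P ratP.
  move: ratP; rewrite mem_ratmonics => /and3P[rP mP /eqP szP].
  have sum_mult : (\sum_x mup x P = k.+1)%N.
    have <- : size rs = k.+1 by apply: succn_inj; rewrite -szP DP size_prod_XsubC.
    transitivity (\sum_x \sum_(r <- rs) (r == x : nat))%N.
      apply: eq_bigr => x _; rewrite DP mu_prod_XsubC -sum1_count big_mkcond.
      by apply: eq_bigr => r _; rewrite /=; case: eqP.
    rewrite exchange_big /= -sum1_size; apply: eq_bigr => r _.
    by rewrite (bigD1 r) //= eqxx big1 ?addn0 // => x; rewrite eq_sym => /negPf->.
  rewrite -[LHS]sum_mult.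
  by apply: eq_bigr => x _; rewrite (mup_rational e_pchar e_gt0 x rP (monic_neq0 mP) (k := k.+1)) ?szP.
transitivity (\sum_(P <- ratmonics k.+1) \sum_(j < k.+1)
    \sum_(x : K | x ^+ (e ^ j.+1) == x) (if conjpoly j.+1 x %| P then lam P else 0)).
  apply: eq_big_seq => P ratP.
  have /(congr1 (fun i => i%:R : algC)) -> := sum_mup P ratP.
  rewrite exchange_big /= natr_sum mulr_suml.
  apply: eq_bigr => j _; rewrite natr_sum mulr_suml.
  rewrite [in RHS](big_mkcond (fun x : K => x ^+ (e ^ j.+1) == x)) /=.
  by apply: eq_bigr => x _; case: eqP => _ /=; case: (conjpoly _ x %| P); rewrite ?mul1r ?mul0r.
rewrite exchange_big; apply: eq_bigr => j _ /=; rewrite exchange_big /lpsum mulr_suml.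
apply: eq_bigr => x /eqP xj; rewrite -big_mkcond /=.
rewrite (lcoef_dvd (j := j.+1)) ?subSS ?rational_conjpoly ?monic_conjpoly ?size_conjpoly //.
Qed.

(** From degree D on, replacing the residue of [P] modulo [M] by that of P G permutes the monic
    rational polynomials of degree k. This multiplies each [lam P] by [lam G], so the sum equals
    itself times a factor other than 1. *)
Lemma lcoef_eq0 (M G : {poly K}) D k :
  rational M -> M \is monic -> size M = D.+1 -> (0 < D)%N ->
  (forall P Q, rational P -> rational Q -> M %| P - Q -> lam P = lam Q) ->
  rational G -> coprimep M G -> lam G != 1 -> (D <= k)%N -> lcoef k = 0.
Proof.
move=> rM mM szM D_gt0 lam_mod rG copMG lamG le_Dk; have M_neq0 := monic_neq0 mM.
pose shift P := P + (P * (G - 1)) %% M.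
have rshift P : rational P -> rational (shift P).
  move=> rP; rewrite /shift rationalD // rational_modp // rationalM // rationalB //.
  exact: rational1.
have shift_mod P : M %| shift P - P * G.
  rewrite /shift.
  have -> : P + (P * (G - 1)) %% M - P * G = - (P * (G - 1) - (P * (G - 1)) %% M) by ring.
  by rewrite dvdpNr {1}(divp_eq (P * (G - 1)) M) addrK dvdp_mull.
have shift_inj : {in ratmonics k &, injective shift}.
  move=> P Q _ _ eqPQ; have : M %| (P - Q) * G.
    have -> : (P - Q) * G = (shift Q - Q * G) - (shift P - P * G) by rewrite eqPQ; ring.
    by rewrite dvdp_sub ?shift_mod.
  rewrite Gauss_dvdpl // => dvdPQ; move: eqPQ; rewrite /shift.
  have -> : (P * (G - 1)) %% M = (Q * (G - 1)) %% M.
    apply/eqP; rewrite -subr_eq0 -modpN -modpD -mulrBl.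
    by apply/eqP/modp_eq0P; rewrite dvdp_mulr.
  by move/addIr.
have szshift P : P \in ratmonics k -> (shift P \is monic) && (size (shift P) == k.+1).
  rewrite mem_ratmonics => /and3P[_ mP /eqP szP].
  have lt_sz : (size ((P * (G - 1)) %% M)%R < size P)%N.
    by rewrite szP (leq_trans _ (_ : size M <= _)%N) ?ltn_modp // szM ltnS.
  by rewrite monicE lead_coefDl // -monicE mP size_polyDl // szP eqxx.
have perm_shift : perm_eq [seq shift P | P <- ratmonics k] (ratmonics k).
  have u : uniq [seq shift P | P <- ratmonics k].
    by rewrite map_inj_in_uniq ?ratmonics_uniq.
  have sub : {subset [seq shift P | P <- ratmonics k] <= ratmonics k}.
    move=> _ /mapP[P ratP ->]; have := szshift P ratP; rewrite mem_ratmonics => ->.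
    by move: ratP; rewrite mem_ratmonics => /andP[rP _]; rewrite rshift.
  apply: uniq_perm => //; first exact: ratmonics_uniq.
  by have [|_ ] := uniq_min_size u sub; rewrite ?size_map.
have : lcoef k = lcoef k * lam G.
  rewrite /lcoef -{1}(perm_big _ perm_shift) big_map /= mulr_suml.
  apply: eq_big_seq => P ratP; move: (ratP); rewrite mem_ratmonics => /andP[rP _].
  by rewrite -lamM //; apply: lam_mod; rewrite ?rshift ?rationalM.
move/eqP; rewrite -subr_eq0 -{1}[lcoef k]mulr1 -mulrBr mulf_eq0 subr_eq0.
by rewrite [1 == _]eq_sym (negPf lamG) orbF => /eqP.
Qed.

End EulerProduct.

(** * Finite fields, their Frobenius-fixed subsets and splitting fields *)

Section FiniteFields.
Implicit Type F : finFieldType.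

Lemma exists_prim_root F m : (0 < m)%N -> (m %| #|F|.-1)%N ->
  exists g : F, m.-primitive_root g.
Proof.
move=> m_gt0 dvd_m; have F1_gt0 : (0 < #|F|.-1)%N by rewrite -ltnS prednK ?finNzRing_gt1 // ltnW ?finNzRing_gt1.
pose rs := enum (predC1 (0 : F)).
have card_rs : size rs = #|F|.-1 by rewrite -cardE cardC1.
have : has (#|F|.-1).-primitive_root (rs : seq F).
  apply: has_prim_root => //; last by rewrite card_rs.
    apply/allP => x; rewrite mem_enum => x_neq0; rewrite unity_rootE.
    apply/eqP/(mulfI x_neq0); rewrite mulr1 -exprS prednK ?expf_card //.
    by rewrite ltnW ?finNzRing_gt1.
  exact: enum_uniq.
case/hasP => g _ prim_g; exists (g ^+ (#|F|.-1 %/ m)).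
exact (dvdn_prim_root prim_g dvd_m).
Qed.

Lemma card_frob_fixed_le F Q : (1 < Q)%N -> (#|[set x : F | x ^+ Q == x]| <= Q)%N.
Proof.
move=> Q_gt1; have szX : size ('X^Q - 'X : {poly F}) = Q.+1.
  by rewrite size_polyDl ?size_polyXn // size_polyN size_polyX.
rewrite -ltnS -szX cardE max_poly_roots ?enum_uniq //.
  by rewrite -size_poly_eq0 szX.
by apply/allP => x; rewrite mem_enum inE /root !hornerE subr_eq0.
Qed.

Lemma card_frob_fixed F Q : (1 < Q)%N -> (Q.-1 %| #|F|.-1)%N ->
  #|[set x : F | x ^+ Q == x]| = Q.
Proof.
move=> Q_gt1 dvdQ; have Q1_gt0 : (0 < Q.-1)%N by rewrite -subn1 subn_gt0.
have [g prim_g] := exists_prim_root Q1_gt0 dvdQ.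
apply/eqP; rewrite eqn_leq card_frob_fixed_le //=.
pose s := 0 :: [seq g ^+ i | i <- iota 0 Q.-1].
have s_uniq : uniq s.
  rewrite /= map_inj_in_uniq ?iota_uniq ?andbT => [|i j].
    apply/mapP => -[i _ /esym/eqP]; rewrite expf_eq0 (negPf (prim_root_neq0 prim_g)).
    by rewrite andbF.
  rewrite !mem_iota /= !add0n => lt_i lt_j /eqP; rewrite (eq_prim_root_expr prim_g).
  by rewrite !modn_small // => /eqP.
have szs : size s = Q by rewrite /= size_map size_iota prednK // ltnW.
rewrite -[leqLHS]szs -(card_uniqP s_uniq); apply/subset_leq_card/subsetP => x.
rewrite !inE => /orP[/eqP->|/mapP[i _ ->]].
  by rewrite expr0n (gtn_eqF (ltnW Q_gt1)) eqxx.
by rewrite -exprM mulnC exprM -[in g ^+ Q](prednK (ltnW Q_gt1)) exprS (prim_expr_order prim_g) mulr1.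
Qed.

Lemma splitting_finField F (p : {poly F}) : p != 0 ->
  exists (L : finFieldType) (iota : {rmorphism F -> L}) (rs : seq L),
    map_poly iota p %= \prod_(r <- rs) ('X - r%:P).
Proof.
move=> p_neq0; have [L [rs Dp _]] := FinSplittingFieldFor p_neq0.
by exists (FinFieldExtType L : finFieldType), (in_alg L), rs.
Qed.

Lemma rational_coef (K : finFieldType) e (P : {poly K}) i :
  [pchar K].-nat e -> (0 < e)%N -> rational e P -> P`_i ^+ e = P`_i.
Proof.
move=> e_pchar e_gt0 /eqP rP.
have pcharP : [pchar {poly K}].-nat e by rewrite (eq_pnat _ (pchar_poly K)).
have PE : P ^+ e = \poly_(j < size P) (P`_j ^+ e) \Po 'X^e.
  rewrite -{1}[P]coefK poly_def poly_def rmorph_sum /=.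
  rewrite (big_morph (fun Q => Q ^+ e) (fun x y => exprDn_pchar x y pcharP) (_ : 0 ^+ e = 0)).
    by apply: eq_bigr => j _; rewrite comp_polyZ rmorphXn /= comp_polyX exprZn -!exprM mulnC.
  by rewrite expr0n gtn_eqF.
have := congr1 (fun Q : {poly K} => Q`_(e * i)) rP.
rewrite PE !coef_comp_poly_Xn // dvdn_mulr // mulKn // coef_poly.
by case: ltnP => // le_i _; rewrite nth_default // expr0n gtn_eqF.
Qed.

Lemma rational_of_coefs (K : finFieldType) e (P : {poly K}) :
  [pchar K].-nat e -> (0 < e)%N -> (forall i, P`_i ^+ e = P`_i) -> rational e P.
Proof.
move=> e_pchar e_gt0 Pi; rewrite -[P]coefK poly_def.
apply: (big_ind (rational e)) => [|Q R|i _].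
- by rewrite /rational expr0n gtn_eqF // comp_poly0.
- exact: rationalD.
by rewrite /rational exprZn comp_polyZ Pi rmorphXn /= comp_polyX -!exprM mulnC.
Qed.

End FiniteFields.

(** * Characters attached to places and reciprocity *)

Section PlaceCharacters.
Variables (K : finFieldType) (e k0 n N0 : nat) (z : K) (w : algC).
Variable pl : seq (K * nat).
Hypothesis e_pchar : [pchar K].-nat e.
Hypothesis e_gt1 : (1 < e)%N.
Hypothesis k0_gt0 : (0 < k0)%N.
Hypotheses (prim_z : n.-primitive_root z) (prim_w : n.-primitive_root w).
Hypothesis De : (e ^ k0)%N = (n * N0).+1.
Hypothesis pl_fix : {in pl, forall t, t.1 ^+ (e ^ k0) = t.1}.

Let e_gt0 : (0 < e)%N := ltnW e_gt1.

(* The character of the rational polynomials attached to a list of places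
   [(tau, i)]: the product of the [i]-th powers of the order [n] character
   evaluated at [P(tau)]. *)
Definition placechar (P : {poly K}) : algC :=
  \prod_(t <- pl) rootchar n z w (P.[t.1] ^+ N0) ^+ t.2.

Let N0_gt0 : (0 < N0)%N.
Proof.
rewrite lt0n; apply/eqP => N00; move: De; rewrite N00 muln0 => e1.
have : (1 < e ^ k0)%N by rewrite -(exp1n k0) ltn_exp2r.
by rewrite e1.
Qed.

Lemma rational_frob_rootX (P : {poly K}) x i : rational e P -> P.[x ^+ (e ^ i)] = P.[x] ^+ (e ^ i).
Proof.
move=> rP; elim: i => [|i IHi]; first by rewrite !expn0 !expr1.
by rewrite expnSr !exprM rational_frob_root // IHi.
Qed.

Lemma placeval (y : K) N j : (e ^ j)%N = (n * N).+1 -> (0 < N)%N -> y ^+ (e ^ j) = y ->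
  (y ^+ N) ^+ n = 1 \/ y ^+ N = 0.
Proof.
move=> Dj N_gt0 yj; have [->|y_neq0] := eqVneq y 0; [right|left].
  by rewrite expr0n gtn_eqF.
by apply: (mulfI y_neq0); rewrite mulr1 -exprM mulnC -exprS -Dj.
Qed.

Lemma placechar_val (P : {poly K}) t : rational e P -> t \in pl ->
  (P.[t.1] ^+ N0) ^+ n = 1 \/ P.[t.1] ^+ N0 = 0.
Proof.
move=> rP pl_t; apply: (placeval De) => //.
by rewrite -rational_frob_rootX // pl_fix.
Qed.

Lemma placecharM (P Q : {poly K}) : rational e P -> rational e Q ->
  placechar (P * Q) = placechar P * placechar Q.
Proof.
move=> rP rQ; rewrite /placechar -big_split /=; apply: eq_big_seq => t pl_t.
rewrite hornerM exprMn (rootcharM prim_z prim_w) ?exprMn //; exact: placechar_val.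
Qed.

Lemma placechar1 : placechar 1 = 1.
Proof.
rewrite /placechar big1 // => t _.
by rewrite hornerC expr1n (rootchar1 prim_z prim_w) expr1n.
Qed.

Lemma placechar_mod (M P Q : {poly K}) : {in pl, forall t, root M t.1} ->
  M %| P - Q -> placechar P = placechar Q.
Proof.
move=> M_root /dvdpP[R DR]; apply: eq_big_seq => t pl_t; congr (rootchar _ _ _ (_ ^+ _) ^+ _).
apply/eqP; rewrite -subr_eq0 -hornerN -hornerD DR hornerM.
by rewrite (eqP (M_root t pl_t)) mulr0.
Qed.

(** The k0 first conjugates of each place, with repetition when its degree is smaller than k0, and
    taken as often as the exponent says: the roots of the polynomial whose Kummer sum is given to
    Stepanov's method. *)
Definition place_roots : seq K :=
  flatten [seq flatten (nseq t.2 [seq t.1 ^+ (e ^ i) | i <- iota 0 k0]) | t <- pl].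

Lemma prod_place_roots x : \prod_(y <- place_roots) (x - y) =
  \prod_(t <- pl) (conjpoly e k0 t.1).[x] ^+ t.2.
Proof.
rewrite /place_roots big_flatten big_map; apply: eq_bigr => t _.
rewrite big_flatten /= big_nseq -Monoid.iteropE /= -[RHS]/(_ ^+ _).
congr (_ ^+ _); rewrite conjpolyE horner_prod; apply: eq_bigr => y _.
by rewrite !hornerE.
Qed.

(** Symmetry of the resultant: both sides are products of the differences of x^(e^a) and tau^(e^b)
    over all a < j and b < k0. The sign (-1)^(j k0) disappears as j is even. *)
Lemma conjpoly_swap (x tau : K) j : x ^+ (e ^ j) = x -> tau ^+ (e ^ k0) = tau -> ~~ odd j ->
  (conjpoly e j x).[tau] ^+ (\sum_(b < k0) e ^ b) =
  (conjpoly e k0 tau).[x] ^+ (\sum_(a < j) e ^ a).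
Proof.
move=> xj tauk j_even.
have expE (y : K) i : y ^+ (\sum_(b < i) e ^ b) = \prod_(b < i) y ^+ (e ^ b).
  by rewrite expr_sum.
have hornE (y y' : K) i : (conjpoly e i y).[y'] = \prod_(l < i) (y' - y ^+ (e ^ l)).
  by rewrite horner_prod; apply: eq_bigr => l _; rewrite !hornerE.
rewrite !expE.
under eq_bigr => b _ do rewrite -rational_frob_rootX ?rational_conjpoly // hornE.
under [RHS]eq_bigr => a _ do rewrite -rational_frob_rootX ?rational_conjpoly // hornE.
rewrite exchange_big /=; apply: etrans (_ : \prod_(a < j) ((-1) ^+ k0 *
   \prod_(b < k0) (x ^+ (e ^ a) - tau ^+ (e ^ b))) = _).
  apply: eq_bigr => a _.
  have -> : (-1 : K) ^+ k0 = \prod_(b < k0) (-1) by rewrite prodr_const card_ord.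
  by rewrite -big_split; apply: eq_bigr => b _; rewrite /= mulN1r opprB.
rewrite big_split /= prodr_const card_ord -exprM mulnC exprM.
rewrite -[j](odd_double_half j) (negPf j_even) add0n -muln2 mulnC exprM sqrrN !expr1n.
by rewrite mul1r.
Qed.

(** As n divides e - 1, both [N0] and [N] are (e - 1) / n times a geometric sum, so [conjpoly_swap]
    exchanges x with every place. A sum of these values over x is thus a Kummer sum for one
    polynomial that does not depend on j. *)
Lemma placechar_conjpoly (x : K) j N : (n %| e.-1)%N -> (0 < j)%N -> ~~ odd j ->
  x ^+ (e ^ j) = x -> (e ^ j)%N = (n * N).+1 ->
  placechar (conjpoly e j x) = rootchar n z w ((\prod_(y <- place_roots) (x - y)) ^+ N).
Proof.
move=> dvd_n j_gt0 j_even xj Dj; have n_gt0 := prim_order_gt0 prim_z.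
have [n1 Dn1] := dvdnP dvd_n.
have NE k N' : (e ^ k)%N = (n * N').+1 -> N' = ((\sum_(b < k) e ^ b) * n1)%N.
  move=> Dk; have := predn_exp e k; rewrite Dk /= Dn1 => E.
  by apply/eqP; rewrite -(eqn_pmul2l n_gt0) E; apply/eqP; ring.
have N_gt0 : (0 < N)%N.
  rewrite lt0n; apply/eqP => N00; move: Dj; rewrite N00 muln0 => e1.
  have : (1 < e ^ j)%N by rewrite -(exp1n j) ltn_exp2r.
  by rewrite e1.
have stepT t : t \in pl -> (conjpoly e j x).[t.1] ^+ N0 = (conjpoly e k0 t.1).[x] ^+ N.
  move=> pl_t; rewrite (NE _ _ De) (NE _ _ Dj) !exprM conjpoly_swap //.
  exact: pl_fix.
have valT t : t \in pl -> (((conjpoly e k0 t.1).[x]) ^+ N) ^+ n = 1 \/ ((conjpoly e k0 t.1).[x]) ^+ N = 0.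
  move=> pl_t; apply: (placeval Dj) => //.
  by rewrite -rational_frob_rootX ?xj // rational_conjpoly // pl_fix.
rewrite prod_place_roots /placechar.
rewrite (eq_big_seq (fun t => rootchar n z w ((conjpoly e k0 t.1).[x] ^+ N) ^+ t.2)); last first.
  by move=> t pl_t; rewrite stepT.
have valX (y : K) i : y ^+ n = 1 \/ y = 0 -> (y ^+ i) ^+ n = 1 \/ y ^+ i = 0.
  case=> [yn|->]; first by left; rewrite -exprM mulnC exprM yn expr1n.
  by case: i => [|i]; [left; rewrite expr0 expr1n | right; rewrite expr0n].
have charX (y : K) i : y ^+ n = 1 \/ y = 0 -> rootchar n z w (y ^+ i) = rootchar n z w y ^+ i.
  move=> yP; elim: i => [|i IHi]; first by rewrite !expr0 (rootchar1 prim_z prim_w).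
  by rewrite !exprS (rootcharM prim_z prim_w) ?IHi //; apply: valX.
suff [-> //] : rootchar n z w ((\prod_(t <- pl) (conjpoly e k0 t.1).[x] ^+ t.2) ^+ N) =
    \prod_(t <- pl) rootchar n z w ((conjpoly e k0 t.1).[x] ^+ N) ^+ t.2 /\
   (((\prod_(t <- pl) (conjpoly e k0 t.1).[x] ^+ t.2) ^+ N) ^+ n = 1 \/
    (\prod_(t <- pl) (conjpoly e k0 t.1).[x] ^+ t.2) ^+ N = 0).
elim: (pl) valT => [|t u IHu] valT.
  rewrite !big_nil expr1n (rootchar1 prim_z prim_w); split=> //; left; exact: expr1n.
have [|IH1 IH2] := IHu; first by move=> t' u_t'; apply: valT; rewrite inE u_t' orbT.
have vt := valT t (mem_head _ _).
rewrite !big_cons exprMn -exprM mulnC exprM -IH1 -charX //.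
have vtX := valX _ t.2 vt; rewrite (rootcharM prim_z prim_w) //; split=> //.
by case: vtX => [a1|->]; case: IH2 => [a2|->]; rewrite ?mul0r ?mulr0;
  [left; rewrite exprMn a1 a2 mulr1 | right | right | right].
Qed.

End PlaceCharacters.

(** * Weil's bound *)

Section WeilBound.

Lemma count_dvdn_iota d q : (0 < d)%N -> count (fun l => d %| l)%N (iota 0 (q * d)) = q.
Proof.
move=> d_gt0; rewrite -size_filter.
have : perm_eq [seq l <- iota 0 (q * d) | d %| l]%N [seq (v * d)%N | v <- iota 0 q].
  apply: uniq_perm.
  - by rewrite filter_uniq ?iota_uniq.
  - by rewrite map_inj_uniq ?iota_uniq // => u v /eqP; rewrite eqn_pmul2r // => /eqP.
  move=> l; rewrite mem_filter mem_iota add0n; apply/andP/mapP => /=.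
    by case=> /dvdnP[v ->]; rewrite ltn_pmul2r // => lt_v; exists v; rewrite ?mem_iota.
  by case=> v; rewrite mem_iota /= add0n => lt_v ->; rewrite dvdn_mull // ltn_pmul2r.
by move/perm_size->; rewrite size_map size_iota.
Qed.

Variables (F : finFieldType) (e k0 n N0 : nat) (z : F) (w : algC).
Hypothesis e_pchar : [pchar F].-nat e.
Hypothesis e_gt1 : (1 < e)%N.
Hypothesis k0_gt0 : (0 < k0)%N.
Hypothesis cardF : #|F| = (e ^ k0)%N.
Hypotheses (prim_z : n.-primitive_root z) (prim_w : n.-primitive_root w).
Hypothesis De : (e ^ k0)%N = (n * N0).+1.
Hypothesis dvd_n : (n %| e.-1)%N.

Let e_gt0 : (0 < e)%N := ltnW e_gt1.

Lemma frob_fix (x : F) : x ^+ (e ^ k0) = x.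
Proof. by rewrite -cardF expf_card. Qed.

Lemma conjdeg_dvd (x : F) : (conjdeg e x %| k0)%N.
Proof. by rewrite -(conjdegP e_pchar) frob_fix. Qed.

(** A list of k0 successive conjugates runs through the orbit of [tau] exactly k0 / deg tau
    times. *)
Lemma count_place_roots (tau : F) i (rest : seq (F * nat)) :
  {in rest, forall t l, tau != t.1 ^+ (e ^ l)} ->
  count_mem tau (place_roots e k0 ((tau, i) :: rest)) = (i * (k0 %/ conjdeg e tau))%N.
Proof.
move=> restP; rewrite /place_roots /= count_cat.
have count_rep m (s : seq F) : count_mem tau (flatten (nseq m s)) = (m * count_mem tau s)%N.
  by elim: m => [|m IHm] //=; rewrite count_cat IHm mulSn.
rewrite count_rep [X in (_ + X)%N](_ : _ = 0%N) ?addn0; last first.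
  apply/count_memPn/flattenP => -[s /mapP[t rest_t ->] /flattenP[s']].
  by move/nseqP => [-> _] /mapP[l _ E]; have := restP t rest_t l; rewrite E eqxx.
congr (_ * _)%N; rewrite count_map.
rewrite -[in RHS](count_dvdn_iota (k0 %/ conjdeg e tau) (conjdeg_gt0 e tau)).
rewrite divnK ?conjdeg_dvd //; apply: eq_count => l /=.
by rewrite (conjdegP e_pchar).
Qed.

Lemma card_frob_pow d : (0 < d)%N -> (d %| k0)%N -> #|[set y : F | y ^+ (e ^ d) == y]| = (e ^ d)%N.
Proof.
move=> d_gt0 /dvdnP[q Dq]; apply: card_frob_fixed.
  by rewrite -(exp1n d) ltn_exp2r.
by rewrite cardF Dq mulnC expnM dvdn_pred_predX.
Qed.

(** Evaluation at [tau] is injective on the e^d rational polynomials of degree below d, since a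
    difference vanishing at [tau] is divisible by its minimal polynomial, of degree d. The values
    lie in the field of e^d elements and so fill it. *)
Lemma rational_interpolation (tau y : F) : y ^+ (e ^ conjdeg e tau) = y ->
  exists2 H, rational e H & H.[tau] = y.
Proof.
set d := conjdeg e tau => yd; have d_gt0 : (0 < d)%N := conjdeg_gt0 e tau.
pose E := [set x : F | x ^+ e == x].
pose poly_of (c : {ffun 'I_d -> F}) : {poly F} := \sum_(i < d) c i *: 'X^i.
have coef_of c (i : 'I_d) : (poly_of c)`_i = c i.
  rewrite coef_sum (bigD1 i) //= big1 ?addr0 => [|j ne_ji].
    by rewrite coefZ coefXn eqxx mulr1.
  rewrite coefZ coefXn; case: eqP => [/val_inj/esym/eqP|]; last by rewrite mulr0.
  by rewrite (negPf ne_ji).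
have size_of c : (size (poly_of c) <= d)%N.
  apply: leq_trans (size_sum _ _ _) _; apply/bigmax_leqP => i _.
  by apply: leq_trans (size_scale_leq _ _) _; rewrite size_polyXn.
pose A : {set {ffun 'I_d -> F}} := [set c in ffun_on (mem E)].
have AE c i : c \in A -> c i ^+ e = c i.
  by rewrite inE => /ffun_onP/(_ i); rewrite inE => /eqP.
have rat_of c : c \in A -> rational e (poly_of c).
  move=> Ac; apply: rational_of_coefs => // i.
  have [lt_i|le_i] := ltnP i d; first by rewrite (coef_of c (Ordinal lt_i)) AE.
  by rewrite nth_default ?expr0n ?gtn_eqF // (leq_trans (size_of c)).
have cardA : #|A| = (e ^ d)%N.
  rewrite cardsE card_ffun_on card_ord; congr (_ ^ _)%N.
  transitivity (e ^ 1)%N; last by rewrite expn1.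
  rewrite -(card_frob_pow (d := 1) isT (dvd1n _)).
  by apply: eq_card => x; rewrite !inE expn1.
have ev_inj : {in A &, injective (fun c => (poly_of c).[tau])}.
  move=> c1 c2 Ac1 Ac2 /eqP E12; suff eq_poly : poly_of c1 = poly_of c2.
    by apply/ffunP => i; rewrite -!coef_of eq_poly.
  apply/eqP; rewrite -subr_eq0.
  have r12 : rational e (poly_of c1 - poly_of c2) by rewrite rationalB ?rat_of.
  have root12 : root (poly_of c1 - poly_of c2) tau.
    by rewrite /root hornerD hornerN subr_eq0.
  apply: contraT => neq0; have := dvdp_leq neq0 (dvdp_conjpoly e_gt0 r12 root12).
  rewrite size_conjpoly -/d ltnNge => /negP[].
  by apply: leq_trans (size_polyD _ _) _; rewrite size_polyN geq_max !size_of.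
have : y \in [set (poly_of c).[tau] | c in A].
  suff -> : [set (poly_of c).[tau] | c in A] = [set y : F | y ^+ (e ^ d) == y].
    by rewrite inE yd.
  apply/eqP; rewrite eqEcard card_in_imset // cardA card_frob_pow ?conjdeg_dvd // leqnn andbT.
  apply/subsetP => _ /imsetP[c Ac ->]; rewrite inE -rational_frob_rootX ?rat_of //.
  by rewrite (eqP (_ : tau ^+ (e ^ d) == tau)) // (conjdegP e_pchar).
by case/imsetP => c Ac ->; exists (poly_of c); first exact: rat_of.
Qed.

Variables (tau1 : F) (i1 : nat) (rest : seq (F * nat)) (dg : F -> nat).
Local Notation pl := ((tau1, i1) :: rest).
Hypothesis dgP : {in pl, forall t, (0 < dg t.1)%N /\ t.1 ^+ (e ^ dg t.1) = t.1}.
Hypothesis restP : {in rest, forall t l, tau1 != t.1 ^+ (e ^ l)}.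
Hypothesis tau1_order : ~~ (n %| i1 * (k0 %/ conjdeg e tau1))%N.

Let lamF := placechar n N0 z w pl.
Let D := (\sum_(t <- pl) dg t.1)%N.

Let modulus := \prod_(t <- pl) conjpoly e (dg t.1) t.1.

Let rational_prod (s : seq (F * nat)) : {subset s <= pl} ->
  rational e (\prod_(t <- s) conjpoly e (dg t.1) t.1).
Proof.
move=> s_pl; rewrite big_seq; apply: (big_ind (rational e)); [exact: rational1 | |].
  exact: rationalM.
by move=> t /s_pl/dgP[_ dgt]; apply: rational_conjpoly.
Qed.


(** Interpolation gives a [G] with value 1 at the other places and, at [tau1], a generator [beta] of
    the units of the field generated by [tau1]. Its character is that of [beta] to the power [i1],
    which is nontrivial by [tau1_order]. *)
Let exists_unit : exists G : {poly F},
  [/\ rational e G, coprimep modulus G & lamF G != 1].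
Proof.
set d := conjdeg e tau1.
have d_gt0 : (0 < d)%N := conjdeg_gt0 e tau1.
have d_dvd : (d %| k0)%N := conjdeg_dvd tau1.
have ed_gt1 : (1 < e ^ d)%N by rewrite -(exp1n d) ltn_exp2r.
have ed1_gt0 : (0 < (e ^ d).-1)%N by rewrite -subn1 subn_gt0.
have dvd_ed : ((e ^ d).-1 %| #|F|.-1)%N.
  by rewrite cardF -(divnK d_dvd) mulnC expnM dvdn_pred_predX.
have [beta prim_beta] := exists_prim_root ed1_gt0 dvd_ed.
have beta_neq0 : beta != 0 := prim_root_neq0 prim_beta.
have beta_fix : beta ^+ (e ^ d) = beta.
  by rewrite -(prednK (ltnW ed_gt1)) exprS (prim_expr_order prim_beta) mulr1.
pose M' := \prod_(t <- rest) conjpoly e (dg t.1) t.1.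
have rM' : rational e M' by apply: rational_prod => t; rewrite inE orbC => ->.
have tau_fix : tau1 ^+ (e ^ d) = tau1 by apply/eqP; rewrite (conjdegP e_pchar).
have M'_tau : M'.[tau1] != 0.
  rewrite horner_prod prodf_seq_neq0; apply/allP => t rest_t /=.
  rewrite conjpolyE -[_ == 0]/(root _ _) root_prod_XsubC; apply/mapP => -[l _ E].
  by have := restP rest_t l; rewrite E eqxx.
have [H rH H_tau] : exists2 H, rational e H & H.[tau1] = (beta - 1) / M'.[tau1].
  apply: rational_interpolation.
  have edc : [pchar F].-nat (e ^ d)%N by rewrite pnatX e_pchar.
  by rewrite expr_div_n exprBn_pchar // expr1n beta_fix -rational_frob_rootX // tau_fix.
exists (1 + M' * H).
have G_tau : (1 + M' * H).[tau1] = beta.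
  by rewrite !hornerE H_tau mulrC divfK // addrC subrK.
have G_rest t : t \in rest -> (1 + M' * H).[t.1] = 1.
  move=> rest_t; have /eqP M't : root M' t.1.
    rewrite /root /M' horner_prod prodf_seq_eq0; apply/hasP; exists t => //=.
    have [dg_gt0 _] := dgP (mem_behead (s := pl) rest_t).
    exact: conjpoly_root.
  by rewrite !hornerE M't mul0r addr0.
have rG : rational e (1 + M' * H) by rewrite rationalD ?rational1 ?rationalM.
split=> //.
  rewrite /modulus coprimep_sym; rewrite big_seq.
  apply: (big_ind (fun p => coprimep _ p)) => [|p q cp cq|t pl_t]; first exact: coprimep1.
    by rewrite coprimepMr cp.
  rewrite conjpolyE big_map; apply: (big_ind (fun p => coprimep _ p)) => [|p q cp cq|l _]; first exact: coprimep1.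
    by rewrite coprimepMr cp.
  rewrite coprimep_XsubC /root rational_frob_rootX // expf_neq0 //.
  by move: pl_t; rewrite inE => /orP[/eqP->|/G_rest->]; rewrite ?G_tau ?oner_neq0.
rewrite /lamF /placechar big_cons big1_seq ?mulr1; last first.
  move=> t /andP[_ rest_t]; rewrite G_rest // expr1n (rootchar1 prim_z prim_w) expr1n //.
rewrite G_tau /=; set b := beta ^+ N0; pose q := (k0 %/ d)%N.
have [n1 Dn1] := dvdnP dvd_n; have n_gt0 := prim_order_gt0 prim_z.
pose geo := (\sum_(i < d) e ^ i)%N; pose kappa := (\sum_(i < q) (e ^ d) ^ i)%N.
have Ded : (e ^ d).-1 = (n * (n1 * geo))%N by rewrite predn_exp Dn1 -/geo; ring.
have DN0 : N0 = (n1 * geo * kappa)%N.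
  apply/eqP; rewrite -(eqn_pmul2l n_gt0); apply/eqP.
  have -> : (n * N0 = (e ^ k0).-1)%N by rewrite De.
  by rewrite -(divnK d_dvd) -/q mulnC expnM predn_exp -/kappa Ded; ring.
have c_gt0 : (0 < n1 * geo)%N by move: ed1_gt0; rewrite Ded muln_gt0 => /andP[].
(* [beta ^+ N0] is a primitive n-th root of unity to the power [kappa], and e^d = 1 modulo n reduces
   [kappa] to k0 / d, the number in [tau1_order]. *)
have kappa_mod : (kappa = q %[mod n])%N.
  have ed_mod : (e ^ d = 1 %[mod n])%N.
    by rewrite -(prednK (ltnW ed_gt1)) Ded -addn1 mulnC modnMDl.
  rewrite /kappa; elim: (q) => [|q' IHq]; first by rewrite big_ord0.
  by rewrite big_ord_recr /= -modnDm IHq -modnXm ed_mod modnXm exp1n modnDm addn1.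
have bn : b ^+ n = 1.
  apply/eqP; rewrite -exprM -(prim_order_dvd prim_beta) Ded DN0.
  by apply/dvdnP; exists kappa; ring.
have charX i : rootchar n z w b ^+ i = rootchar n z w (b ^+ i).
  have [l ->] := prim_rootP prim_z bn.
  by rewrite (rootcharX prim_z prim_w) -!exprM (rootcharX prim_z prim_w).
apply: contra tau1_order => /eqP; rewrite charX => /(rootchar_eq1 prim_z prim_w).
rewrite -exprM mulnC exprM bn expr1n => /(_ erefl)/eqP.
rewrite -exprM -(prim_order_dvd prim_beta) Ded DN0 => dvd_c.
have : (n1 * geo * n %| n1 * geo * (kappa * i1))%N by rewrite mulnA mulnC.
rewrite dvdn_pmul2l // => dvd_k; rewrite /dvdn mulnC -modnMml -kappa_mod modnMml.
exact: dvd_k.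
Qed.

Let rational_modulus : rational e modulus.
Proof. exact: rational_prod. Qed.

Let monic_modulus : modulus \is monic.
Proof. by apply: monic_prod => t _; exact: monic_conjpoly. Qed.

Let size_modulus : size modulus = D.+1.
Proof.
rewrite /modulus /D; elim: (pl) => [|t s IHs]; first by rewrite !big_nil size_poly1.
have mp : \prod_(t <- s) conjpoly e (dg t.1) t.1 \is monic.
  by apply: monic_prod => t' _; exact: monic_conjpoly.
rewrite !big_cons size_Mmonic ?monic_neq0 ?monic_conjpoly // IHs size_conjpoly.
by rewrite addnS.
Qed.

Let D_gt0 : (0 < D)%N.
Proof. by rewrite /D big_cons addn_gt0; case: (dgP (mem_head _ _)) => ->. Qed.

Let lcoef_eq0F k : (D <= k)%N -> lcoef e lamF k = 0.
Proof.
move=> le_Dk; have [G [rG copG lamG]] := exists_unit.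
have pl_fix : {in pl, forall t, t.1 ^+ (e ^ k0) = t.1} by move=> t _; exact: frob_fix.
apply: (lcoef_eq0 e_pchar e_gt0 _ rational_modulus monic_modulus size_modulus D_gt0 _ rG copG lamG le_Dk).
  by move=> P Q; apply: (placecharM e_gt1 k0_gt0 prim_z prim_w De pl_fix).
move=> P Q _ _; apply: placechar_mod => t pl_t.
rewrite /root /modulus horner_prod prodf_seq_eq0; apply/hasP; exists t => //=.
have [dg_gt0 _] := dgP pl_t; exact: conjpoly_root.
Qed.

Section Extension.
Variables (k : nat) (L : finFieldType) (iota : {rmorphism F -> L}) (rs : seq L).
Local Notation J := (2 * k0)%N.
Local Notation Q := (e ^ (J * k))%N.
(** Since J is twice [k0], Q = h^2 as in the Stepanov bound, and the degree J k is even as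
    [conjpoly_swap] requires. *)
Let h := (#|F| ^ k)%N.
(** Its splitting field contains the field of Q elements and the roots of all rational monic
    polynomials of degree at most J k, as the recurrence up to index J k demands. *)
Let p := (\prod_(i < (J * k).+1) \prod_(P <- ratmonics F e i) P) * ('X^Q - 'X).
Hypothesis k_gt0 : (0 < k)%N.
Hypothesis Dp : map_poly iota p %= \prod_(r <- rs) ('X - r%:P).

Let plL := [seq (iota t.1, t.2) | t <- pl].
Let lamL := placechar n N0 (iota z) w plL.

Let eL_pchar : [pchar L].-nat e.
Proof. by rewrite (eq_pnat _ (fmorph_pchar iota)). Qed.

Let J_gt0 : (0 < J)%N. Proof. by rewrite muln_gt0. Qed.

Let Q_gt1 : (1 < Q)%N.
Proof. by rewrite -[X in (X < _)%N](exp1n (J * k)) ltn_exp2r // muln_gt0 J_gt0. Qed.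

Let split_dvd (P : {poly L}) : P \is monic -> P %| map_poly iota p ->
  exists rs' : seq L, P = \prod_(r <- rs') ('X - r%:P).
Proof.
move=> mP; rewrite (eqp_dvdr _ Dp) => /dvdp_prod_XsubC[m DP]; exists (mask m rs).
by apply/eqP; rewrite -eqp_monic ?monic_prod_XsubC.
Qed.

Let cardQ : #|[set x : L | x ^+ Q == x]| = Q.
Proof.
have szX (R : nzRingType) : size ('X^Q - 'X : {poly R}) = Q.+1.
  by rewrite size_polyDl ?size_polyXn // size_polyN size_polyX.
have mX : 'X^Q - 'X \is @monic L.
  by rewrite monicE lead_coefDl ?lead_coefXn // size_polyN size_polyX size_polyXn.
have [rs' DX] : exists rs' : seq L, 'X^Q - 'X = \prod_(r <- rs') ('X - r%:P).
  apply: split_dvd => //; rewrite /p rmorphM /= [X in _ * X]rmorphB /= map_polyXn map_polyX.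
  exact: dvdp_mulIr.
have Qc : Q%:R = 0 :> L.
  have pL : pdiv e \in [pchar L] by apply: pnatPpi eL_pchar _; rewrite pi_pdiv.
  apply/eqP; rewrite -(dvdn_pcharf pL) (dvdn_trans (pdiv_dvd e)) // dvdn_exp //.
  by rewrite muln_gt0 J_gt0.
have rs_uniq : uniq rs'.
  rewrite -separable_prod_XsubC -DX unlock derivB derivXn derivX.
  rewrite -scaler_nat Qc scale0r sub0r.
  by rewrite -[X in coprimep _ X]scaleN1r coprimepZr ?oppr_eq0 ?oner_eq0 // coprimep1.
have szrs : size rs' = Q by apply: succn_inj; rewrite -(szX L) DX size_prod_XsubC.
rewrite -[RHS]szrs -(card_uniqP rs_uniq); apply: eq_card => x.
by rewrite inE -root_prod_XsubC -DX /root !hornerE subr_eq0.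
Qed.

Let iota_fix (y : L) : y ^+ e = y -> exists2 x : F, x ^+ e = x & y = iota x.
Proof.
move=> ye; pose E := [set x : F | x ^+ e == x].
have cardE : #|E| = e.
  transitivity (e ^ 1)%N; last by rewrite expn1.
  rewrite -(card_frob_pow (d := 1) isT (dvd1n _)).
  by apply: eq_card => x; rewrite !inE expn1.
have : y \in [set iota x | x in E].
  suff -> : [set iota x | x in E] = [set y : L | y ^+ e == y] by rewrite inE ye.
  apply/eqP; rewrite eqEcard card_imset; last exact: fmorph_inj.
  rewrite cardE card_frob_fixed_le // andbT; apply/subsetP => _ /imsetP[x Ex ->].
  by move: Ex; rewrite !inE => /eqP xe; rewrite -rmorphXn xe.
by case/imsetP => x; rewrite inE => /eqP xe ->; exists x.
Qed.

Let rational_map (P : {poly F}) : rational e (map_poly iota P) = rational e P.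
Proof.
rewrite /rational -rmorphXn -(map_polyXn iota) -map_comp_poly.
by rewrite (inj_eq (map_poly_inj iota)).
Qed.

Let ratmonics_map i :
  perm_eq (ratmonics L e i) [seq map_poly iota P | P <- ratmonics F e i].
Proof.
apply: uniq_perm; first exact: ratmonics_uniq.
  by rewrite map_inj_uniq ?ratmonics_uniq //; exact: map_poly_inj.
move=> P; rewrite mem_ratmonics; apply/idP/mapP => [/and3P[rP mP szP]|[P0]]; last first.
  rewrite mem_ratmonics => /and3P[rP mP szP] ->.
  by rewrite rational_map rP map_monic mP size_map_poly.
have [P0 DP] : exists P0, P = map_poly iota P0.
  have coefP j : exists x, P`_j == iota x.
    have [x _ ->] := iota_fix (rational_coef j eL_pchar e_gt0 rP).
    by exists x.
  exists (\poly_(j < size P) xchoose (coefP j)).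
  apply/polyP => j; rewrite coef_map coef_poly.
  have [_|le_j] := ltnP j (size P); first exact/eqP/(xchooseP (coefP j)).
  by rewrite nth_default // raddf0.
exists P0 => //; rewrite mem_ratmonics.
by move: rP mP szP; rewrite DP rational_map map_monic size_map_poly => -> -> ->.
Qed.

Let lam_map (P : {poly F}) : lamL (map_poly iota P) = lamF P.
Proof.
rewrite /lamL /lamF /placechar big_map; apply: eq_bigr => t _ /=.
by rewrite horner_map -rmorphXn rootchar_map.
Qed.

Let lcoef_map i : lcoef e lamL i = lcoef e lamF i.
Proof.
rewrite /lcoef (perm_big _ (ratmonics_map i)) big_map.
by apply: eq_bigr => P _; exact: lam_map.
Qed.

Let lpsum1 : lpsum e lamL 1 = lpsum e lamF 1.
Proof.
have conj1 (K : finFieldType) (x : K) : conjpoly e 1 x = 'X - x%:P.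
  by rewrite /conjpoly big_ord1 expn0 expr1.
have -> : lpsum e lamL 1 = \sum_(y in [set iota x | x in [set x : F | x ^+ e == x]]) lamL ('X - y%:P).
  apply: eq_big => [y|y _]; last by rewrite conj1.
  rewrite expn1; apply/eqP/imsetP => [/iota_fix[x xe ->]|[x]].
    by exists x; rewrite ?inE ?xe.
  by rewrite inE => /eqP xe ->; rewrite -rmorphXn xe.
rewrite big_imset /=; last by move=> x y _ _; exact: fmorph_inj.
apply: eq_big => [x|x _]; first by rewrite inE expn1.
by rewrite conj1 -lam_map rmorphB /= map_polyX map_polyC.
Qed.

Let plL_fix : {in plL, forall t, t.1 ^+ (e ^ k0) = t.1}.
Proof. by move=> _ /mapP[t _ ->] /=; rewrite -rmorphXn frob_fix. Qed.

Let primL_z : n.-primitive_root (iota z).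
Proof. by rewrite fmorph_primitive_root. Qed.

Let lamLM (P R : {poly L}) : rational e P -> rational e R -> lamL (P * R) = lamL P * lamL R.
Proof. exact: (placecharM e_gt1 k0_gt0 primL_z prim_w De plL_fix). Qed.

Let recurrence i : (i < J * k)%N ->
  i.+1%:R * lcoef e lamF i.+1 = \sum_(j < i.+1) lpsum e lamL j.+1 * lcoef e lamF (i - j).
Proof.
move=> lt_i; rewrite -lcoef_map (lcoef_recurrence eL_pchar e_gt0 lamLM).
  by apply: eq_bigr => j _; rewrite lcoef_map.
move=> P ratP; apply: split_dvd.
  by move: ratP; rewrite mem_ratmonics => /and3P[].
move: ratP; rewrite (perm_mem (ratmonics_map _)) => /mapP[P0 ratP0 ->].
rewrite dvdp_map /p dvdp_mulr // (bigD1 (Ordinal (lt_i : (i.+1 < (J * k).+1)%N))) //=.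
by rewrite dvdp_mulr // (perm_big _ (perm_to_rem ratP0)) big_cons dvdp_mulIl.
Qed.

Let place_roots_map : place_roots e k0 plL = [seq iota y | y <- place_roots e k0 pl].
Proof.
rewrite /place_roots map_flatten -!map_comp; congr flatten; apply: eq_map => t /=.
rewrite map_flatten map_nseq; congr (flatten (nseq _ _)).
by rewrite -map_comp; apply: eq_map => l /=; rewrite rmorphXn.
Qed.

Let S0 := (size (place_roots e k0 pl)).+1.

Let norm_lpsum : (3 * stepanov_const n S0 <= h)%N ->
  `|lpsum e lamL (J * k)| <= (2 * stepanov_const n S0 * (1 + 3 * S0) * h)%:R.
Proof.
move=> le_h; have [N DN] : exists N, Q = (n * N).+1.
  have /dvdnP[N DN] := dvdn_trans dvd_n (dvdn_pred_predX e (J * k)).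
  by exists N; rewrite (mulnC n N) -DN prednK // ltnW.
rewrite /lpsum (eq_bigr (fun x => rootchar n (iota z) w
   ((\prod_(y <- place_roots e k0 plL) (x - y)) ^+ N))) => [|x /eqP xQ]; last first.
  apply: (placechar_conjpoly eL_pchar e_gt1 primL_z prim_w De plL_fix) => //.
    by rewrite muln_gt0 J_gt0.
  by rewrite -mulnA oddM.
apply: (@stepanov_sum L Q h _ _ cardQ _ n (iota z) w N S0 _ (iota tau1)) => //.
- by rewrite pnatX eL_pchar.
- by rewrite -{1}cardQ max_card.
- by rewrite /h cardF -!expnM; congr (_ ^ _)%N; ring.
- rewrite place_roots_map => _ /mapP[y _ ->].
  rewrite -rmorphXn; congr (iota _); apply/eqP; rewrite (conjdegP e_pchar).
  by rewrite -mulnA mulnCA dvdn_mulr // conjdeg_dvd.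
- rewrite place_roots_map map_f // -has_pred1 has_count count_place_roots //.
  by move: tau1_order; case: (_ * _)%N => //; rewrite dvdn0.
- rewrite place_roots_map count_map.
  rewrite (eq_count (a2 := pred1 tau1)) ?count_place_roots // => y /=.
  by rewrite (inj_eq (fmorph_inj iota)).
by rewrite place_roots_map size_map.
Qed.

Lemma lpsum_extension : (3 * stepanov_const n S0 <= h)%N ->
  exists S : nat -> algC,
     [/\ forall i, (i < J * k)%N ->
          i.+1%:R * lcoef e lamF i.+1 = \sum_(j < i.+1) S j.+1 * lcoef e lamF (i - j),
         S 1%N = lpsum e lamF 1 &
         `|S (J * k)%N| <= (2 * stepanov_const n S0 * (1 + 3 * S0))%:R * h%:R].
Proof.
move=> le_h; exists (lpsum e lamL); split; [exact: recurrence | exact: lpsum1 |].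
by rewrite -natrM; exact: norm_lpsum.
Qed.

End Extension.

(* Katz's form of Weil's bound: the sum runs over the subfield [x ^+ e = x] only,
   while the places [t.1] lie in extensions of it of degree dividing [dg t.1]. *)
Theorem weil_bound :
  `|\sum_(x : F | x ^+ e == x) \prod_(t <- pl) rootchar n z w ((t.1 - x) ^+ N0) ^+ t.2|
    <= (\sum_(t <- pl) dg t.1)%N.-1%:R * sqrtC e%:R.
Proof.
have -> : \sum_(x : F | x ^+ e == x) \prod_(t <- pl) rootchar n z w ((t.1 - x) ^+ N0) ^+ t.2
    = lpsum e lamF 1.
  apply: eq_big => [x|x _]; first by rewrite expn1.
  apply: eq_bigr => t _; congr (rootchar _ _ _ (_ ^+ _) ^+ _).
  by rewrite /conjpoly big_ord1 !hornerE expn0 expr1.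
set S0 := (size (place_roots e k0 pl)).+1; set c := stepanov_const n S0.
have sqrt_gt0 : 0 < sqrtC e%:R :> algC by rewrite sqrtC_gt0 ltr0n.
have sqrt_J : (sqrtC e%:R : algC) ^+ (2 * k0) = #|F|%:R.
  by rewrite exprM sqrtCK -natrX cardF.
apply: (@rh_of_power_sums (lcoef e lamF) D (2 * k0) (3 * c).+1 (2 * c * (1 + 3 * S0))%:R).
- by apply: lcoef0; apply: placechar1 prim_z prim_w.
- exact: lcoef_eq0F.
- exact: sqrt_gt0.
- by rewrite muln_gt0.
move=> k lt_k; have k_gt0 : (0 < k)%N := leq_ltn_trans (leq0n _) lt_k.
have p_neq0 : (\prod_(i < (2 * k0 * k).+1) \prod_(P <- ratmonics F e i) P) *
    ('X^(e ^ (2 * k0 * k)) - 'X) != 0.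
  apply: mulf_neq0.
    apply/prodf_neq0 => i _; rewrite prodf_seq_neq0; apply/allP => P /=.
    by rewrite mem_ratmonics => /and3P[_ /monic_neq0].
  have Q_gt1 : (1 < e ^ (2 * k0 * k))%N.
    by rewrite -[X in (X < _)%N](exp1n (2 * k0 * k)) ltn_exp2r // !muln_gt0 k0_gt0.
  by rewrite -size_poly_eq0 size_polyDl ?size_polyXn // size_polyN size_polyX.
have [L [iota [rs Dp]]] := splitting_finField p_neq0.
(* Stepanov's bound needs a large field; k < |F|^k provides it for all k beyond 3 c, and only large
   k matter. *)
have le_h : (3 * c <= #|F| ^ k)%N.
  apply: leq_trans (ltnW lt_k) (ltnW (ltn_expl _ _)).
  by rewrite cardF -[X in (X < _)%N](exp1n k0) ltn_exp2r.
have [S [recS S1 normS]] := lpsum_extension k_gt0 Dp le_h.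
exists S; split=> //; by rewrite sqrt_J -natrX.
Qed.

End WeilBound.

(** * Numerical estimates *)

Section Numerics.
Variable R : realFieldType.
Implicit Types a b c p u v x M : R.

(** In use, [a] and [b] count the common neighbours before and after the step for the prime [p], and
    x = sqrt q. The first inequality comes from the second moment, the second is numerical. *)
Lemma deviation_transfer p a b u v c x : 0 < u -> 1 <= p -> 0 <= c -> 0 <= x ->
  (p * b - a) ^+ 2 * u <= (p - 1) ^+ 2 * (a * u + a ^+ 2 * v) ->
  (p - 1) ^+ 2 * (a * u + a ^+ 2 * v) <= (p * (c * x)) ^+ 2 * u ->
  `|b - a / p| <= c * x.
Proof.
move=> u_gt0 p_ge1 c_ge0 x_ge0 le1 le2.
have p_gt0 : 0 < p by lra.
have := le_trans le1 le2; rewrite ler_pM2r // => le_sq.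
have le_norm : `|p * b - a| <= p * (c * x).
  have ge0 : 0 <= p * (c * x) by rewrite !mulr_ge0 // ltW.
  by rewrite -(@ler_pXn2r _ 2) ?nnegrE ?normr_ge0 // real_normK ?num_real.
rewrite -(ler_pM2l p_gt0) -{1}(gtr0_norm p_gt0) -normrM.
by have -> : p * (b - a / p) = p * b - a by field; rewrite gt_eqF.
Qed.

(** The tight case p = 2, with [M] the product of the earlier primes. Of the available 25/4 x^2 u,
    the term a u takes less than 3/5 x^2 u and a^2 v less than 27/5 x^2 u. *)
Lemma moment_bound2 x M a u v : 2 <= M -> 320 * M ^+ 2 <= x ^+ 2 -> 0 < x -> 0 <= a ->
  a * M <= x ^+ 2 + 5 / 2 * x * M -> 0 <= v -> v <= 4 * M ^+ 2 -> x ^+ 2 - 4 * M ^+ 2 <= u ->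
  a * u + a ^+ 2 * v <= (2 * (5 / 4 * x)) ^+ 2 * u.
Proof.
move=> M_ge2 le_Mx x_gt0 a_ge0 le_a v_ge0 le_v le_u.
have le_x : 17 * M <= x.
  have ge0 : 0 <= 17 * M by lra.
  by rewrite -(@ler_pXn2r _ 2) ?nnegrE ?(ltW x_gt0) //; nra.
have aM : a * M <= 23 / 20 * x ^+ 2 by nra.
have a_le : a <= 23 / 40 * x ^+ 2 by nra.
have aM2 : (a * M) ^+ 2 <= (23 / 20 * x ^+ 2) ^+ 2.
  have aM0 : 0 <= a * M by nra.
  have xx0 : 0 <= 23 / 20 * x ^+ 2 by nra.
  by rewrite ler_pXn2r ?nnegrE.
have av : a ^+ 2 * v <= 4 * (23 / 20 * x ^+ 2) ^+ 2.
  apply: le_trans (_ : _ <= 4 * (a * M) ^+ 2) _; last by lra.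
  have -> : 4 * (a * M) ^+ 2 = a ^+ 2 * (4 * M ^+ 2) by ring.
  by rewrite ler_wpM2l // sqr_ge0.
have u_ge : 79 / 80 * x ^+ 2 <= u by lra.
have x2_gt0 : 0 < x ^+ 2 by rewrite exprn_gt0.
set y := x ^+ 2 in le_Mx le_a le_u aM a_le aM2 av u_ge x2_gt0 *.
have -> : (2 * (5 / 4 * x)) ^+ 2 * u = 25 / 4 * y * u by rewrite /y; field.
nra.
Qed.

(** For p >= 3, with w = d m: theta runs over at least q^3 elements, so [u] gains the factor [w] and
    outweighs the cubic bound on [v]. The factors (p - 1)^2 and p^2 are compared separately. *)
Lemma moment_bound3 x M w a u v : 3 <= M -> 9 * M <= w -> 40 * M <= x -> 0 <= a ->
  a * M <= x ^+ 2 + 5 / 2 * x * M -> 0 <= v -> v <= 2 * M ^+ 3 ->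
  3 * x ^+ 2 * w - 2 * M ^+ 3 <= u ->
  a * u + a ^+ 2 * v <= (5 / 4 * x) ^+ 2 * u.
Proof.
move=> M_ge3 le_w le_x a_ge0 le_a v_ge0 le_v le_u.
have aM : a * M <= 11 / 10 * x ^+ 2 by nra.
have a_le : a <= 11 / 30 * x ^+ 2 by nra.
have x2 : 1600 * M ^+ 2 <= x ^+ 2 by nra.
have aM2 : (a * M) ^+ 2 <= (11 / 10 * x ^+ 2) ^+ 2.
  have aM0 : 0 <= a * M by nra.
  have xx0 : 0 <= 11 / 10 * x ^+ 2 by nra.
  by rewrite ler_pXn2r ?nnegrE.
have u_ge : 26 * x ^+ 2 * M <= u.
  apply: le_trans le_u; set y := x ^+ 2 in x2 *.
  have : y * (9 * M) <= y * w by rewrite ler_wpM2l //; nra.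
  have : 0 <= M ^+ 3 by rewrite exprn_ge0 //; lra.
  have : 1600 * M ^+ 3 <= y * M by rewrite exprSr mulrA ler_wpM2r //; lra.
  by lra.
have av : a ^+ 2 * v <= 2 * (11 / 10 * x ^+ 2) ^+ 2 * M.
  apply: le_trans (_ : _ <= 2 * (a * M) ^+ 2 * M) _; last by rewrite ler_wpM2r //; lra.
  have -> : 2 * (a * M) ^+ 2 * M = a ^+ 2 * (2 * M ^+ 3) by ring.
  by rewrite ler_wpM2l // sqr_ge0.
set y := x ^+ 2 in x2 aM le_a a_le aM2 av u_ge le_u *.
have y_gt0 : 0 < y by nra.
have -> : (5 / 4 * x) ^+ 2 * u = 25 / 16 * y * u by rewrite /y; field.
have au : a * u <= 11 / 30 * y * u by rewrite ler_wpM2r //; nra.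
have yu : y * (26 * y * M) <= y * u by rewrite ler_wpM2l // ltW.
nra.
Qed.

End Numerics.

Lemma ler_nat_of_int (R : numDomainType) (p b a u v : nat) : (0 < p)%N ->
  ((p * b)%N%:Z - a%:Z) ^+ 2 * u%:Z <= (p.-1 ^ 2 * (a * u + a ^ 2 * v))%N%:Z ->
  (p%:R * b%:R - a%:R) ^+ 2 * u%:R
    <= (p%:R - 1) ^+ 2 * (a%:R * u%:R + a%:R ^+ 2 * v%:R) :> R.
Proof.
move=> p_gt0; rewrite -(ler_int R).
have -> : (((p * b)%N%:Z - a%:Z) ^+ 2 * u%:Z)%:~R = (p%:R * b%:R - a%:R) ^+ 2 * u%:R :> R.
  by rewrite intrM rmorphXn rmorphB /= -!pmulrn natrM.
have -> // : (p.-1 ^ 2 * (a * u + a ^ 2 * v))%N%:Z%:~R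
   = (p%:R - 1) ^+ 2 * (a%:R * u%:R + a%:R ^+ 2 * v%:R) :> R.
by rewrite -pmulrn natrM natrX natrD natrM [(a ^ 2 * v)%:R]natrM [(a ^ 2)%:R]natrX -subn1 natrB.
Qed.

Lemma moment_bound2_initial (R : realFieldType) (q u v : R) : 48 <= q -> v <= 1 -> q <= u + 1 -> 
  q * u + q ^+ 2 * v <= (2 * (51 / 50)) ^+ 2 * q * u.
Proof. move=> h1 h2 h3. nra. Qed.

(** At the first step a = q and, for odd p, u >= 26 q. The constant 51/50 comes from 1 + 1/26 <
    (51/50)^2. *)
Lemma moment_bound3_initial (R : realFieldType) (q w u v : R) : 48 <= q -> 9 <= w -> v <= 1 ->
  3 * q * w <= u + 1 -> q * u + q ^+ 2 * v <= (51 / 50) ^+ 2 * q * u.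
Proof.
move=> h1 h2 h3 h4.
have : 26 * q <= u by nra.
nra. Qed.

(** * Degree bounds along the list of primes *)

Section ListBounds.
Local Open Scope nat_scope.

(* Bounds the degree over [x ^+ (q ^ p) = x] of a point of prime degree [i] over
   [x ^+ q = x]. *)
Definition place_degree p i := if i == p then 1 else i.

(** For p = 2 the square root of q^p is only q, of which a lower bound of order M^2 is known, so the
    bound has to be quadratic in the product M of the primes. For p >= 3 a cubic one is enough. *)
Lemma place_cut_bound2 ps : ps != [::] -> all (leq 2) ps ->
  (\sum_(i <- ps) place_degree 2 i).+1 * \prod_(i <- ps) (2 * place_degree 2 i)
    <= 4 * (\prod_(i <- ps) i) ^ 2.
Proof.
move=> ps_neq0 ps_ge2.
(* The second inequality strengthens the induction: it pays for the growth of the sum of degrees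
   when a prime i >= 3 is added. It is an equality for the list [[:: 3]]. *)
suff /andP[] : ((\sum_(i <- ps) place_degree 2 i).+1 * \prod_(i <- ps) (2 * place_degree 2 i)
    <= 4 * (\prod_(i <- ps) i) ^ 2) &&
   (3 * \prod_(i <- ps) (2 * place_degree 2 i) <= 2 * (\prod_(i <- ps) i) ^ 2) by [].
elim: ps ps_neq0 ps_ge2 => // i ps IHps _ /= /andP[i_ge2 ps_ge2].
rewrite !big_cons /place_degree -/(place_degree 2 i).
have [->|ps_neq0] := eqVneq ps [::].
  rewrite !big_nil /place_degree; case: eqP => [->|/eqP i_neq2] //.
  have i_ge3 : 2 < i by rewrite ltn_neqAle eq_sym i_neq2.
  by apply/andP; split; nia.
have /andP[] := IHps ps_neq0 ps_ge2.
set D := \sum_(_ <- _) _; set cut := \prod_(_ <- _) (2 * _); set M := \prod_(_ <- _) _.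
rewrite ?expnMn => le1 le2; rewrite /place_degree; case: eqP => [->|/eqP i_neq2].
  by apply/andP; split; nia.
have i_ge3 : 2 < i by rewrite ltn_neqAle eq_sym i_neq2.
apply/andP; split.
  have -> : (i + D).+1 * (2 * i * cut) = 2 * i * (D.+1 * cut) + 2 * i * i * cut by ring.
  have h1 : 2 * i * (D.+1 * cut) <= 2 * i * (4 * M ^ 2) by rewrite leq_mul2l le1 orbT.
  have h2 : 3 * (2 * i * i * cut) <= 2 * i * i * (2 * M ^ 2).
    by rewrite mulnCA leq_mul2l le2 orbT.
  have h3 : 3 * i * M ^ 2 <= i * i * M ^ 2 by rewrite leq_mul2r leq_mul2r i_ge3 !orbT.
  nia.
have h1 : 2 * i * (3 * cut) <= 2 * i * (2 * M ^ 2) by rewrite leq_mul2l le2 orbT.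
have h3 : 2 * i * M ^ 2 <= i * i * M ^ 2 by rewrite leq_mul2r leq_mul2r ltnW ?orbT.
nia.
Qed.

(** The decreasing order of the primes enters here: p <= i gives p i <= i^2. *)
Lemma place_cut_bound p ps : 1 < p -> all (leq p) ps ->
  \prod_(i <- ps) (p * place_degree p i) <= (\prod_(i <- ps) i) ^ 2.
Proof.
move=> p_gt1; elim: ps => [|i ps IHps] /=; first by rewrite !big_nil.
case/andP=> le_pi /IHps{}IHps; rewrite !big_cons expnMn leq_mul //.
by rewrite /place_degree; case: eqP => [->|_]; rewrite -mulnn leq_mul // ltnW.
Qed.

Lemma place_degree_bound p ps : 1 < p -> all (leq p) ps -> ps != [::] ->
  \sum_(i <- ps) place_degree p i <= \prod_(i <- ps) i.
Proof.
move=> p_gt1; elim: ps => [//|i ps IHps] /= /andP[le_pi ps_ge _]; rewrite !big_cons.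
have i_gt1 : 1 < i by apply: leq_trans le_pi.
have le_i : place_degree p i <= i by rewrite /place_degree; case: ifP => _ //; apply: ltnW.
have [->|ps_neq0] := eqVneq ps [::]; first by rewrite !big_nil addn0 muln1.
have := IHps ps_ge ps_neq0; set D := \sum_(_ <- _) _; set M := \prod_(_ <- _) _ => le_D.
have M_gt1 : 1 < M.
  move: ps_ge ps_neq0; rewrite /M; case: (ps) => //= j ps' /andP[le_pj ps'_ge] _.
  rewrite big_cons; apply: leq_trans (leq_trans p_gt1 le_pj) _; rewrite leq_pmulr //.
  elim: ps' ps'_ge => [|h ps' IH] /=; first by rewrite big_nil.
  by case/andP=> le_ph /IH; rewrite big_cons muln_gt0 (leq_trans (ltnW p_gt1) le_ph).
have : i + M <= i * M by nia.
by apply: leq_trans; apply: leq_add.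
Qed.

Lemma sqr_scale_bound q w : 9 * w ^ 2 <= q -> (3 * q * w) ^ 2 <= q ^ 3.
Proof.
move=> le_q; have -> : (3 * q * w) ^ 2 = q ^ 2 * (9 * w ^ 2) by rewrite !expnMn; lia.
by rewrite [q ^ 3]expnSr leq_mul2l le_q orbT.
Qed.

Lemma scale_bound2 q M V : V <= 4 * M ^ 2 -> 20 * (2 ^ 2 * M) ^ 2 < q -> 5 * V <= q.
Proof. by rewrite expnMn; lia. Qed.

Lemma scale_bound3 q M w V : V <= 2 * M ^ 3 -> M <= w -> 20 * w ^ 2 < q -> 5 * V <= 3 * q * w.
Proof.
move=> le_V le_M lt_q; have le_M2 : M ^ 2 <= w ^ 2 by rewrite leq_exp2r.
apply: (@leq_trans (5 * (2 * M ^ 2) * M)); last by apply: leq_mul => //; lia.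
by rewrite -mulnA leq_mul2l /= -mulnA (leq_trans le_V) // leq_mul2l -(expnSr M 2) leqnn.
Qed.

Lemma sqr_bound2 q M : 20 * (2 ^ 2 * M) ^ 2 < q -> 320 * M ^ 2 <= q.
Proof. by rewrite expnMn; lia. Qed.

Lemma cube_bound M : 0 < M -> M.+1 * M ^ 2 <= 2 * M ^ 3.
Proof. by move=> M_gt0; rewrite (expnS M 2) mulnA leq_mul2r; apply/orP; right; lia. Qed.

End ListBounds.

(** * Cliques in Paley graphs *)

Section PaleyCharacter.
Variables (F : finFieldType) (d q : nat) (z : F) (w : algC).
Hypothesis q_pchar : [pchar F].-nat q.
Hypothesis q_gt1 : (1 < q)%N.
Hypothesis q_odd : odd q.
Hypothesis d_gt0 : (0 < d)%N.
Hypothesis cardF : #|F| = (q ^ d)%N.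
Hypothesis dvd_dq : (d %| q.-1)%N.
Hypotheses (prim_z : d.-primitive_root z) (prim_w : d.-primitive_root w).

Definition chi_exp := ((q ^ d).-1 %/ d)%N.
Definition chi (y : F) : algC := rootchar d z w (y ^+ chi_exp).
Local Notation N0 := chi_exp.

Let q_gt0 : (0 < q)%N := ltnW q_gt1.

Let dvd_pred c : (d %| (q ^ c).-1)%N.
Proof. exact: dvdn_trans dvd_dq (dvdn_pred_predX _ _). Qed.

Let pow_gt1 c : (0 < c)%N -> (1 < q ^ c)%N.
Proof. by move=> c_gt0; rewrite -[X in (X < _)%N](exp1n c) ltn_exp2r. Qed.

Lemma chi_expE : (q ^ d)%N = (d * N0).+1.
Proof. by rewrite mulnC divnK ?dvd_pred // prednK // expn_gt0 q_gt0. Qed.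

Let N0_gt0 : (0 < N0)%N.
Proof.
by rewrite divn_gt0 // dvdn_leq ?dvd_pred // -subn1 subn_gt0 pow_gt1.
Qed.

Let geoE c : ((q ^ c).-1 = q.-1 * \sum_(i < c) q ^ i)%N. Proof. exact: predn_exp. Qed.

(** The exponent is (q - 1) / d times a sum of d odd terms: the sum is even if d is, and otherwise
    (q - 1) / d is even. Hence -1 is a d-th power. *)
Lemma chi_exp_even : ~~ odd N0.
Proof.
have DN : (N0 = q.-1 %/ d * \sum_(i < d) q ^ i)%N.
  by rewrite /chi_exp geoE -{1}(divnK dvd_dq) mulnAC mulnK.
have odd_geo c : odd (\sum_(i < c) q ^ i)%N = odd c.
  elim: c => [|c IHc]; first by rewrite big_ord0.
  by rewrite big_ord_recr oddD IHc oddX q_odd orbT addbT.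
rewrite DN oddM odd_geo; case: (boolP (odd d)) => d_odd; last by rewrite andbF.
have := congr1 odd (divnK dvd_dq); rewrite oddM d_odd andbT => ->.
by rewrite -subn1 oddB // q_odd.
Qed.

Lemma chi_val (y : F) : (y ^+ N0) ^+ d = 1 \/ y ^+ N0 = 0.
Proof.
apply: (placeval chi_expE N0_gt0); by rewrite -cardF expf_card.
Qed.

Lemma chiM x y : chi (x * y) = chi x * chi y.
Proof. by rewrite /chi exprMn (rootcharM prim_z prim_w) //; apply: chi_val. Qed.

Lemma chiN y : chi (- y) = chi y.
Proof. by rewrite /chi exprNn -signr_odd (negPf chi_exp_even) mul1r. Qed.

Lemma chi0 : chi 0 = 0.
Proof. by rewrite /chi expr0n gtn_eqF // (rootchar0 w prim_z). Qed.

Lemma chi1 : chi 1 = 1.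
Proof. by rewrite /chi expr1n (rootchar1 prim_z prim_w). Qed.

Lemma chiX y i : chi (y ^+ i) = chi y ^+ i.
Proof. by elim: i => [|i IHi]; rewrite ?expr0 ?chi1 // !exprS chiM IHi. Qed.

Lemma chi_neq0 y : y != 0 -> chi y ^+ d = 1.
Proof.
move=> y_neq0; have [yd|y0] := chi_val y; last first.
  by move/eqP: y0; rewrite expf_eq0 (negPf y_neq0) andbF.
have [i Di] := prim_rootP prim_z yd.
by rewrite /chi Di (rootcharX prim_z prim_w) exprAC (prim_expr_order prim_w) expr1n.
Qed.

Lemma chi_frob y l : chi (y ^+ (q ^ l)) = chi y.
Proof.
have [->|y_neq0] := eqVneq y 0; first by rewrite expr0n gtn_eqF // expn_gt0 q_gt0.
rewrite chiX; have [t Dt] := dvdnP (dvd_pred l).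
rewrite -[(q ^ l)%N]prednK ?expn_gt0 ?q_gt0 // Dt exprS mulnC exprM chi_neq0 //.
by rewrite expr1n mulr1.
Qed.

Lemma paleyE x y : paley F d x y = (chi (x - y) == 1).
Proof.
apply/existsP/eqP => [[t /andP[t_neq0 /eqP->]]|chi_xy].
  by rewrite chiX chi_neq0.
have xy_neq0 : x - y != 0.
  by apply/eqP => E; move: chi_xy; rewrite E chi0 => /esym/eqP; rewrite oner_eq0.
have F1_gt0 : (0 < #|F|.-1)%N by rewrite cardF -subn1 subn_gt0 pow_gt1.
have [g prim_g] := exists_prim_root F1_gt0 (dvdnn _).
have [i Di] : exists i, x - y = g ^+ i.
  have xyF : (x - y) ^+ #|F|.-1 = 1.
    apply: (mulfI xy_neq0); rewrite mulr1 -exprS prednK ?expf_card //.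
    by rewrite cardF expn_gt0 q_gt0.
  by have [i ->] := prim_rootP prim_g xyF; exists i.
have xyN : (x - y) ^+ N0 = 1.
  have [xyd|xy0] := chi_val (x - y); first exact: (rootchar_eq1 prim_z prim_w xyd).
  by move/eqP: xy0; rewrite expf_eq0 (negPf xy_neq0) andbF.
have : (d %| i)%N.
  move/eqP: xyN; rewrite Di -exprM -(prim_order_dvd prim_g) cardF chi_expE /=.
  by rewrite dvdn_pmul2r.
case/dvdnP => t Dt; exists (g ^+ t).
by rewrite expf_neq0 ?(prim_root_neq0 prim_g) //= Di Dt exprM.
Qed.

(** With r = d / c, write q^d - 1 = (q^c - 1) kappa. As q^c = 1 modulo r, r divides [kappa], a sum
    of r powers of q^c; hence q^c - 1 divides N0 c. The case c = 1 makes the subfield of q elements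
    a clique. *)
Lemma chi_subfield c y : (0 < c)%N -> (c %| d)%N -> y ^+ (q ^ c) = y -> y != 0 ->
  chi y ^+ c = 1.
Proof.
move=> c_gt0 dvd_cd yc y_neq0.
have yc1 : y ^+ (q ^ c).-1 = 1.
  by apply: (mulfI y_neq0); rewrite mulr1 -exprS prednK // expn_gt0 q_gt0.
suff /dvdnP[t Dt] : ((q ^ c).-1 %| N0 * c)%N.
  by rewrite -chiX /chi -exprM mulnC Dt mulnC exprM yc1 expr1n (rootchar1 prim_z prim_w).
pose r := (d %/ c)%N; have Dd : (r * c = d)%N by rewrite divnK.
have r_gt0 : (0 < r)%N by rewrite divn_gt0 // dvdn_leq.
pose kappa := (\sum_(i < r) (q ^ c) ^ i)%N.
have dvd_r : (r %| kappa)%N.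
  have kappa_mod r' : (\sum_(i < r') (q ^ c) ^ i = r' %[mod r])%N.
    have ec_mod : (q ^ c = 1 %[mod r])%N.
      have /dvdnP[t Dt] : (r %| (q ^ c).-1)%N.
        by apply: dvdn_trans (dvd_pred c); rewrite -Dd dvdn_mulr.
      by rewrite -(prednK (ltnW (pow_gt1 c_gt0))) Dt -addn1 modnMDl.
    elim: r' => [|r' IHr]; first by rewrite big_ord0.
    by rewrite big_ord_recr /= -modnDm IHr -modnXm ec_mod modnXm exp1n modnDm addn1.
  by rewrite /dvdn /kappa kappa_mod modnn.
have Dk : ((q ^ d).-1 = (q ^ c).-1 * kappa)%N by rewrite -Dd mulnC expnM predn_exp.
apply/dvdnP; exists (kappa %/ r)%N; apply/eqP; rewrite -(eqn_pmul2l r_gt0); apply/eqP.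
have -> : (r * (N0 * c) = (q ^ d).-1)%N by rewrite chi_expE /= -Dd; ring.
by rewrite Dk mulnA [(r * _)%N]mulnC divnK // mulnC.
Qed.

Definition qconj (a b : F) := [exists l : 'I_d, a == b ^+ (q ^ l)].

Lemma frob_fixF (x : F) : x ^+ (q ^ d) = x.
Proof. by rewrite -cardF expf_card. Qed.

Lemma qconjP a b : reflect (exists l, a = b ^+ (q ^ l)) (qconj a b).
Proof.
apply: (iffP existsP) => [[l /eqP->]|[l ->]]; first by exists l.
have lt_l : (l %% d < d)%N by rewrite ltn_mod.
exists (Ordinal lt_l); rewrite /= {1}(divn_eq l d) expnD exprM.
have -> // : b ^+ (q ^ (l %/ d * d)) = b.
by elim: (l %/ d)%N => [|i IHi]; rewrite ?mul0n ?expn0 ?expr1 // mulSn expnD exprM frob_fixF.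
Qed.

Lemma qconj_refl a : qconj a a.
Proof. by apply/qconjP; exists 0%N; rewrite expn0 expr1. Qed.

Lemma qconj_sym a b : qconj a b -> qconj b a.
Proof.
case/existsP => l /eqP->; apply/qconjP; exists (d - l)%N.
by rewrite -exprM -expnD subnKC ?frob_fixF // ltnW.
Qed.

Lemma qconj_trans a b c : qconj a b -> qconj b c -> qconj a c.
Proof.
move=> /qconjP[l ->] /qconjP[l' ->]; apply/qconjP; exists (l' + l)%N.
by rewrite expnD exprM.
Qed.

Lemma chi_qconj a b x : x ^+ q = x -> qconj a b -> chi (x - a) = chi (x - b).
Proof.
move=> xq /qconjP[l ->]; rewrite -[RHS](chi_frob _ l).
congr chi; rewrite exprBn_pchar ?pnatX ?q_pchar //; congr (_ - _).
by elim: l => [|l IHl]; rewrite ?expn0 ?expr1 // expnSr exprM -IHl.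
Qed.

Lemma chi_frob_fix (a b : F) : a ^+ q = a -> b ^+ q = b -> a != b -> chi (a - b) = 1.
Proof.
move=> a_q b_q neq_ab; have := chi_subfield (c := 1) isT (dvd1n _) (_ : (a - b) ^+ (q ^ 1) = _).
by rewrite expr1 expn1 exprBn_pchar // a_q b_q subr_eq0 => ->.
Qed.

(** * Weighted moments over the extension of degree r *)

Section Weights.
Variable r : nat.
Hypothesis r_gt0 : (0 < r)%N.
Hypothesis dvd_rd : (r %| d)%N.
Local Notation e := (q ^ r)%N.

Let e_pchar : [pchar F].-nat e. Proof. by rewrite pnatX q_pchar. Qed.
Let e_gt1 : (1 < e)%N.
Proof. by rewrite -[X in (X < _)%N](exp1n r) ltn_exp2r. Qed.
Let e_gt0 : (0 < e)%N := ltnW e_gt1.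

Local Notation deg := (conjdeg e).
Local Notation sqrt_e := (sqrtC e%:R : algC).

Let k0 := (d %/ r)%N.
Let Dd : (r * k0 = d)%N. Proof. by rewrite mulnC divnK. Qed.
Let k0_gt0 : (0 < k0)%N. Proof. by rewrite divn_gt0 // dvdn_leq. Qed.
Let cardFe : #|F| = (e ^ k0)%N. Proof. by rewrite -expnM Dd. Qed.

Lemma deg_dvd (tau : F) : (r * deg tau %| d)%N.
Proof. by rewrite -Dd dvdn_pmul2l // (conjdeg_dvd e_pchar cardFe). Qed.

(** On the field of q^(r deg tau1) elements [chi] has order r deg tau1, so the divisibility
    hypothesis says that its [i1]-th power is nontrivial there. *)
Lemma chi_sum_bound (tau1 : F) i1 (rest : seq (F * nat)) :
  {in rest, forall t, ~~ qconj tau1 t.1} -> ~~ (r * deg tau1 %| i1)%N ->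
  `|\sum_(x : F | x ^+ e == x) \prod_(t <- (tau1, i1) :: rest) chi (t.1 - x) ^+ t.2|
    <= (\sum_(t <- (tau1, i1) :: rest) deg t.1)%N.-1%:R * sqrt_e.
Proof.
move=> restP ndvd.
have W := @weil_bound F e k0 d chi_exp z w e_pchar e_gt1 k0_gt0 cardFe prim_z prim_w _ _ tau1 i1 rest deg.
rewrite /chi; apply W.
- by rewrite -expnM Dd chi_expE.
- exact: dvdn_trans dvd_dq (dvdn_pred_predX _ _).
- by move=> t _; rewrite conjdeg_gt0; split=> //; apply/eqP; rewrite (conjdegP e_pchar).
- move=> t rest_t l; apply: contra (restP t rest_t) => /eqP->.
  by apply/qconjP; exists (r * l)%N; rewrite expnM.
apply: contra ndvd; set delta := deg tau1.
have dvd_delta : (delta %| k0)%N := conjdeg_dvd e_pchar cardFe tau1.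
have q_gt0' : (0 < k0 %/ delta)%N by rewrite divn_gt0 ?conjdeg_gt0 // dvdn_leq.
have -> : d = (r * delta * (k0 %/ delta))%N by rewrite -mulnA [(delta * _)%N]mulnC divnK.
by rewrite dvdn_pmul2r.
Qed.

(* On the subfield [y ^+ (q ^ c) = y] the character [chi] has order [c], so this
   average is the indicator of the nonzero [d]-th powers, except that it takes
   the value [1 / c] at 0. *)
Definition weight (c : nat) (y : F) : algC := c%:R^-1 * \sum_(i < c) chi y ^+ i.

Lemma weightE c y : (0 < c)%N -> (c %| d)%N -> y ^+ (q ^ c) = y ->
  weight c y = if y == 0 then c%:R^-1 else (chi y == 1)%:R.
Proof.
move=> c_gt0 dvd_c yc; have c_neq0 : c%:R != 0 :> algC by rewrite pnatr_eq0 -lt0n.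
rewrite /weight; have [->|y_neq0] := eqVneq y 0.
  rewrite chi0 -(prednK c_gt0) big_ord_recl expr0.
  by rewrite big1 ?addr0 ?mulr1 // => i _; rewrite expr0n.
have [->|chi_neq1] := eqVneq (chi y) 1.
  under eq_bigr => i _ do rewrite expr1n.
  by rewrite sumr_const card_ord mulVf.
apply/eqP; rewrite mulf_eq0 invr_eq0 (negPf c_neq0) /=; apply/eqP.
apply: (mulfI (_ : chi y - 1 != 0)); first by rewrite subr_eq0.
rewrite -subrX1 mulr0.
by rewrite (chi_subfield c_gt0 dvd_c yc y_neq0) subrr.
Qed.

(** For [theta] in the field of q^r elements, tau - theta lies in that of q^(r deg tau) elements, so
    each factor is an indicator of adjacency away from theta = tau. *)
Definition place_weight (T : seq F) (theta : F) : algC :=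
  \prod_(tau <- T) weight (r * deg tau) (tau - theta).

(** Each weight is an average of powers of [chi]. Expanding one of them gives an average of sums
    with one more place, in which [tau1] keeps its nontrivial exponent; averaging costs nothing in
    the bound. *)
Lemma weighted_sum_bound (T : seq F) (tau1 : F) i1 (rest : seq (F * nat)) :
  {in rest, forall t, ~~ qconj tau1 t.1} -> {in T, forall tau, ~~ qconj tau1 tau} ->
  ~~ (r * deg tau1 %| i1)%N ->
  `|\sum_(x : F | x ^+ e == x) place_weight T x *
       \prod_(t <- (tau1, i1) :: rest) chi (t.1 - x) ^+ t.2|
    <= (\sum_(tau <- T) deg tau + \sum_(t <- (tau1, i1) :: rest) deg t.1)%N.-1%:R * sqrt_e.
Proof.
move=> restP TP ndvd; elim: T TP rest restP => [|tau T IHT] TP rest restP.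
  rewrite big_nil add0n; apply: le_trans (chi_sum_bound restP ndvd).
  rewrite le_eqVlt; apply/orP; left; apply/eqP; congr (`|_|).
  by apply: eq_bigr => x _; rewrite /place_weight big_nil mul1r.
set c := (r * deg tau)%N; have c_gt0 : (0 < c)%N by rewrite muln_gt0 r_gt0 conjdeg_gt0.
set B := (X in _ <= X).
have -> : \sum_(x : F | x ^+ e == x) place_weight (tau :: T) x *
       \prod_(t <- (tau1, i1) :: rest) chi (t.1 - x) ^+ t.2
   = c%:R^-1 * \sum_(i < c) \sum_(x : F | x ^+ e == x) place_weight T x *
       \prod_(t <- (tau1, i1) :: (tau, val i) :: rest) chi (t.1 - x) ^+ t.2.
  rewrite exchange_big mulr_sumr; apply: eq_bigr => x _ /=.
  rewrite /place_weight big_cons -/c /weight -!mulrA; congr (_ * _).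
  rewrite mulr_suml; apply: eq_bigr => i _; rewrite !big_cons /=; ring.
rewrite normrM ger0_norm ?invr_ge0 ?ler0n // mulrC ler_pdivrMr ?ltr0n //.
apply: le_trans (ler_norm_sum _ _ _) _.
apply: (@le_trans _ _ (\sum_(i < c) B)); last by rewrite sumr_const card_ord mulr_natr.
apply: ler_sum => i _; have := IHT _ ((tau, val i) :: rest).
have -> : (\sum_(t0 <- T) deg t0 + \sum_(t <- (tau1, i1) :: (tau, val i) :: rest) deg t.1)%N
   = (\sum_(t0 <- tau :: T) deg t0 + \sum_(t <- (tau1, i1) :: rest) deg t.1)%N.
  by rewrite !big_cons /=; ring.
apply; first by move=> t T_t; apply: TP; rewrite inE T_t orbT.
move=> t; rewrite inE => /orP[/eqP->|]; last exact: restP.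
by apply: TP; rewrite mem_head.
Qed.

Lemma place_weight_ge0 T x : x ^+ e = x -> 0 <= place_weight T x.
Proof.
move=> xe; apply: prodr_ge0 => tau _; rewrite weightE ?muln_gt0 ?r_gt0 ?conjdeg_gt0 ?deg_dvd //.
  by case: ifP => _; rewrite ?invr_ge0 ler0n.
rewrite expnM exprBn_pchar; last by rewrite pnatX e_pchar.
have -> : tau ^+ (e ^ deg tau) = tau by apply/eqP; rewrite (conjdegP e_pchar).
by congr (_ - _); elim: (deg tau) => [|l IHl]; rewrite ?expn0 ?expr1 // expnSr exprM IHl.
Qed.

(** In the average that defines the new weight, the zeroth power contributes the sum for the shorter
    list divided by [c], and the other c - 1 powers obey Weil's bound. *)
Lemma sum_place_weight_ge (T : seq F) : pairwise (fun a b => ~~ qconj a b) T ->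
  e%:R / (\prod_(tau <- T) (r * deg tau))%N%:R - (\sum_(tau <- T) deg tau)%N%:R * sqrt_e
   <= \sum_(x : F | x ^+ e == x) place_weight T x.
Proof.
elim: T => [|tau T IHT] /= => [_|/andP[tauT /IHT{}IHT]].
  rewrite !big_nil divr1 mul0r subr0.
  under eq_bigr => x _ do rewrite /place_weight big_nil.
  rewrite sumr_const ler_nat.
  have := card_frob_pow e_gt1 cardFe (d := 1) isT (dvd1n _).
  rewrite expn1 => {1}<-; apply/eq_leq/eq_card => x. by rewrite !inE.
set c := (r * deg tau)%N; have c_gt0 : (0 < c)%N by rewrite muln_gt0 r_gt0 conjdeg_gt0.
set DT := (\sum_(t <- T) deg t)%N in IHT *; set cut := (\prod_(t <- T) _)%N in IHT *.
rewrite big_cons -/c -/cut [X in X%:R * sqrt_e]big_cons -/DT.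
set S := \sum_(x | _) place_weight T x in IHT *.
pose X := \sum_(i < c.-1) \sum_(x : F | x ^+ e == x) place_weight T x * chi (tau - x) ^+ i.+1.
have DS : \sum_(x : F | x ^+ e == x) place_weight (tau :: T) x = c%:R^-1 * (S + X).
  rewrite /S /X exchange_big -big_split mulr_sumr; apply: eq_bigr => x _ /=.
  rewrite /place_weight big_cons -/c /weight -mulrA; congr (_ * _).
  rewrite -mulr_sumr [LHS]mulrC; move: (c_gt0); case: (c) => // c' _.
  by rewrite big_ord_recl expr0 mulrDr mulr1.
have S_real : S \is Num.real.
  by apply: sum_real => x /eqP xe; rewrite ger0_real ?place_weight_ge0.
have S'_real : c%:R^-1 * (S + X) \is Num.real.
  by rewrite -DS; apply: sum_real => x /eqP xe; rewrite ger0_real ?place_weight_ge0.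
have c_neq0 : c%:R != 0 :> algC by rewrite pnatr_eq0 -lt0n.
have c_real : c%:R^-1 \is @Num.real algC by rewrite realV realn.
have X_real : X \is Num.real.
  have -> : X = c%:R * (c%:R^-1 * (S + X)) - S.
    by rewrite mulrA mulfV // mul1r addrAC subrr add0r.
  by apply: rpredB => //; apply: rpredM => //; apply: realn.
have normX : `|X| <= c.-1%:R * ((deg tau + DT)%N%:R * sqrt_e).
  apply: le_trans (ler_norm_sum _ _ _) _.
  apply: (@le_trans _ _ (\sum_(i < c.-1) ((deg tau + DT)%N%:R * sqrt_e))); last first.
    by rewrite sumr_const card_ord -[X in X <= _]mulr_natl lexx.
  apply: ler_sum => i _; 
  have -> : \sum_(x : F | x ^+ e == x) place_weight T x * chi (tau - x) ^+ i.+1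
     = \sum_(x : F | x ^+ e == x) place_weight T x *
         \prod_(t <- [:: (tau, i.+1)]) chi (t.1 - x) ^+ t.2.
    by apply: eq_bigr => x _; rewrite big_seq1.
  apply: le_trans (weighted_sum_bound _ _ _) _ => //.
  - by move=> t T_t; have /allP/(_ t T_t) := tauT.
  - rewrite -/c; apply/negP => /(dvdn_leq (ltn0Sn _)) le_c.
    by have := ltn_ord i; rewrite ltnNge -ltnS prednK ?le_c.
  rewrite big_seq1 /=.
  rewrite ler_wpM2r ?sqrtC_ge0 ?ler0n // ler_nat.
  by rewrite [(DT + _)%N]addnC leq_pred.
rewrite DS natrM invfM mulrA [e%:R / _]mulrC -mulrA.
have c_gt0' : 0 < c%:R :> algC by rewrite ltr0n.
have lowX : - (c.-1%:R * ((deg tau + DT)%N%:R * sqrt_e)) <= X.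
  by have := normX; rewrite real_ler_norml // => /andP[].
rewrite -(ler_pM2l c_gt0') mulrBr !mulVKf ?gt_eqF //.
apply: le_trans (lerD IHT lowX); rewrite -subr_ge0.
have -> : c%:R = c.-1%:R + 1 :> algC by rewrite -{1}(prednK c_gt0) -addn1 natrD.
rewrite natrD.
have -> : e%:R / cut%:R - DT%:R * sqrt_e - c.-1%:R * (((deg tau)%:R + DT%:R) * sqrt_e)
   - (e%:R / cut%:R - (c.-1%:R + 1) * (((deg tau)%:R + DT%:R) * sqrt_e)) = (deg tau)%:R * sqrt_e by ring.
by rewrite mulr_ge0 ?ler0n // sqrtC_ge0 ler0n.
Qed.

Lemma norm_chi_le1 y : `|chi y| <= 1.
Proof.
have [->|y_neq0] := eqVneq y 0; first by rewrite chi0 normr0 ler01.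
have /(congr1 (fun x => `|x|)) := chi_neq0 y_neq0; rewrite normrX normr1 => norm1.
by rewrite -(@expr_le1 _ d) // norm1 lexx.
Qed.

Definition deviation (x theta : F) : algC := weight r (x - theta) - r%:R^-1.

Let r_neq0 : r%:R != 0 :> algC. Proof. by rewrite pnatr_eq0 -lt0n. Qed.

Lemma deviation_sum x theta :
  deviation x theta = r%:R^-1 * \sum_(i < r.-1) chi (x - theta) ^+ i.+1.
Proof.
rewrite /deviation /weight; case: (r) r_gt0 => // r' _.
by rewrite big_ord_recl expr0 mulrDr mulr1 addrAC subrr add0r.
Qed.

Lemma norm_deviation_le x theta : `|deviation x theta| <= r.-1%:R / r%:R.
Proof.
rewrite deviation_sum normrM ger0_norm ?invr_ge0 ?ler0n // mulrC.
rewrite ler_wpM2r ?invr_ge0 ?ler0n //; apply: le_trans (ler_norm_sum _ _ _) _.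
apply: (@le_trans _ _ (\sum_(i < r.-1) 1)); last by rewrite sumr_const card_ord lexx.
by apply: ler_sum => i _; rewrite normrX exprn_ile1 ?norm_chi_le1.
Qed.

Lemma qconj_frob_fix a b : a ^+ q = a -> qconj a b -> a = b.
Proof.
by move=> aq /qconj_sym/qconjP[l ->]; elim: l => [|l IHl]; rewrite ?expn0 ?expr1 // expnSr exprM -IHl aq.
Qed.

Lemma conjdeg_frob_fix (a : F) : a ^+ q = a -> deg a = 1%N.
Proof.
move=> aq; apply/eqP; rewrite -dvdn1 -(conjdegP e_pchar 1 a) expn1; apply/eqP.
by elim: (r) => [|l IHl]; rewrite ?expn0 ?expr1 // expnSr exprM IHl.
Qed.

(** Expanding the square, the diagonal terms are bounded by the total weight. For x != y in the base
    field, x is conjugate neither to y nor to a point of [T], so Weil's bound applies to all powers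
    involved, with two further places of degree 1. *)
Lemma second_moment (T : seq F) (A : {set F}) :
  {in T, forall tau, tau ^+ q != tau} -> {in A, forall x, x ^+ q = x} ->
  `|\sum_(theta : F | theta ^+ e == theta)
      place_weight T theta * (\sum_(x in A) deviation x theta) ^+ 2|
    <= (r.-1%:R / r%:R) ^+ 2 *
       (#|A|%:R * \sum_(theta : F | theta ^+ e == theta) place_weight T theta
        + #|A|%:R ^+ 2 * ((\sum_(tau <- T) deg tau).+1%:R * sqrt_e)).
Proof.
move=> TP AP; set S := \sum_(theta | _) place_weight T theta.
set B := _ * sqrt_e; set c := _ / _.
have c_ge0 : 0 <= c by rewrite divr_ge0 ?ler0n.
have B_ge0 : 0 <= B by rewrite mulr_ge0 ?ler0n // sqrtC_ge0 ler0n.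
have S_ge0 : 0 <= S by apply: sumr_ge0 => x /eqP; apply: place_weight_ge0.
pose M x y := \sum_(theta : F | theta ^+ e == theta)
  place_weight T theta * (deviation x theta * deviation y theta).
have -> : \sum_(theta : F | theta ^+ e == theta)
      place_weight T theta * (\sum_(x in A) deviation x theta) ^+ 2
   = \sum_(x in A) \sum_(y in A) M x y.
  under [RHS]eq_bigr => x _ do rewrite exchange_big.
  rewrite exchange_big; apply: eq_bigr => theta _ /=.
  rewrite expr2 mulr_suml mulr_sumr; apply: eq_bigr => x _.
  by rewrite !mulr_sumr.
have diag x : `|M x x| <= c ^+ 2 * S.
  apply: le_trans (ler_norm_sum _ _ _) _; rewrite mulr_sumr.
  apply: ler_sum => theta /eqP theta_e.
  have W_ge0 := place_weight_ge0 T theta_e.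
  rewrite normrM ger0_norm // mulrC ler_wpM2r // -expr2 normrX.
  by rewrite lerXn2r ?nnegrE ?normr_ge0 ?norm_deviation_le.
have offdiag x y : x \in A -> y \in A -> x != y -> `|M x y| <= c ^+ 2 * B.
  move=> Ax Ay neq_xy; have nconj_xy : ~~ qconj x y.
    by apply: contra neq_xy => /(qconj_frob_fix (AP x Ax))->.
  pose N i j := \sum_(theta : F | theta ^+ e == theta) place_weight T theta *
     \prod_(t <- [:: (x, i); (y, j)]) chi (t.1 - theta) ^+ t.2.
  have -> : M x y = r%:R^-1 ^+ 2 * \sum_(i < r.-1) \sum_(j < r.-1) N i.+1 j.+1.
    under eq_bigr => i _ do rewrite exchange_big.
    rewrite exchange_big mulr_sumr; apply: eq_bigr => theta _ /=.
    rewrite !deviation_sum.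
    set s1 := \sum_(i < _) _; set s2 := \sum_(i < _) _.
    have -> : place_weight T theta * (r%:R^-1 * s1 * (r%:R^-1 * s2))
       = r%:R^-1 ^+ 2 * (place_weight T theta * (s1 * s2)) by ring.
    congr (_ * _); rewrite /s1 /s2.
    rewrite mulr_suml mulr_sumr; apply: eq_bigr => i _.
    rewrite !mulr_sumr; apply: eq_bigr => j _.
    by rewrite big_cons big_seq1.
  have -> : c ^+ 2 * B = r%:R^-1 ^+ 2 * (r.-1%:R ^+ 2 * B).
    by rewrite /c; ring.
  have ri_ge0 : 0 <= r%:R^-1 ^+ 2 :> algC by rewrite exprn_ge0 ?invr_ge0 ?ler0n.
  rewrite normrM (ger0_norm ri_ge0); apply: ler_wpM2l => //.
  apply: le_trans (ler_norm_sum _ _ _) _.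
  apply: (@le_trans _ _ (\sum_(i < r.-1) \sum_(j < r.-1) B)); last first.
    by rewrite !sumr_const card_ord -mulrnA -[X in X <= _]mulr_natl natrM -expr2 lexx.
  apply: ler_sum => i _; apply: le_trans (ler_norm_sum _ _ _) _; apply: ler_sum => j _.
  apply: le_trans (weighted_sum_bound _ _ _) _.
  - by move=> t; rewrite inE => /eqP->.
  - move=> tau T_tau; apply/negP => /(qconj_frob_fix (AP x Ax)) Dx.
    by have := TP tau T_tau; rewrite -Dx (AP x Ax) eqxx.
  - rewrite (conjdeg_frob_fix (AP x Ax)) muln1; apply/negP => /(dvdn_leq (ltn0Sn _)) le_r.
    by have := ltn_ord i; rewrite ltnNge -ltnS prednK ?le_r.
  rewrite big_cons big_seq1 /= (conjdeg_frob_fix (AP x Ax)) (conjdeg_frob_fix (AP y Ay)).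
  by rewrite /B !addnS addn0 lexx.
apply: le_trans (ler_norm_sum _ _ _) _.
apply: (@le_trans _ _ (\sum_(x in A) (c ^+ 2 * S + #|A|%:R * (c ^+ 2 * B)))); last first.
  rewrite sumr_const -[X in X <= _]mulr_natl le_eqVlt; apply/orP; left; apply/eqP; ring.
apply: ler_sum => x Ax; rewrite (bigD1 x) //=.
apply: le_trans (ler_normD _ _) _; apply: lerD (diag x) _.
apply: le_trans (ler_norm_sum _ _ _) _.
apply: (@le_trans _ _ (\sum_(y in A) (c ^+ 2 * B))); last first.
  by rewrite sumr_const -[X in X <= _]mulr_natl lexx.
rewrite [X in _ <= X](bigD1 x) //= -[X in X <= _]add0r; apply: lerD.
  by rewrite mulr_ge0 ?exprn_ge0.
by apply: ler_sum => y /andP[Ay neq_yx]; apply: offdiag; rewrite // eq_sym.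
Qed.

Lemma weight_neq0 (tau theta : F) : theta ^+ e = theta -> tau != theta ->
  weight (r * deg tau) (tau - theta) != 0 -> chi (tau - theta) = 1.
Proof.
move=> theta_e neq_tau; rewrite weightE ?muln_gt0 ?r_gt0 ?conjdeg_gt0 ?deg_dvd //; last first.
  rewrite expnM exprBn_pchar; last by rewrite pnatX e_pchar.
  have -> : tau ^+ (e ^ deg tau) = tau by apply/eqP; rewrite (conjdegP e_pchar).
  by congr (_ - _); elim: (deg tau) => [|l IHl]; rewrite ?expn0 ?expr1 // expnSr exprM IHl.
by rewrite subr_eq0 (negPf neq_tau); case: (chi _ =P 1) => // _; rewrite mulr0n eqxx.
Qed.

Definition neighbors (A : {set F}) theta := [set x in A | chi (x - theta) == 1].

(** The term [theta \in A] reflects the value 1 / r of the weight at 0. Multiplied by r, the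
    deviation sum is an integer, so the bounds can be stated without complex numbers. *)
Lemma deviation_sumE (A : {set F}) theta :
  {in A, forall x, x ^+ q = x} -> theta ^+ e = theta ->
  r%:R * (\sum_(x in A) deviation x theta)
    = ((r * #|neighbors A theta| + (theta \in A))%N%:Z - #|A|%:Z)%:~R.
Proof.
move=> AP theta_e; pose v (x : F) : algC := (r * (chi (x - theta)%R == 1%R) + (x == theta))%N%:R.
have devE x : x \in A -> r%:R * deviation x theta = v x - 1.
  move=> Ax; rewrite mulrBr mulfV // weightE //; last first.
    rewrite exprBn_pchar // theta_e; congr (_ - _).
    by elim: (r) => [|l IHl]; rewrite ?expn0 ?expr1 // expnSr exprM IHl AP.
  rewrite subr_eq0 /v; have [->|neq_x] := eqVneq x theta.
    by rewrite subrr chi0 eq_sym oner_eq0 muln0 add0n mulfV.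
  by rewrite addn0 natrM.
rewrite mulr_sumr (eq_bigr _ devE) big_split /= sumrN sumr_const.
rewrite rmorphB /= -!pmulrn; congr (_ - _).
rewrite /v -natr_sum; congr _%:R; rewrite big_split -big_distrr /=; congr (_ * _ + _)%N.
  rewrite -sum1_card big_mkcond [RHS]big_mkcond /=; apply: eq_bigr => x _.
  by rewrite !inE; case: (x \in A); case: eqP.
rewrite big_mkcond /= (bigD1 theta) //= eqxx big1 ?addn0; first by case: (theta \in A).
by move=> x /negPf->; case: ifP.
Qed.

(** If every theta of nonzero weight violated the inequality, the weighted average of the squared
    deviations would exceed [second_moment]. The integers [s] and [u] stand for sqrt e and for its
    excess over the Weil error D cut; S cut >= u sqrt e clears the denominators. *)
Lemma exists_good_point (T : seq F) (A : {set F}) (u s : nat) :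
  let D := (\sum_(tau <- T) deg tau)%N in let cut := (\prod_(tau <- T) (r * deg tau))%N in
  {in T, forall tau, tau ^+ q != tau} -> {in A, forall x, x ^+ q = x} ->
  pairwise (fun a b => ~~ qconj a b) T ->
  (0 < u)%N -> (s = u + D * cut)%N -> (s ^ 2 <= e)%N ->
  exists theta, [/\ theta ^+ e = theta,
    {in T, forall tau, tau != theta -> chi (tau - theta) = 1} &
    ((r * #|neighbors A theta| + (theta \in A))%N%:Z - #|A|%:Z) ^+ 2 * u%:Z
      <= (r.-1 ^ 2 * (#|A| * u + #|A| ^ 2 * (D.+1 * cut)))%N%:Z].
Proof.
move=> D cut TP AP pwT u_gt0 Ds le_se.
pose W := place_weight T; pose S := \sum_(x : F | x ^+ e == x) W x.
pose G theta := \sum_(x in A) deviation x theta.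
pose Z theta : algC := ((r * #|neighbors A theta| + (theta \in A))%N%:Z - #|A|%:Z)%:~R.
pose al : algC := #|A|%:R; pose B : algC := D.+1%:R * sqrt_e.
pose RH : algC := (r.-1%:R / r%:R) ^+ 2 * (al * S + al ^+ 2 * B).
have cut_gt0 : (0 < cut)%N.
  by rewrite prodn_gt0 // => tau; rewrite muln_gt0 r_gt0 conjdeg_gt0.
have cut_gt0' : 0 < cut%:R :> algC by rewrite ltr0n.
have sqrt_gt0 : 0 < sqrt_e by rewrite sqrtC_gt0 ltr0n.
have le_s : s%:R <= sqrt_e.
  rewrite -(@ler_pXn2r _ 2) // ?nnegrE ?ler0n ?(ltW sqrt_gt0) // sqrtCK -natrX ler_nat //.
have S_cut : sqrt_e * u%:R <= S * cut%:R.
  rewrite -ler_pdivrMr //; apply: le_trans (sum_place_weight_ge pwT).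
  rewrite -/cut -/D ler_pdivrMr // mulrBl divfK ?gt_eqF //.
  have -> : e%:R - D%:R * sqrt_e * cut%:R = sqrt_e * (sqrt_e - (D * cut)%N%:R).
    by rewrite mulrBr -expr2 sqrtCK natrM; congr (_ - _); ring.
  by rewrite ler_wpM2l ?(ltW sqrt_gt0) // lerBrDr -natrD -Ds.
have u_gt0' : 0 < u%:R :> algC by rewrite ltr0n.
have S_gt0 : 0 < S.
  by rewrite -(pmulr_lgt0 _ cut_gt0'); apply: lt_le_trans S_cut; rewrite mulr_gt0.
have W_ge0 x : x ^+ e = x -> 0 <= W x by apply: place_weight_ge0.
pose P theta := [&& theta ^+ e == theta, W theta != 0 &
    ((r * #|neighbors A theta| + (theta \in A))%N%:Z - #|A|%:Z) ^+ 2 * u%:Z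
      <= (r.-1 ^ 2 * (#|A| * u + #|A| ^ 2 * (D.+1 * cut)))%N%:Z].
have [theta /and3P[/eqP theta_e W_neq0 bound]|noP] := pickP P.
  exists theta; split=> // tau T_tau neq_tau; apply: weight_neq0 => //.
  by move: W_neq0; rewrite /W /place_weight prodf_seq_neq0 => /allP/(_ tau T_tau).
have r_gt0' : 0 < r%:R :> algC by rewrite ltr0n.
have big theta : theta ^+ e = theta -> W theta != 0 -> RH < S * G theta ^+ 2.
  move=> theta_e W_neq0; have := noP theta; rewrite /P theta_e eqxx W_neq0 /= => /negbT.
  rewrite -ltNge -(ltr_int algC) [X in _ < X]rmorphM [X in _ < X * _]rmorphXn /= -/(Z theta).
  have <- : r%:R * G theta = Z theta by exact: deviation_sumE.
  rewrite -!pmulrn => lt_bound.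
  have u_r : 0 < u%:R * r%:R ^+ 2 :> algC by rewrite mulr_gt0 ?exprn_gt0.
  rewrite -(ltr_pM2l u_r).
  have -> : u%:R * r%:R ^+ 2 * (S * G theta ^+ 2) = S * ((r%:R * G theta) ^+ 2 * u%:R) by ring.
  apply: le_lt_trans (_ : _ <= S * (r.-1 ^ 2 * (#|A| * u + #|A| ^ 2 * (D.+1 * cut)))%N%:R) _; last first.
    by rewrite ltr_pM2l.
  have -> : u%:R * r%:R ^+ 2 * RH
    = r.-1%:R ^+ 2 * (al * u%:R * S) + r.-1%:R ^+ 2 * al ^+ 2 * D.+1%:R * (sqrt_e * u%:R).
    by rewrite /RH /B; field.
  have -> : S * (r.-1 ^ 2 * (#|A| * u + #|A| ^ 2 * (D.+1 * cut)))%N%:R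
    = r.-1%:R ^+ 2 * (al * u%:R * S) + r.-1%:R ^+ 2 * al ^+ 2 * D.+1%:R * (S * cut%:R).
    by rewrite !(natrM, natrD, natrX) /al; ring.
  by rewrite lerD2l ler_wpM2l // !mulr_ge0 ?exprn_ge0 ?ler0n.
have G_real theta : theta ^+ e = theta -> 0 <= G theta ^+ 2.
  move=> theta_e; have -> : G theta = Z theta / r%:R.
    by rewrite /Z -(deviation_sumE AP theta_e) mulrC mulKf.
  apply: real_exprn_even_ge0 => //; apply: rpredM; first exact: realz.
  by rewrite realV realn.
have term_ge0 theta : theta ^+ e = theta -> 0 <= W theta * (S * G theta ^+ 2 - RH).
  move=> theta_e; have [->|W_neq0] := eqVneq (W theta) 0; first by rewrite mul0r.
  by rewrite mulr_ge0 ?W_ge0 // subr_ge0 ltW // big.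
have M_le : \sum_(x : F | x ^+ e == x) W x * G x ^+ 2 <= RH.
  apply: le_trans (second_moment TP AP); rewrite real_ler_norm //.
  by apply: sum_real => x /eqP xe; rewrite ger0_real // mulr_ge0 ?W_ge0 ?G_real.
have sum_le0 : \sum_(x : F | x ^+ e == x) W x * (S * G x ^+ 2 - RH) <= 0.
  under eq_bigr => x _ do rewrite mulrBr mulrCA.
  by rewrite sumrB -mulr_sumr -mulr_suml -mulrBr pmulr_rle0 // subr_le0.
have W0 theta : theta ^+ e == theta -> W theta = 0.
  move=> theta_e; have ge0 x : x ^+ e == x -> 0 <= W x * (S * G x ^+ 2 - RH).
    by move/eqP; apply: term_ge0.
  have /psumr_eq0P/(_ theta theta_e)/eqP : \sum_(x : F | x ^+ e == x) W x * (S * G x ^+ 2 - RH) = 0.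
    by apply/eqP; rewrite eq_le sum_le0 sumr_ge0.
  move=> /(_ ge0); rewrite mulf_eq0 => /orP[/eqP //|].
  have [-> //|W_neq0] := eqVneq (W theta) 0.
  by rewrite subr_eq0 gt_eqF // big //; apply/eqP.
by move: S_gt0; rewrite /S big1 ?ltxx.
Qed.

(* If [theta] were in the subfield [x ^+ q = x], or conjugate to a point of [T],
   then all of [A] would be adjacent to it, which contradicts the deviation bound. *)
Lemma extend_clique (T : seq F) (A : {set F}) (u s : nat) :
  let D := (\sum_(tau <- T) deg tau)%N in let cut := (\prod_(tau <- T) (r * deg tau))%N in
  {in T, forall tau, tau ^+ q != tau} -> {in A, forall x, x ^+ q = x} ->
  pairwise (fun a b => ~~ qconj a b) T ->
  {in T & A, forall tau x, chi (x - tau) = 1} ->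
  (0 < u)%N -> (s = u + D * cut)%N -> (s ^ 2 <= e)%N ->
  (#|A| * u + #|A| ^ 2 * (D.+1 * cut) < #|A|.-1 ^ 2 * u)%N -> (1 < r)%N ->
  exists theta, [/\ theta ^+ e = theta, theta ^+ q != theta,
    {in T, forall tau, ~~ qconj theta tau}, {in T, forall tau, chi (tau - theta) = 1} &
    ((r * #|neighbors A theta|)%N%:Z - #|A|%:Z) ^+ 2 * u%:Z
      <= (r.-1 ^ 2 * (#|A| * u + #|A| ^ 2 * (D.+1 * cut)))%N%:Z].
Proof.
move=> D cut TP AP pwT TA u_gt0 Ds le_se large r_gt1.
have [theta [theta_e theta_T bound]] := exists_good_point TP AP pwT u_gt0 Ds le_se.
have not_all : (#|neighbors A theta| + (theta \in A) != #|A|)%N.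
  apply/eqP => Dn; move: bound; rewrite -/D -/cut.
  set n := #|neighbors A theta| in Dn *; set b := nat_of_bool _ in Dn *.
  have -> : (r * n + b)%N%:Z - #|A|%:Z = (r.-1 * n)%N%:Z :> int.
    by rewrite -Dn -{1}(prednK r_gt0) mulSn !PoszD; ring.
  rewrite expr2 -!PoszM lez_nat mulnn; apply/negP; rewrite -ltnNge expnMn -mulnA.
  rewrite ltn_pmul2l ?expn_gt0 ?ltn_predRL ?r_gt1 //.
  apply: leq_trans large _; rewrite leq_mul2r leq_exp2r // -subn1 leq_subLR -Dn addnC.
  by rewrite leq_add2r leq_b1 orbT.
have theta_q : theta ^+ q != theta.
  apply: contra not_all => /eqP theta_q; apply/eqP.
  rewrite addnC [RHS](cardsD1 theta); congr (_ + _)%N.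
  apply: eq_card => x; rewrite !inE; case: (boolP (x \in A)) => [Ax|_]; rewrite ?andbF ?andbT //=.
  have [->|neq_x] := eqVneq x theta; first by rewrite subrr chi0 eq_sym oner_eq0.
  by rewrite (chi_frob_fix (AP x Ax) theta_q neq_x) eqxx.
have theta_A : theta \notin A by apply: contra theta_q => /AP->.
have theta_nconj : {in T, forall tau, ~~ qconj theta tau}.
  move=> tau T_tau; apply: contra not_all => conj_tau.
  rewrite (negPf theta_A) addn0; apply/eqP/eq_card => x; rewrite !inE.
  case: (boolP (x \in A)) => //= Ax; rewrite (chi_qconj (AP x Ax) conj_tau).
  by rewrite TA ?eqxx.
exists theta; split=> //.
  move=> tau T_tau; apply: theta_T => //; apply: contra (theta_nconj tau T_tau) => /eqP->.
  exact: qconj_refl.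
by move: bound; rewrite (negPf theta_A) addn0.
Qed.

End Weights.

(** * Points of a clique outside the subfield of q elements *)

Lemma chi_conj y : (1 < d)%N -> (chi y)^* = chi y ^+ d.-1.
Proof.
move=> d_gt1; have [->|y_neq0] := eqVneq y 0.
  by rewrite chi0 conjC0 expr0n -subn1 subn_eq0 leqNgt d_gt1.
have chi_d := chi_neq0 y_neq0.
have chi_nz : chi y != 0.
  by apply/eqP => c0; move: chi_d; rewrite c0 expr0n gtn_eqF // => /eqP; rewrite eq_sym oner_eq0.
apply: (mulfI chi_nz); rewrite -exprS prednK // chi_d -normCK.
have /(congr1 (fun x => `|x|)) := chi_d; rewrite normrX normr1 => /eqP.
by rewrite pexprn_eq1 ?normr_ge0 // (gtn_eqF d_gt0) /= => /eqP->; rewrite expr1n.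
Qed.

Local Notation degq := (conjdeg (q ^ 1)%N).

Lemma degq_gt1 (tau : F) : tau ^+ q != tau -> (1 < degq tau)%N.
Proof.
move=> tau_q; rewrite ltn_neqAle conjdeg_gt0 ?pnatX ?q_pchar // andbT eq_sym.
apply: contra tau_q => /eqP deg1.
have e_pchar : [pchar F].-nat (q ^ 1)%N by rewrite expn1.
by have := conjdegP e_pchar 1 tau; rewrite deg1 !expn1 => ->.
Qed.

Lemma card_frob_fixF : #|[pred x : F | x ^+ (q ^ 1) == x]| = q.
Proof.
rewrite -[RHS]expn1 -[RHS](card_frob_pow q_gt1 cardF (d := 1) isT (dvd1n _)).
by apply: eq_card => x; rewrite !inE.
Qed.

Lemma degq_le (tau : F) : (degq tau <= d)%N.
Proof. by rewrite dvdn_leq // -[X in (X %| _)%N]mul1n deg_dvd. Qed.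

(** The sum of |sum of chi(tau - x)|^2 over the subfield is at least |A| t^2. Its correlations are
    at most q for conjugate points and (2 d - 1) sqrt q otherwise, where two places of degree at
    most d occur. Squaring keeps the result in [nat]; truncated subtraction makes it trivial when t
    |A| <= q. *)
Lemma common_neighbors_bound (Th : seq F) (A : {set F}) : (1 < d)%N ->
  {in Th, forall tau, tau ^+ q != tau} -> {in A, forall x, x ^+ q = x} ->
  pairwise (fun a b => ~~ qconj a b) Th ->
  {in Th & A, forall tau x, chi (x - tau) = 1} ->
  ((size Th * #|A| - q) ^ 2 <= (size Th * (2 * d).-1) ^ 2 * q)%N.
Proof.
move=> d_gt1 ThP AP pwTh ThA; set t := size Th.
have [->|t_gt0] := posnP t; first by rewrite mul0n sub0n.
have q1_gt0 : (0 < q ^ 1)%N by rewrite expn1.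
pose sq : algC := sqrtC q%:R.
have sq_ge0 : 0 <= sq by rewrite sqrtC_ge0 ler0n.
pose h x := \sum_(tau <- Th) chi (tau - x).
pose M a b := \sum_(x : F | x ^+ (q ^ 1) == x) chi (a - x) * chi (b - x) ^+ d.-1.
pose B : algC := (2 * d).-1%:R * sq.
have B_ge0 : 0 <= B by rewrite mulr_ge0 ?ler0n.
have sum_h : \sum_(x : F | x ^+ (q ^ 1) == x) `|h x| ^+ 2
   = \sum_(a <- Th) \sum_(b <- Th) M a b.
  under [RHS]eq_bigr => a _ do rewrite exchange_big.
  rewrite exchange_big; apply: eq_bigr => x _ /=.
  rewrite normCK /h rmorph_sum mulr_suml; apply: eq_bigr => a _.
  by rewrite mulr_sumr; apply: eq_bigr => b _; rewrite /= chi_conj.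
have offdiag a b : a \in Th -> ~~ qconj a b -> `|M a b| <= B.
  move=> Th_a nconj; have -> : M a b = \sum_(x : F | x ^+ (q ^ 1) == x)
      \prod_(t <- [:: (a, 1); (b, d.-1)]) chi (t.1 - x) ^+ t.2.
    by apply: eq_bigr => x _; rewrite big_cons big_seq1.
  apply: le_trans (chi_sum_bound _ _ _ _) _ => //.
  - by move=> t'; rewrite inE => /eqP->.
  - by rewrite mul1n dvdn1 gtn_eqF ?degq_gt1 ?ThP.
  rewrite big_cons big_seq1 /= /B /sq expn1 ler_wpM2r // ler_nat -!subn1 leq_sub2r //.
  by rewrite mul2n -addnn leq_add ?degq_le //; have := degq_le b; rewrite expn1.
have diag a : `|M a a| <= q%:R.
  apply: le_trans (ler_norm_sum _ _ _) _.
  apply: (@le_trans _ _ (\sum_(x : F | x ^+ (q ^ 1) == x) 1)); last first.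
    by rewrite sumr_const card_frob_fixF lexx.
  apply: ler_sum => x _; rewrite -exprS prednK // normrX exprn_ile1 ?norm_chi_le1 //.
have t_gt0' : 0 < t%:R :> algC by rewrite ltr0n.
have upper : `|\sum_(a <- Th) \sum_(b <- Th) M a b| <= t%:R * (q%:R + t%:R * B).
  have rowB a : a \in Th -> forall T', {subset T' <= Th} ->
      pairwise (fun a b => ~~ qconj a b) T' ->
      `|\sum_(b <- T') M a b| <= q%:R + (size T')%:R * B.
    move=> Th_a; elim=> [|b T' IH] sub /=; first by rewrite big_nil normr0 mul0r addr0 ler0n.
    case/andP=> /allP bT' /(IH _) {}IH; rewrite big_cons; apply: le_trans (ler_normD _ _) _.
    have subT' : {subset T' <= Th} by move=> x T'x; apply: sub; rewrite inE T'x orbT.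
    (* No two entries of [T'] are conjugate, so a row meets at most one conjugate of [a], and the
       diagonal bound is spent only there. *)
    case: (boolP (qconj a b)) => [conj_ab|nconj].
      apply: lerD.
        have -> : M a b = M a a.
          by apply: eq_bigr => x /eqP xq; congr (_ * _ ^+ _);
             rewrite -chiN -[RHS]chiN !opprB; apply: chi_qconj;
             [rewrite expn1 in xq | apply: qconj_sym].
        exact: diag.
      apply: le_trans (ler_norm_sum _ _ _) _.
      apply: (@le_trans _ _ (\sum_(b' <- T') B)); last first.
        by rewrite big_const_seq count_predT iter_addr_0 -[X in X <= _]mulr_natl ler_wpM2r // ler_nat.
      rewrite big_seq [X in _ <= X]big_seq; apply: ler_sum => b' T'b'.
      apply: offdiag => //; apply: contra (bT' b' T'b') => conj_ab'.
      exact: qconj_trans (qconj_sym conj_ab) conj_ab'.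
    rewrite -[(size T').+1]addn1 natrD mulrDl mul1r addrA addrC.
    by apply: lerD; [apply: offdiag | apply: IH].
  apply: le_trans (ler_norm_sum _ _ _) _.
  apply: (@le_trans _ _ (\sum_(a <- Th) (q%:R + t%:R * B))); last first.
    by rewrite big_const_seq count_predT iter_addr_0 -[X in X <= _]mulr_natl lexx.
  rewrite big_seq [X in _ <= X]big_seq; apply: ler_sum => a Th_a.
  exact: rowB.
have lower : #|A|%:R * t%:R ^+ 2 <= \sum_(x : F | x ^+ (q ^ 1) == x) `|h x| ^+ 2.
  apply: (@le_trans _ _ (\sum_(x in A) `|h x| ^+ 2)).
    have -> : #|A|%:R * t%:R ^+ 2 = \sum_(x in A) t%:R ^+ 2 :> algC by rewrite sumr_const mulr_natl.
    apply: ler_sum => x Ax.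
    suff -> : h x = t%:R by rewrite normr_nat.
    rewrite /h (eq_big_seq (fun=> 1)); last by move=> tau Th_tau; rewrite -chiN opprB ThA.
    by rewrite big_const_seq count_predT iter_addr_0.
  rewrite [X in _ <= X](bigID (mem A)) /=.
  rewrite [X in _ <= X + _](eq_bigl (mem A)); last first.
    by move=> x /=; case Ax: (x \in A); rewrite ?andbF // andbT expn1 AP ?eqxx.
  by rewrite lerDl sumr_ge0 // => x _; rewrite exprn_ge0.
have main : t%:R * #|A|%:R - q%:R <= t%:R * B.
  rewrite lerBlDl -(ler_pM2l t_gt0'); apply: le_trans upper; rewrite -sum_h.
  apply: le_trans (le_trans lower (real_ler_norm _)).
    by rewrite mulrA mulrC -expr2 lexx.
  by apply: sum_real => x _; rewrite ger0_real // exprn_ge0.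
have [le_tA|lt_q] := leqP (t * #|A|) q; first by rewrite (eqP le_tA).
rewrite -(ler_nat algC) natrX natrM natrX natrB ?(ltnW lt_q) // !natrM -[q%:R in X in _ <= X]sqrtCK -exprMn -mulrA.
rewrite ler_pXn2r ?nnegrE ?mulr_ge0 ?ler0n //.
by rewrite subr_ge0 -natrM ler_nat ltnW.
Qed.

(** The Weil sum with the single place [theta] would be q, while it is at most (d - 1) sqrt q. This
    makes the subfield itself a maximal clique when m = 1. *)
Lemma card_le_of_frob_fix_neighbor (theta : F) : theta ^+ q != theta ->
  (forall x, x ^+ q = x -> chi (x - theta) = 1) -> (q <= d.-1 ^ 2)%N.
Proof.
move=> theta_q adj.
have ndvd : ~~ (1 * degq theta %| 1)%N by rewrite mul1n dvdn1 gtn_eqF ?degq_gt1.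
have := @chi_sum_bound 1 isT (dvd1n _) theta 1 [::] (fun _ => fun h => match notF h with end) ndvd.
rewrite (eq_bigr (fun=> 1)) => [|x /eqP]; last first.
  by rewrite expn1 big_seq1 expr1 -chiN opprB => /adj.
rewrite sumr_const card_frob_fixF normr_nat big_seq1 /= expn1 => bound.
rewrite -(leq_pmul2r q_gt0) mulnn -(ler_nat algC) natrM !natrX -[q%:R in X in _ <= X]sqrtCK -exprMn.
rewrite ler_pXn2r ?nnegrE ?mulr_ge0 ?sqrtC_ge0 ?ler0n //.
apply: le_trans bound _; rewrite ler_wpM2r ?sqrtC_ge0 ?ler0n // ler_nat -!subn1 leq_sub2r //.
by have := degq_le theta; rewrite expn1.
Qed.

Lemma qconj_representatives (s : seq F) : exists Th : seq F,
  [/\ {subset Th <= s}, pairwise (fun a b => ~~ qconj a b) Th &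
      {in s, forall a, exists2 b, b \in Th & qconj a b}].
Proof.
elim: s => [|a s [Th [subTh pwTh repTh]]]; first by exists [::].
case: (boolP (has (qconj a) Th)) => [/hasP[b Th_b ab]|/hasPn nTh].
  exists Th; split=> // [x /subTh|x]; first by rewrite inE orbC => ->.
  by rewrite inE => /predU1P[->|/repTh //]; exists b.
exists (a :: Th); split=> /= [x||x].
- by rewrite !inE => /predU1P[->|/subTh->]; rewrite ?eqxx ?orbT.
- by rewrite pwTh andbT; apply/allP.
rewrite inE => /predU1P[->|/repTh[b Th_b ab]]; first by exists a; rewrite ?mem_head ?qconj_refl.
by exists b; rewrite ?inE ?Th_b ?orbT.
Qed.

Lemma card_qconj_classes (B : {set F}) (Th : seq F) :
  {in B, forall a, exists2 b, b \in Th & qconj a b} -> (#|B| <= d * size Th)%N.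
Proof.
move=> repB.
have sub : {subset enum B <= [seq b ^+ (q ^ l) | b <- Th, l <- iota 0 d]}.
  move=> a; rewrite mem_enum => /repB[b Th_b /existsP[l /eqP->]].
  by apply: allpairs_f; rewrite ?mem_iota ?ltn_ord.
have := uniq_leq_size (enum_uniq _) sub.
by rewrite -cardE size_allpairs size_iota mulnC.
Qed.

Definition common (T : seq F) := [set x | (x ^+ q == x) && all (fun tau => chi (x - tau) == 1) T].

Lemma common_cons theta T : common (theta :: T) = neighbors (common T) theta.
Proof. by apply/setP => x; rewrite !inE /= -andbA; congr (_ && _); rewrite andbC. Qed.

Lemma card_common_nil : #|common [::]| = q.
Proof.
rewrite -[RHS]card_frob_fixF; apply: eq_card => x.
by rewrite !inE andbT expn1.
Qed.

Definition valid_places (pl : seq (F * nat)) :=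
  [/\ {in pl, forall t, [/\ prime t.2, (t.2 %| d)%N, t.1 ^+ (q ^ t.2) = t.1 & t.1 ^+ q != t.1]},
      pairwise (fun a b => ~~ qconj a b) (unzip1 pl) &
      pairwise (fun a b => chi (a - b) == 1) (unzip1 pl)].

Lemma conjdeg_le_place_degree p (t : F * nat) : (0 < p)%N -> prime t.2 ->
  t.1 ^+ (q ^ t.2) = t.1 -> (conjdeg (q ^ p)%N t.1 <= place_degree p t.2)%N.
Proof.
move=> p_gt0 pr_t t_q.
have e_pchar : [pchar F].-nat (q ^ p)%N by rewrite pnatX q_pchar.
have frob_mul i : t.1 ^+ (q ^ (t.2 * i)) = t.1.
  by elim: i => [|i IHi]; rewrite ?muln0 ?expn0 ?expr1 // mulnS expnD exprM t_q.
rewrite /place_degree; case: eqP => [Dp|_]; apply: dvdn_leq => //; rewrite ?(prime_gt0 pr_t) //.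
  by rewrite -(conjdegP e_pchar) expn1 -Dp t_q.
by rewrite -(conjdegP e_pchar) -expnM mulnC frob_mul.
Qed.

(** The true degrees over the field of q^p elements are replaced by bounds read off from the primes,
    hence the existential [u] and [v]. The margin 5 V <= s leaves u >= 4 V. *)
Lemma extend_places (pl : seq (F * nat)) (p s : nat) :
  let V := ((\sum_(i <- unzip2 pl) place_degree p i).+1
            * \prod_(i <- unzip2 pl) (p * place_degree p i))%N in
  let A := common (unzip1 pl) in
  valid_places pl -> prime p -> (p %| d)%N -> (s ^ 2 <= q ^ p)%N -> (5 * V <= s)%N ->
  (4 <= #|A|)%N ->
  exists theta u v, [/\ valid_places ((theta, p) :: pl), (v <= V)%N, (s <= u + V)%N, (0 < u)%N &
    ((p * #|common (theta :: unzip1 pl)|)%N%:Z - #|A|%:Z) ^+ 2 * u%:Z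
      <= (p.-1 ^ 2 * (#|A| * u + #|A| ^ 2 * v))%N%:Z].
Proof.
move=> V A [plP pwT pwA] pr_p dvd_p le_s le_V A_ge4.
have p_gt0 := prime_gt0 pr_p.
set T := unzip1 pl in A A_ge4 pwT pwA *.
pose D := (\sum_(tau <- T) conjdeg (q ^ p)%N tau)%N.
pose cut := (\prod_(tau <- T) (p * conjdeg (q ^ p)%N tau))%N.
have le_D : (D <= \sum_(i <- unzip2 pl) place_degree p i)%N.
  rewrite /D /T !big_map big_seq [X in (_ <= X)%N]big_seq; apply: leq_sum => t pl_t.
  by have [pr_t _ t_q _] := plP t pl_t; apply: conjdeg_le_place_degree.
have le_cut : (cut <= \prod_(i <- unzip2 pl) (p * place_degree p i))%N.
  rewrite /cut /T !big_map big_seq [X in (_ <= X)%N]big_seq; apply: leq_prod => t pl_t.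
  have [pr_t _ t_q _] := plP t pl_t.
  by rewrite leq_mul2l conjdeg_le_place_degree ?orbT.
have cut_gt0 : (0 < cut)%N.
  by rewrite prodn_gt0 // => tau; rewrite muln_gt0 p_gt0 conjdeg_gt0 // pnatX q_pchar.
have le_v : (D.+1 * cut <= V)%N by apply: leq_mul.
have le_Dc : (D * cut <= V)%N by apply: leq_trans le_v; rewrite leq_mul2r leqnSn orbT.
have V_gt0 : (0 < V)%N by apply: leq_trans le_v; rewrite muln_gt0.
have [u Ds] : exists u, s = (u + D * cut)%N.
  by exists (s - D * cut)%N; rewrite subnK //; apply: leq_trans le_V; apply: leq_trans le_Dc _; lia.
have u_ge : (4 * V <= u)%N by lia.
have u_gt0 : (0 < u)%N by lia.
have TP : {in T, forall tau, tau ^+ q != tau}.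
  by move=> _ /mapP[t pl_t ->]; have [] := plP t pl_t.
have AP : {in A, forall x, x ^+ q = x} by move=> x; rewrite inE => /andP[/eqP].
have TA : {in T & A, forall tau x, chi (x - tau) = 1}.
  by move=> tau x T_tau; rewrite inE => /andP[_ /allP/(_ tau T_tau)/eqP].
(* As v <= u / 4, it suffices that 4 a + a^2 < 4 (a - 1)^2 for a = |A|, which fails at a = 3 and
   holds from a = 4 on. *)
have large : (#|A| * u + #|A| ^ 2 * (D.+1 * cut) < #|A|.-1 ^ 2 * u)%N.
  move: A_ge4 le_v u_ge; set v := (D.+1 * cut)%N; case: #|A| => // a a_ge3 le_v u_ge /=.
  have h : (4 * (a.+1 ^ 2 * v) <= a.+1 ^ 2 * u)%N.
    by rewrite mulnCA leq_mul2l; apply/orP; right; lia.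
  suff : (4 * (a.+1 * u) + a.+1 ^ 2 * u < 4 * (a ^ 2 * u))%N by lia.
  have -> : (4 * (a.+1 * u) + a.+1 ^ 2 * u = (4 * a.+1 + a.+1 ^ 2) * u)%N by ring.
  rewrite mulnA ltn_mul2r u_gt0 /=; nia.
have [theta [theta_e theta_q nconj adj bound]] :=
  extend_clique p_gt0 dvd_p TP AP pwT TA u_gt0 Ds le_s large (prime_gt1 pr_p).
exists theta, u, (D.+1 * cut)%N; split=> //; last first.
- by rewrite common_cons.
- by rewrite Ds leq_add2l.
split=> /=.
- by move=> t; rewrite inE => /predU1P[->|/plP //]; split.
- by rewrite -/T pwT andbT; apply/allP.
rewrite -/T pwA andbT; apply/allP => tau T_tau.
by rewrite -chiN opprB adj ?eqxx.
Qed.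

(** * Choice of the points and size of the clique *)

Section Selection.
Variables (R : rcfType) (m : nat).
Hypothesis m_gt0 : (0 < m)%N.
Hypothesis rad_m : forall p, prime p -> (p %| m)%N -> (p %| d)%N.
Hypothesis q_big1 : (1 < m)%N -> (12 * d ^ 2 * m ^ 2 < q)%N.
Hypothesis q_big2 : forall p1 p2, prime p1 -> prime p2 -> (p1 * p2 %| m)%N ->
  (20 * d ^ 2 * m ^ 2 < q)%N.

Local Notation x := (Num.sqrt q%:R : R).

Let x_gt0 : 0 < x. Proof. by rewrite sqrtr_gt0 ltr0n. Qed.
Let x_sq : x ^+ 2 = q%:R. Proof. by rewrite sqr_sqrtr ?ler0n. Qed.

(* A step adds an error of at most [5/4 * x] (for the first step, [51/50 * x])
   and divides the previous one by at least 2, hence [5/2 = 5/2/2 + 5/4]. *)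
Definition eps (k : nat) : R := match k with 0 => 0 | 1 => 51 / 50 | _ => 5 / 2 end.

Definition place_prod (pl : seq (F * nat)) := (\prod_(i <- unzip2 pl) i)%N.

Lemma sqrt_ge (c n : nat) : (c ^ 2 * n ^ 2 < q)%N -> c%:R * n%:R <= x.
Proof.
move=> lt_q; rewrite -(@ler_pXn2r _ 2) ?nnegrE ?mulr_ge0 ?ler0n ?(ltW x_gt0) //.
by rewrite x_sq -natrM -natrX ler_nat expnMn ltnW.
Qed.

Lemma select_first p : prime p -> (p %| m)%N ->
  exists theta, valid_places [:: (theta, p)] /\
    `|#|common [:: theta]|%:R - q%:R / p%:R| <= 51 / 50 * x.
Proof.
move=> pr_p dvd_pm; have p_gt1 := prime_gt1 pr_p; have p_gt0 := prime_gt0 pr_p.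
have dvd_pd := rad_m pr_p dvd_pm.
have le_pm := dvdn_leq m_gt0 dvd_pm; have le_pd := dvdn_leq d_gt0 dvd_pd.
have q_big := q_big1 (leq_trans p_gt1 le_pm).
have dm_ge : (p ^ 2 <= d * m)%N by rewrite -mulnn leq_mul.
have q_ge : (12 * (d * m) ^ 2 < q)%N by rewrite expnMn mulnA.
(* An integer at most the square root of q^p: it is q for p = 2, and for p >= 3 the bound 9 (d m)^2
   <= q gives 3 q d m <= q^(3/2). *)
pose s := (if p == 2 then q else 3 * q * (d * m))%N.
have le_s : (s ^ 2 <= q ^ p)%N.
  rewrite /s; case: eqP => [-> //|/eqP p_neq2].
  apply: (@leq_trans (q ^ 3)); last by rewrite leq_exp2l // ltn_neqAle eq_sym p_neq2.
  by apply: sqr_scale_bound; apply: leq_trans (ltnW q_ge); rewrite leq_mul2r orbT.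
have s_ge : (q <= s)%N.
  by rewrite /s; case: eqP => // _; rewrite mulnAC leq_pmull // !muln_gt0 d_gt0.
have valid0 : valid_places [::] by [].
have q_ge48 : (48 < q)%N.
  have : (2 ^ 2 <= d * m)%N by apply: leq_trans dm_ge; rewrite leq_exp2r.
  by move: q_ge; move: (d * m)%N => dm; clear; nia.
have [||theta [u [v [valid le_v le_u u_gt0 bound]]]] :=
    extend_places valid0 pr_p dvd_pd le_s.
- by rewrite /= !big_nil; lia.
- by rewrite /= card_common_nil; lia.
exists theta; split=> //; move: bound le_v le_u; rewrite /= !big_nil muln1 card_common_nil.
set b := #|common _| => bound le_v le_u.
have {}bound := ler_nat_of_int R p_gt0 bound.
have p_ge1 : 1 <= p%:R :> R by rewrite ler1n.
have u_gt0' : 0 < u%:R :> R by rewrite ltr0n.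
have q48 : 48 <= q%:R :> R by rewrite ler_nat ltnW.
have v1 : v%:R <= 1 :> R by rewrite lern1.
have c_ge0 : 0 <= 51 / 50 :> R by lra.
apply: deviation_transfer u_gt0' p_ge1 c_ge0 (ltW x_gt0) bound _.
rewrite [(p%:R * _) ^+ 2]exprMn [(_ * x) ^+ 2]exprMn x_sq -[_ * _ * u%:R]mulrA; move: le_u; rewrite /s; case: eqP => [->|/eqP p_neq2] le_u.
  have le_u' : q%:R <= u%:R + 1 :> R by rewrite natr1 ler_nat -addn1.
  have := moment_bound2_initial q48 v1 le_u'; set X := _ + _ * _; lra.
have p_ge3 : (3 <= p)%N by rewrite ltn_neqAle eq_sym p_neq2.
have w_ge9 : 9 <= (d * m)%:R :> R.
  by rewrite ler_nat; apply: leq_trans dm_ge; rewrite -[9%N]/(3 ^ 2)%N leq_exp2r.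
have le_u' : 3 * q%:R * (d * m)%:R <= u%:R + 1 :> R.
  by rewrite -!natrM [u%:R + 1]natr1 ler_nat; rewrite addn1 in le_u.
have := moment_bound3_initial q48 w_ge9 v1 le_u'.
set X := _ + _ * _ => leX.
have X_ge0 : 0 <= X by rewrite addr_ge0 ?mulr_ge0 ?ler0n // exprn_ge0.
apply: le_trans (_ : _ <= p%:R ^+ 2 * X) _.
  by rewrite ler_wpM2r // lerXn2r ?nnegrE ?subr_ge0 ?ler0n ?ler1n // gerBl ler01.
by rewrite ler_wpM2l ?exprn_ge0 ?ler0n.
Qed.

Lemma place_prod_ge (pl : seq (F * nat)) p : (0 < p)%N -> pl != [::] ->
  {in pl, forall t, (p <= t.2)%N} -> (p <= place_prod pl)%N.
Proof.
rewrite /place_prod; case: pl => // t pl p_gt0 _ le_p; rewrite big_cons.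
apply: leq_trans (le_p t (mem_head _ _)) _; rewrite leq_pmulr //.
have : {in pl, forall t, (p <= t.2)%N} by move=> t' pl_t'; apply: le_p; rewrite inE pl_t' orbT.
elim: pl {le_p} => [|t' pl IHpl] le_p; first by rewrite big_nil.
rewrite big_cons muln_gt0 (leq_trans p_gt0) ?le_p ?mem_head // IHpl // => t1 pl_t1.
by apply: le_p; rewrite inE pl_t1 orbT.
Qed.

Lemma select_next (pl : seq (F * nat)) p : pl != [::] -> valid_places pl -> prime p ->
  (place_prod pl * p %| m)%N -> {in pl, forall t, (p <= t.2)%N} ->
  `|#|common (unzip1 pl)|%:R - q%:R / (place_prod pl)%:R| <= 5 / 2 * x ->
  exists theta, valid_places ((theta, p) :: pl) /\
    `|#|common (theta :: unzip1 pl)|%:R - q%:R / (place_prod pl * p)%N%:R| <= 5 / 2 * x.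
Proof.
move=> pl_neq0 valid pr_p dvd_m le_p close.
set M := place_prod pl in dvd_m close *.
set a := #|common _| in close *.
have p_gt1 := prime_gt1 pr_p; have p_gt0 := prime_gt0 pr_p.
have dvd_pm : (p %| m)%N := dvdn_trans (dvdn_mull _ (dvdnn p)) dvd_m.
have dvd_pd := rad_m pr_p dvd_pm; have le_pd := dvdn_leq d_gt0 dvd_pd.
have le_Mpm := dvdn_leq m_gt0 dvd_m.
have M_ge : (p <= M)%N by apply: place_prod_ge.
have M_gt0 : (0 < M)%N := leq_trans p_gt0 M_ge.
have q_big : (20 * d ^ 2 * m ^ 2 < q)%N.
  have [t pl_t] : exists t, t \in pl by case: (pl) pl_neq0 => // t pl' _; exists t; rewrite mem_head.
  have [plP _ _] := valid; have [pr_t _ _ _] := plP t pl_t.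
  apply: (q_big2 pr_t pr_p); apply: dvdn_trans dvd_m; rewrite dvdn_mul //.
  by rewrite /M /place_prod big_map (big_rem t) //= dvdn_mulr.
have ge_p : all (leq p) (unzip2 pl) by rewrite all_map; apply/allP => t /le_p.
have ge_2 : all (leq 2) (unzip2 pl).
  by rewrite all_map; apply/allP => t /le_p; apply: leq_trans.
have ps_neq0 : unzip2 pl != [::] by case: (pl) pl_neq0.
(* [p] divides d and [M * p] divides m, whence q > 20 (p^2 M)^2. The factor p^2 yields q >= 320 M^2
   for p = 2 and x >= 40 M for p >= 3. *)
have dm_ge : (p ^ 2 * M <= d * m)%N.
  by rewrite -mulnn -mulnA leq_mul // mulnC.
have q_ge : (20 * (d * m) ^ 2 < q)%N by rewrite expnMn mulnA.
have qM : (20 * (p ^ 2 * M) ^ 2 < q)%N.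
  by apply: leq_ltn_trans q_ge; rewrite leq_mul2l leq_exp2r.
set V := ((\sum_(i <- unzip2 pl) place_degree p i).+1
            * \prod_(i <- unzip2 pl) (p * place_degree p i))%N.
have le_V2 : p = 2 -> (V <= 4 * M ^ 2)%N by rewrite /V => ->; apply: place_cut_bound2.
have le_V3 : (V <= 2 * M ^ 3)%N.
  apply: (@leq_trans (M.+1 * M ^ 2)).
    by rewrite leq_mul ?place_cut_bound // ltnS place_degree_bound.
  exact: cube_bound.
pose s := (if p == 2 then q else 3 * q * (d * m))%N.
have le_s : (s ^ 2 <= q ^ p)%N.
  rewrite /s; case: eqP => [-> //|/eqP p_neq2].
  apply: (@leq_trans (q ^ 3)); last by rewrite leq_exp2l // ltn_neqAle eq_sym p_neq2.
  by apply: sqr_scale_bound; apply: leq_trans (ltnW q_ge); rewrite leq_mul2r orbT.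
have le_V : (5 * V <= s)%N.
  rewrite /s; case: eqP => [p2|_].
    by apply: (scale_bound2 (le_V2 p2)); move: qM; rewrite p2.
  apply: (scale_bound3 le_V3) q_ge.
  by apply: leq_trans dm_ge; rewrite leq_pmull ?expn_gt0 ?p_gt0.
have x_ge : 16 * M%:R <= x.
  apply: (@sqrt_ge 16); apply: leq_ltn_trans qM; rewrite expnMn mulnA leq_mul2r.
  apply/orP; right; apply: (@leq_trans (20 * (2 ^ 2) ^ 2)) => //.
  by rewrite leq_mul2l -!expnM leq_exp2r.
have M_gt0' : 0 < M%:R :> R by rewrite ltr0n.
have M_ge2 : 2 <= M%:R :> R by rewrite ler_nat (leq_trans p_gt1).
have [lo_a hi_a] : x ^+ 2 - 5 / 2 * x * M%:R <= a%:R * M%:R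
                /\ a%:R * M%:R <= x ^+ 2 + 5 / 2 * x * M%:R.
  have : `|a%:R * M%:R - x ^+ 2| <= 5 / 2 * x * M%:R.
    have -> : a%:R * M%:R - x ^+ 2 = (a%:R - q%:R / M%:R) * M%:R.
      by rewrite mulrBl divfK ?gt_eqF // x_sq.
    by rewrite normrM (gtr0_norm M_gt0') ler_pM2r.
  by rewrite ler_norml => /andP[? ?]; split; lra.
have a_ge4 : (4 <= a)%N.
  rewrite -(ler_nat R); rewrite -(ler_pM2r M_gt0'); apply: le_trans lo_a; nra.
have [theta [u [v [valid' le_v le_u u_gt0 bound]]]] :=
  extend_places valid pr_p dvd_pd le_s le_V a_ge4.
exists theta; split=> //.
have {}bound := ler_nat_of_int R p_gt0 bound.
have p_ge1 : 1 <= p%:R :> R by rewrite ler1n.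
have u_gt0' : 0 < u%:R :> R by rewrite ltr0n.
have c_ge0 : 0 <= 5 / 4 :> R by lra.
have p_gt0' : 0 < p%:R :> R by rewrite ltr0n.
suff bound_b : `|#|common (theta :: unzip1 pl)|%:R - a%:R / p%:R| <= 5 / 4 * x.
  rewrite -[X in `|X|](subrKA (a%:R / p%:R)); apply: le_trans (ler_normD _ _) _.
  have -> : a%:R / p%:R - q%:R / (M * p)%N%:R = (a%:R - q%:R / M%:R) / p%:R :> R.
    by rewrite natrM; field; rewrite !gt_eqF.
  rewrite normrM [X in _ + _ * X]gtr0_norm ?invr_gt0 //.
  have : `|a%:R - q%:R / M%:R| / p%:R <= 5 / 4 * x.
    rewrite ler_pdivrMr //; apply: le_trans close _.
    have p_ge2 : 2 <= p%:R :> R by rewrite ler_nat.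
    have := x_gt0; nra.
  by move: bound_b; lra.
apply: deviation_transfer u_gt0' p_ge1 c_ge0 (ltW x_gt0) bound _.
move: le_u; rewrite /s; case: eqP => [p2|/eqP p_neq2] le_u.
  have le_v4 : v%:R <= 4 * M%:R ^+ 2 :> R.
    by rewrite -natrX -natrM ler_nat (leq_trans le_v) ?le_V2.
  have le_u4 : x ^+ 2 - 4 * M%:R ^+ 2 <= u%:R.
    by rewrite x_sq lerBlDr -natrX -natrM -natrD ler_nat (leq_trans le_u) // leq_add2l le_V2.
  have M320 : 320 * M%:R ^+ 2 <= x ^+ 2.
    by rewrite x_sq -natrX -natrM ler_nat; apply: sqr_bound2; move: qM; rewrite p2.
  have := moment_bound2 M_ge2 M320 x_gt0 (ler0n R a) hi_a (ler0n R v) le_v4 le_u4.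
  by rewrite {1 2}p2; lra.
have p_ge3 : (3 <= p)%N by rewrite ltn_neqAle eq_sym p_neq2.
have M_ge3 : 3 <= M%:R :> R by rewrite ler_nat (leq_trans p_ge3).
have p9 : (9 <= p ^ 2)%N by rewrite -[9%N]/(3 ^ 2)%N leq_exp2r.
have w_ge : 9 * M%:R <= (d * m)%:R :> R.
  by rewrite -natrM ler_nat; apply: leq_trans dm_ge; rewrite leq_mul2r p9 orbT.
have x_ge40 : 40 * M%:R <= x.
  apply: (@sqrt_ge 40); apply: leq_ltn_trans qM; rewrite expnMn mulnA leq_mul2r.
  by apply/orP; right; apply: (@leq_trans (20 * 9 ^ 2)); rewrite // leq_mul2l leq_exp2r.
have le_v2 : v%:R <= 2 * M%:R ^+ 3 :> R.
  by rewrite -natrX -natrM ler_nat (leq_trans le_v).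
have le_u' : 3 * x ^+ 2 * (d * m)%:R - 2 * M%:R ^+ 3 <= u%:R.
  by rewrite x_sq lerBlDr -natrX -!natrM -natrD ler_nat (leq_trans le_u) // leq_add2l //.
have := moment_bound3 M_ge3 w_ge x_ge40 (ler0n R a) hi_a (ler0n R v) le_v2 le_u'.
set X := _ + _ * _ => leX.
have X_ge0 : 0 <= X by rewrite addr_ge0 ?mulr_ge0 ?ler0n // exprn_ge0.
apply: le_trans (_ : _ <= p%:R ^+ 2 * X) _.
  by rewrite ler_wpM2r // lerXn2r ?nnegrE ?subr_ge0 ?ler0n ?ler1n // gerBl ler01.
by rewrite [(p%:R * _) ^+ 2]exprMn -[_ * _ * u%:R]mulrA ler_wpM2l ?exprn_ge0 ?ler0n.
Qed.

Lemma place_prod_cons t (pl : seq (F * nat)) : place_prod (t :: pl) = (t.2 * place_prod pl)%N.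
Proof. by rewrite /place_prod big_cons. Qed.

(** [n] is the part of [m] still to be used. Removing its largest prime factor each time keeps the
    primes of the list at least as large as those of [n]. *)
Lemma select_places (n : nat) (pl : seq (F * nat)) :
  valid_places pl -> (place_prod pl * n)%N = m ->
  (forall t p, t \in pl -> prime p -> (p %| n)%N -> (p <= t.2)%N) ->
  `|#|common (unzip1 pl)|%:R - q%:R / (place_prod pl)%:R| <= eps (size pl) * x ->
  exists pl', [/\ valid_places pl', place_prod pl' = m &
    `|#|common (unzip1 pl')|%:R - q%:R / m%:R| <= eps (size pl') * x].
Proof.
elim/ltn_ind: n pl => n IHn pl valid Dm le_pl close.
have n_gt0 : (0 < n)%N by move: m_gt0; rewrite -Dm muln_gt0 => /andP[].
have [n_gt1|n_le1] := ltnP 1 n; last first.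
  have n1 : n = 1%N by apply/eqP; rewrite eqn_leq n_le1.
  by exists pl; move: Dm close; rewrite n1 muln1 => ->.
set p := max_pdiv n; have pr_p : prime p := max_pdiv_prime n_gt1.
have [n' Dn] := dvdnP (max_pdiv_dvd n); rewrite -/p in Dn.
have n'_gt0 : (0 < n')%N by move: n_gt0; rewrite Dn muln_gt0 => /andP[].
have lt_n : (n' < n)%N by rewrite Dn ltn_Pmulr ?prime_gt1.
have le_p t : t \in pl -> (p <= t.2)%N by move=> pl_t; apply: le_pl => //; apply: max_pdiv_dvd.
have dvd_m : (place_prod pl * p %| m)%N by rewrite -Dm Dn dvdn_mul // dvdn_mull.
have [theta [valid' close']] : exists theta, valid_places ((theta, p) :: pl) /\
  `|#|common (theta :: unzip1 pl)|%:R - q%:R / (place_prod pl * p)%N%:R|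
     <= eps (size pl).+1 * x.
  have [pl0|pl_neq0] := eqVneq pl [::].
    have dvd_pm : (p %| m)%N by apply: dvdn_trans dvd_m; rewrite dvdn_mull.
    have [theta [valid1 close1]] := select_first pr_p dvd_pm.
    by exists theta; rewrite pl0 /place_prod /= big_nil mul1n.
  have [|theta [valid1 close1]] := select_next pl_neq0 valid pr_p dvd_m le_p.
    apply: le_trans close _; rewrite ler_wpM2r ?(ltW x_gt0) //.
    by rewrite /eps; case: (size pl) => [|[|k]]; lra.
  by exists theta; split=> //; move: close1; case: (pl) pl_neq0.
apply: (IHn n' lt_n ((theta, p) :: pl)) => //=.
- by rewrite place_prod_cons -Dm Dn /= mulnAC mulnA [RHS]mulnC mulnA mulnAC.
- move=> t p'; rewrite inE => /predU1P[->|pl_t] pr_p' dvd_p' /=.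
    by apply: max_pdiv_max; rewrite mem_primes pr_p' n_gt0 Dn dvdn_mulr.
  by apply: le_pl => //; rewrite Dn dvdn_mulr.
by rewrite place_prod_cons /= mulnC.
Qed.

Lemma exists_maximal_clique (T : finType) (adj : rel T) (C0 : {set T}) : clique adj C0 ->
  exists2 C : {set T}, C0 \subset C & maximal_clique adj C.
Proof.
pose P (C : {set T}) := [forall a in C, forall b in C, (a != b) ==> adj a b].
have cliqueP C : reflect (clique adj C) (P C).
  apply: (iffP idP) => [/'forall_in_'forall_in_implyP cl a b Ca Cb|cl]; first exact: cl.
  by apply/'forall_in_'forall_in_implyP => a Ca b Cb; apply: cl.
move/cliqueP=> /maxset_exists[C /maxsetP[/cliqueP clC maxC] sub]; exists C => //; split=> // v nCv clv.
have /cliqueP PvC := clv; have := maxC _ PvC (subsetUr _ _) => E.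
by case/negP: nCv; rewrite -E setU11.
Qed.

Lemma chi_in_places (T : seq F) : pairwise (fun a b => chi (a - b) == 1) T ->
  {in T &, forall a b, a != b -> chi (a - b) = 1}.
Proof.
move=> pwT a b Ta Tb neq_ab; pose e0 : rel F := fun a b => (a == b) || (chi (a - b) == 1).
have pw0 : pairwise e0 T by apply: sub_pairwise pwT => u v /= uv; rewrite /e0 uv orbT.
have refl0 : reflexive e0 by move=> u; rewrite /e0 eqxx.
have sym0 : symmetric e0 by move=> u v; rewrite /e0 eq_sym -chiN opprB.
rewrite pairwise_all2rel // in pw0.
by have /allrelP/(_ a b Ta Tb) := pw0; rewrite /e0 (negPf neq_ab) => /eqP.
Qed.

Hypothesis d_gt1 : (1 < d)%N.
Local Notation P := (paley F d).

(** For m = 1 the allowed error is log_r 1 = 0, so the empty list must give |C| = q exactly, hence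
    the separate clause. In the last clause [t] counts Frobenius classes, each of at most d
    points. *)
Lemma clique_of_places (pl : seq (F * nat)) : valid_places pl ->
  exists C : {set F}, [/\ maximal_clique P C,
    (#|common (unzip1 pl)| <= #|C|)%N,
    pl = [::] -> (d.-1 ^ 2 < q)%N -> #|C| = q &
    exists t, (#|C| <= #|common (unzip1 pl)| + d * t)%N /\
      ((t * #|common (unzip1 pl)| - q) ^ 2 <= (t * (2 * d).-1) ^ 2 * q)%N].
Proof.
case=> plP _ pwA; set T := unzip1 pl in pwA *; set A := common T.
have T_q : {in T, forall tau, tau ^+ q != tau} by move=> _ /mapP[t /plP[_ _ _ ?] ->].
have A_q : {in A, forall a, a ^+ q = a} by move=> a; rewrite inE => /andP[/eqP].
have A_T : {in A & T, forall a tau, chi (a - tau) = 1}.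
  by move=> a tau; rewrite inE => /andP[_ /allP aT] /aT /eqP.
have adjE a b : P a b = (chi (a - b) == 1) by apply: paleyE.
have clC0 : clique P (A :|: [set tau in T]).
  move=> a b; rewrite !in_setU ![_ \in [set _ in T]]inE adjE => a_ b_ neq_ab; apply/eqP.
  case/orP: a_ => [Aa|Ta]; case/orP: b_ => [Ab|Tb].
  - by apply: chi_frob_fix; rewrite ?A_q.
  - exact: A_T.
  - by rewrite -chiN opprB A_T.
  - exact: (chi_in_places pwA).
have [C sub0 [clC maxC]] := exists_maximal_clique clC0.
have sub_A : A \subset C by apply: subset_trans sub0; rewrite subsetUl.
have sub_T : {subset T <= C}.
  by move=> tau T_tau; apply: (subsetP sub0); rewrite in_setU inE T_tau orbT.
have chi_C : {in C &, forall a b, a != b -> chi (a - b) = 1}.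
  by move=> a b Ca Cb /(clC a b Ca Cb); rewrite adjE => /eqP.
pose B := [set a in C | a ^+ q != a].
have DC : C = A :|: B.
  apply/setP => a; rewrite in_setU [a \in B]inE; case: (boolP (a \in C)) => [Ca|nCa].
    case: (boolP (a ^+ q == a)) => [a_q|]; rewrite ?orbT ?orbF //=; apply/esym.
    rewrite inE a_q; apply/allP => tau T_tau; apply/eqP/chi_C => //; first exact: sub_T.
    by apply/eqP => Da; move: a_q; rewrite Da; apply/negP/T_q.
  by rewrite orbF; apply/esym/negP => /(subsetP sub_A); apply/negP.
have card_C : (#|C| <= #|A| + #|B|)%N by rewrite DC cardsU leq_subr.
have chi_AB : {in B & A, forall b a, chi (a - b) = 1}.
  move=> b a; rewrite inE => /andP[Cb b_q] Aa; apply: chi_C => //; first exact: (subsetP sub_A).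
  by apply: contra b_q => /eqP<-; rewrite A_q.
exists C; split=> //; first exact: subset_leq_card.
  move=> pl0 lt_q; have B0 : B = set0.
    apply/setP => b; rewrite in_set0; apply/negP => Bb; move: lt_q; apply/negP; rewrite -leqNgt.
    have b_q : b ^+ q != b by move: Bb; rewrite inE => /andP[].
    apply: card_le_of_frob_fix_neighbor b_q _ => a a_q; apply: chi_AB => //.
    by rewrite inE a_q eqxx /T pl0.
  by rewrite DC B0 setU0 /A /T pl0 card_common_nil.
have [Th [subTh pwTh repTh]] := qconj_representatives (enum B).
exists (size Th); split.
  apply: leq_trans card_C _; rewrite leq_add2l; apply: card_qconj_classes => b Bb.
  by apply: repTh; rewrite mem_enum.
have Th_B b : b \in Th -> b \in B by move/subTh; rewrite mem_enum.
apply: common_neighbors_bound => //.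
  by move=> b /Th_B; rewrite inE => /andP[].
by move=> b a /Th_B Bb; apply: chi_AB.
Qed.

(** Cancelling t (2 d - 1) x leaves t g d x <= x^2, so the at most d t points outside the subfield
    number at most x / g. *)
Lemma class_count_bound (al t g : R) : 0 <= t ->
  t * al <= x ^+ 2 + t * ((2 * d%:R - 1) * x) -> (g * d%:R + (2 * d%:R - 1)) * x <= al ->
  g * (d%:R * t) <= x.
Proof.
move=> t_ge0 le_t le_al; rewrite -(ler_pM2r x_gt0).
have : t * ((g * d%:R + (2 * d%:R - 1)) * x) <= t * al by rewrite ler_wpM2l.
by move: le_t; set A := t * al; rewrite -expr2; lra.
Qed.

Lemma maximal_clique_size (L : R) : 0 <= L ->
  (forall p, prime p -> (p %| m)%N -> 1 <= L) ->
  (forall p1 p2, prime p1 -> prime p2 -> (p1 * p2 %| m)%N -> 2 <= L) ->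
  (m = 1%N -> (d.-1 ^ 2 < q)%N) ->
  exists C : {set F}, [/\ maximal_clique P C,
    q%:R / m%:R - d%:R * L * x <= #|C|%:R & #|C|%:R <= q%:R / m%:R + d%:R * L * x].
Proof.
move=> L_ge0 L_ge1 L_ge2 q_m1.
have valid0 : valid_places [::] by [].
have [|||pl [valid Dm close]] := select_places valid0 (n := m).
- by rewrite /place_prod big_nil mul1n.
- by [].
- by rewrite /place_prod /= big_nil divr1 mul0r card_common_nil subrr normr0.
have [C [maxC le_A C_q [t [le_C le_t]]]] := clique_of_places valid.
have d_ge2 : 2 <= d%:R :> R by rewrite ler_nat.
have m_gt0' : 0 < m%:R :> R by rewrite ltr0n.
set al := #|common _| in le_A le_C le_t close.
have le_tR : t%:R * al%:R <= x ^+ 2 + t%:R * ((2 * d%:R - 1) * x).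
  have D2 : (2 * d).-1%:R = 2 * d%:R - 1 :> R by rewrite -subn1 natrB ?muln_gt0 // natrM.
  have ge0 : 0 <= t%:R * ((2 * d%:R - 1) * x) by rewrite -D2 !mulr_ge0 ?ler0n ?(ltW x_gt0).
  have [le_q|lt_q] := leqP (t * al) q.
    by rewrite -[X in X <= _]addr0 lerD // x_sq -natrM ler_nat.
  have D1 : t%:R * al%:R - q%:R = (t * al - q)%N%:R :> R by rewrite natrB ?(ltnW lt_q) // natrM.
  rewrite -lerBlDl x_sq D1 -(@ler_pXn2r _ 2) ?nnegrE ?ler0n //.
  have -> : (t%:R * ((2 * d%:R - 1) * x)) ^+ 2 = ((t * (2 * d).-1) ^ 2 * q)%N%:R.
    by rewrite natrM natrX natrM D2 -[q%:R in RHS]x_sq; ring.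
  by rewrite -natrX ler_nat.
have le_CR : #|C|%:R <= al%:R + d%:R * t%:R :> R by rewrite -natrM -natrD ler_nat.
have le_AR : al%:R <= #|C|%:R :> R by rewrite ler_nat.
(* [kap] bounds x / (d m) from below, [c * x] is the error in the number of common neighbours, and x
   / g bounds the points outside the subfield. The last condition fits both errors into d L x. *)
have main kap c g : kap * (d * m)%N%:R <= x -> 0 < g -> 0 <= c ->
    `|al%:R - q%:R / m%:R| <= c * x -> g * d%:R + (2 * d%:R - 1) <= kap * d%:R - c ->
    c + g^-1 <= d%:R * L ->
    q%:R / m%:R - d%:R * L * x <= #|C|%:R /\ #|C|%:R <= q%:R / m%:R + d%:R * L * x.
  move=> le_kap g_gt0 c_ge0; rewrite ler_norml => /andP[lo hi] le_g le_L.
  have le_Lx : (c + g^-1) * x <= d%:R * L * x by rewrite ler_wpM2r ?(ltW x_gt0).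
  have gx_ge0 : 0 <= g^-1 * x by rewrite mulr_ge0 ?invr_ge0 ?(ltW g_gt0) ?(ltW x_gt0).
  have lo_q : kap * d%:R * x <= q%:R / m%:R.
    rewrite ler_pdivlMr // -[X in _ <= X]x_sq expr2.
    have -> : kap * d%:R * x * m%:R = kap * (d * m)%N%:R * x by rewrite natrM; ring.
    by rewrite ler_wpM2r ?(ltW x_gt0).
  have le_al : (g * d%:R + (2 * d%:R - 1)) * x <= al%:R.
    apply: le_trans (_ : (kap * d%:R - c) * x <= _); first by rewrite ler_wpM2r ?(ltW x_gt0).
    by lra.
  have := class_count_bound (ler0n R t) le_tR le_al.
  rewrite -(ler_pM2l (_ : 0 < g^-1)) ?invr_gt0 // mulKf ?gt_eqF // => le_dt.
  by split; lra.
have sqrt_bound (n : nat) (kap : R) : 0 <= kap -> kap ^+ 2 <= n%:R ->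
    (n * d ^ 2 * m ^ 2 < q)%N -> kap * (d * m)%N%:R <= x.
  move=> kap_ge0 le_n lt_q.
  rewrite -(@ler_pXn2r _ 2) ?nnegrE ?mulr_ge0 ?ler0n ?(ltW x_gt0) // x_sq exprMn.
  apply: le_trans (_ : n%:R * (d * m)%N%:R ^+ 2 <= _).
    by rewrite ler_wpM2r ?exprn_ge0 ?ler0n.
  by rewrite -natrX -natrM ler_nat expnMn mulnA ltnW.
have dL_ge0 : 0 <= d%:R * L * x by rewrite !mulr_ge0 ?ler0n ?(ltW x_gt0).
have prime_of t0 : t0 \in pl -> prime t0.2 by have [plP _ _] := valid; move=> /plP[].
suff [] : q%:R / m%:R - d%:R * L * x <= #|C|%:R /\ #|C|%:R <= q%:R / m%:R + d%:R * L * x.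
  by exists C.
case Dpl: pl => [|t1 [|t2 pl']] in Dm close prime_of C_q.
- have m1 : m = 1%N by rewrite -Dm /place_prod big_nil.
  rewrite C_q // ?q_m1 // m1 divr1; split; first by rewrite gerBl.
  by rewrite lerDl.
- have dvd_m : (t1.2 %| m)%N by rewrite -Dm place_prod_cons dvdn_mulr.
  have pr1 : prime t1.2 by apply: prime_of; rewrite mem_head.
  have L1 := L_ge1 _ pr1 dvd_m.
  have q_big : (12 * d ^ 2 * m ^ 2 < q)%N.
    by apply: q_big1; apply: leq_trans (prime_gt1 pr1) (dvdn_leq m_gt0 dvd_m).
  (* 17/5 is below sqrt 12, and 51/50 is the error after one step. The largest [g] then allowed for
     d = 2 is 139/100, and 51/50 + 100/139 < 2 <= d L. *)
  apply: (main (17 / 5) (51 / 50) (139 / 100)) close _ _; try lra.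
    by apply: (sqrt_bound 12) q_big; lra.
  have : 2 <= d%:R * L by nra.
  by lra.
have dvd_m : (t1.2 * t2.2 %| m)%N by rewrite -Dm !place_prod_cons mulnA dvdn_mulr.
have pr1 : prime t1.2 by apply: prime_of; rewrite mem_head.
have pr2 : prime t2.2 by apply: prime_of; rewrite !inE eqxx orbT.
have L2 := L_ge2 _ _ pr1 pr2 dvd_m.
(* 22/5 is below sqrt 20, 165/100 is again the largest [g] allowed for d = 2, and 5/2 + 100/165 < 4
   <= d L. *)
apply: (main (22 / 5) (5 / 2) (165 / 100)) close _ _; try lra.
  by apply: (sqrt_bound 20) (q_big2 pr1 pr2 dvd_m); lra.
have : 4 <= d%:R * L by nra.
by lra.
Qed.

End Selection.

End PaleyCharacter.

Lemma dvdn_of_rad p m d : (0 < m)%N -> (radn m %| radn d)%N -> prime p -> (p %| m)%N -> (p %| d)%N.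
Proof.
move=> m_gt0 dvd_rad pr_p dvd_pm.
have : (p %| radn d)%N.
  apply: dvdn_trans dvd_rad; rewrite /radn (big_rem p) ?dvdn_mulr //=.
  by rewrite mem_primes pr_p m_gt0.
rewrite /radn big_seq Euclid_dvd_prod // big_has_cond.
case/hasP => t _ /andP[]; rewrite mem_primes => /and3P[pr_t _ dvd_td].
by rewrite dvdn_prime2 // => /eqP->.
Qed.

Theorem theorem1p4 (R : realType) (d m q : nat) (F : finFieldType)
    (hd : (2 <= d)%N) (hm : (0 < m)%N) (hrad : (radn m %| radn d)%N)
    (hq : prime_power q) (hqodd : odd q) (hqd : (q = 1 %[mod d])%N)
    (hF : #|F| = (q ^ d)%N)
    (hbig : (8 * logb (pdiv d)%:R m%:R + 4) * d%:R ^+ 2 * m%:R ^+ 2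
            < q%:R :> R) :
  exists C : {set F},
    [/\ maximal_clique (paley F d) C,
        q%:R / m%:R - d%:R * logb (pdiv d)%:R m%:R * Num.sqrt q%:R
          <= #|C|%:R :> R
      & #|C|%:R <= q%:R / m%:R
                   + d%:R * logb (pdiv d)%:R m%:R * (Num.sqrt q%:R + 1) :> R].
Proof.
set L := logb _ _ in hbig *.
have d_gt0 : (0 < d)%N := ltnW hd.
have [p [k [pr_p k_gt0 Dq]]] := hq.
have q_gt1 : (1 < q)%N by rewrite Dq -[X in (X < _)%N](exp1n k) ltn_exp2r ?prime_gt1.
have q_pchar : [pchar F].-nat q.
  rewrite Dq pnatX pnatE //; apply/orP; left.
  by apply: (@card_finPcharP _ _ (k * d)) => //; rewrite hF Dq expnM.
have dvd_dq : (d %| q.-1)%N by rewrite -subn1 -eqn_mod_dvd 1?ltnW //; apply/eqP.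
have [z prim_z] : exists z : F, d.-primitive_root z.
  apply: exists_prim_root d_gt0 _; rewrite hF.
  exact: dvdn_trans dvd_dq (dvdn_pred_predX _ _).
have [w prim_w] := C_prim_root_exists d_gt0.
have pr_r : prime (pdiv d) := pdiv_prime hd.
have ln_r_gt0 : 0 < ln (pdiv d)%:R :> R by rewrite ln_gt0 // ltr1n prime_gt1.
(* Prime factors of m divide d, so they are at least r = [pdiv d]: each contributes at least 1 to
   log_r m. *)
have L_ge n : ((pdiv d) ^ n <= m)%N -> n%:R <= L.
  move=> le_m; rewrite /L /logb ler_pdivlMr // mulr_natl -lnXn ?ltr0n ?prime_gt0 //.
  rewrite -natrX ler_ln ?ler_nat // posrE ltr0n // expn_gt0 prime_gt0 // orbT.
have L_ge0 : 0 <= L by apply: (L_ge 0).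
have rad_m t : prime t -> (t %| m)%N -> (t %| d)%N by apply: dvdn_of_rad.
have r_le t : prime t -> (t %| m)%N -> (pdiv d <= t)%N.
  by move=> pr_t /(rad_m t pr_t); apply: pdiv_min_dvd; apply: prime_gt1.
have L_ge1 t : prime t -> (t %| m)%N -> 1 <= L.
  by move=> pr_t dvd_t; apply: (L_ge 1); rewrite expn1 (leq_trans (r_le t pr_t dvd_t)) // dvdn_leq.
have L_ge2 t1 t2 : prime t1 -> prime t2 -> (t1 * t2 %| m)%N -> 2 <= L.
  move=> pr1 pr2 dvd_m; apply: (L_ge 2); apply: leq_trans (dvdn_leq hm dvd_m).
  rewrite -mulnn leq_mul //; apply: r_le => //; apply: dvdn_trans dvd_m.
    by rewrite dvdn_mulr.
  by rewrite dvdn_mull.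
(* 8 L + 4 is at least 12 if m has a prime factor, at least 20 if it has two, and at least 4 in any
   case. *)
have q_big (n : nat) : n%:R <= 8 * L + 4 -> (n * d ^ 2 * m ^ 2 < q)%N.
  move=> le_n; rewrite -(ltr_nat R); apply: le_lt_trans hbig; rewrite natrM [(n * _)%:R]natrM !natrX.
  by rewrite !ler_wpM2r ?exprn_ge0 ?ler0n.
have q_big1 : (1 < m)%N -> (12 * d ^ 2 * m ^ 2 < q)%N.
  move=> m_gt1; apply: q_big; have := L_ge1 _ (pdiv_prime m_gt1) (pdiv_dvd m); lra.
have q_big2 t1 t2 : prime t1 -> prime t2 -> (t1 * t2 %| m)%N -> (20 * d ^ 2 * m ^ 2 < q)%N.
  by move=> pr1 pr2 dvd_m; apply: q_big; have := L_ge2 _ _ pr1 pr2 dvd_m; lra.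
have q_m1 : m = 1%N -> (d.-1 ^ 2 < q)%N.
  move=> m1; have : (4 * d ^ 2 * m ^ 2 < q)%N by apply: q_big; lra.
  apply: leq_ltn_trans; rewrite m1 exp1n muln1; apply: (@leq_trans (d ^ 2)).
    by rewrite leq_exp2r // leq_pred.
  by rewrite leq_pmull.
have [C [maxC lo hi]] := maximal_clique_size q_pchar q_gt1 hqodd d_gt0 hF dvd_dq prim_z prim_w
  hm rad_m q_big1 q_big2 hd L_ge0 L_ge1 L_ge2 q_m1.
exists C; split=> //; apply: le_trans hi _; rewrite lerD2l ler_wpM2l //.
  by rewrite mulr_ge0 ?ler0n.
by rewrite lerDl ler01.
Qed.
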